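(* Let $\mathcal{A}$ be a hyperplane arrangement in $V=\mathbb{K}^\ell$, $H\in\mathcal{A}$, and $\mathcal{A}'=\mathcal{A}\setminus\{H\}$. If $\mathcal{A}$ and $\mathcal{A}'$ are both tame, and $\mathcal{A}$ is locally free along $H$, then $\mathcal{A}^H$ is tame.
   Context: Let $\mathbb{K}$ be a field, $V=\mathbb{K}^\ell$, $S=\mathbb{K}[x_1,\ldots,x_\ell]$ the coordinate ring of $V$. An arrangement $\mathcal{A}$ in $V$ is a finite set of linear hyperplanes of $V$; for each $H\in\mathcal{A}$ fix a linear form $\alpha_H\in V^*$ with $H=\ker\alpha_H$, and put $Q(\mathcal{A})=\prod_{H\in\mathcal{A}}\alpha_H$. Let $\Omega^1_V=\bigoplus_{i=1}^\ell S\,dx_i$ and $\Omega^p_V=\wedge^p\Omega^1_V$. For $0\le p\le\ell$ the module of logarithmic $p$-forms is $$\Omega^p(\mathcal{A})=\{\omega\in \tfrac{1}{Q(\mathcal{A})}\Omega^p_V \mid Q(\mathcal{A})\,d\alpha_H\wedge\omega\in\alpha_H\Omega^{p+1}_V\ (\forall H\in\mathcal{A})\}.$$ $\mathcal{A}$ is free if $\Omega^1(\mathcal{A})$ is a free $S$-module (of rank $\ell$). $\mathcal{A}$ is tame if $\mathrm{pd}_S\,\Omega^p(\mathcal{A})\le p$ for all $0\le p\le\ell$, where $\mathrm{pd}_S$ is projective dimension over $S$. For $x\in V$ let $\mathcal{A}_x=\{L\in\mathcal{A}\mid x\in L\}$ (an arrangement in $V$). For $X\subset V$, $\mathcal{A}$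 is locally free along $X$ if $\mathcal{A}_x$ is free for all $0\ne x\in X$. For $H\in\mathcal{A}$, the restriction $\mathcal{A}^H=\{H\cap L\mid L\in\mathcal{A}\setminus\{H\}\}$ is an arrangement in $H\cong\mathbb{K}^{\ell-1}$, whose logarithmic forms and tameness are defined over $\overline{S}=S/\alpha_HS$. *)

(* Defs.v *)
From HB Require Import structures.
From mathcomp Require Import all_boot all_order all_algebra.
From mathcomp Require Import finmap mpoly boolp zify.

Set Implicit Arguments.
Unset Strict Implicit.
Unset Printing Implicit Defensive.

Import GRing.Theory.
Local Open Scope ring_scope.

(* Classical logic ([boolp]) is used only to turn the S-submodule of
   logarithmic forms into a boolean predicate, hence into an [lmodType]. *)

Section Modules.
Variable S : nzRingType.

Definition projective (P : lmodType S) : Prop :=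
  forall (M N : lmodType S) (g : {linear M -> N}) (f : {linear P -> N}),
    (forall y : N, exists x : M, g x = y) ->
    exists h : {linear P -> M}, forall x : P, g (h x) = f x.

(* pd_S M <= n: there is an exact sequence
   0 -> P_n -> ... -> P_1 -> P_0 -> M -> 0 with all P_i projective,
   presented as an infinite resolution with P_i = 0 for i > n. *)
Definition pd_le (n : nat) (M : lmodType S) : Prop :=
  exists (P : nat -> lmodType S)
         (d : forall i, {linear P i.+1 -> P i}) (e : {linear P 0 -> M}),
  [/\ forall i, projective (P i),
      forall m : M, exists x : P 0, e x = m,
      forall x : P 0, e x = 0 <-> exists y, d 0 y = x,
      forall i (x : P i.+1), d i x = 0 <-> exists y, d i.+1 y = x
    & forall i, (n < i)%N -> forall x : P i, x = 0].

Definition free_of_rank (n : nat) (M : lmodType S) : Prop :=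
  exists b : 'I_n -> M, forall x : M,
    exists! c : {ffun 'I_n -> S}, x = \sum_(i < n) c i *: b i.

End Modules.

(* Differential forms on K^l with rational coefficients: w I is the coefficient
   of dx_(i_1) /\ ... /\ dx_(i_p), where I = {i_1 < ... < i_p}; all degrees
   p = 0, ..., l are gathered in a single type. *)
Definition ratform (K : fieldType) (l : nat) : Type :=
  {ffun {set 'I_l} -> {fraction {mpoly K[l]}}}.

Section RationalForms.
Variables (K : fieldType) (l : nat).
Local Notation S := {mpoly K[l]}.
Local Notation form := (ratform K l).

HB.instance Definition _ := GRing.Zmodule.copy form
  {ffun {set 'I_l} -> {fraction S}}.

Definition scale_form (f : S) (w : form) : form := [ffun I => tofrac f * w I].

Fact scale_formA f g w : scale_form f (scale_form g w) = scale_form (f * g) w.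
Proof. by apply/ffunP => I; rewrite !ffunE mulrA tofracM. Qed.

Fact scale_form1 : left_id 1 scale_form.
Proof. by move=> w; apply/ffunP => I; rewrite !ffunE tofrac1 mul1r. Qed.

Fact scale_formDr : right_distributive scale_form +%R.
Proof. by move=> f w v; apply/ffunP => I; rewrite !ffunE mulrDr. Qed.

Fact scale_formDl w : {morph scale_form^~ w : f g / f + g}.
Proof. by move=> f g; apply/ffunP => I; rewrite !ffunE tofracD mulrDl. Qed.

HB.instance Definition _ := GRing.Zmodule_isLmodule.Build S form
  scale_formA scale_form1 scale_formDr scale_formDl.

(* The sign is that of the shuffle sorting the elements of I followed by those
   of J :\: I. *)
Definition wedge (w v : form) : form :=
  [ffun J : {set 'I_l} => \sum_(I : {set 'I_l} | I \subset J)
     (-1) ^+ #|[set u : 'I_l * 'I_l |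
                 [&& u.1 \in I, u.2 \in J :\: I & (u.2 < u.1)%N]]|
     * (w I * v (J :\: I))].

Definition dpoly (f : S) : form :=
  [ffun I : {set 'I_l} => \sum_(i < l | I == [set i]) tofrac (mderiv i f)].

(* w lies in Omega^p_V: homogeneous of degree p with polynomial coefficients. *)
Definition regular_form (p : nat) (w : form) : Prop :=
  forall I : {set 'I_l},
    (#|I| != p -> w I = 0) /\ exists f : S, w I = tofrac f.

Fact regular_form0 p : regular_form p 0.
Proof.
by move=> I; rewrite ffunE; split=> //; exists 0; rewrite tofrac0.
Qed.

Fact regular_formP p f w v :
  regular_form p w -> regular_form p v -> regular_form p (f *: w + v).
Proof.
move=> rw rv I; have [w0 [a aE]] := rw I; have [v0 [b bE]] := rv I.
rewrite !ffunE; split=> [Ip|]; first by rewrite w0 // v0 // mulr0 addr0.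
by exists (f * a + b); rewrite aE bE tofracD tofracM.
Qed.

Fact wedge0 u : wedge u 0 = 0.
Proof.
by apply/ffunP => J; rewrite !ffunE big1 // => I _; rewrite ffunE !mulr0.
Qed.

Fact wedgeP u f w v : wedge u (f *: w + v) = f *: wedge u w + wedge u v.
Proof.
apply/ffunP => J; rewrite !ffunE big_distrr -big_split /=.
apply: eq_bigr => I _; rewrite !ffunE !mulrDr; congr (_ + _).
by rewrite [RHS]mulrCA; congr (_ * _); rewrite mulrCA.
Qed.

End RationalForms.

Section Arrangements.
Variables (K : fieldType) (l : nat).
Local Notation V := 'rV[K]_l.
Local Notation S := {mpoly K[l]}.
Local Notation form := (ratform K l).

Definition hyperplane (H : {vspace V}) : bool := (\dim H).+1 == l.

Definition arrangement (A : {fset {vspace V}}) : Prop :=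
  forall H, H \in A -> hyperplane H.

Fact linear_form_subproof (H : {vspace V}) :
  exists a : 'Hom(V, K^o), hyperplane H ==> (lker a == H).
Proof.
case hH: (hyperplane H); last by exists 0.
have dC : \dim (H^C)%VS = 1%N.
  by rewrite dimv_compl dimvf dim_matrix mul1r -[X in (X - _)%N](eqP hH) subSnn.
pose W := (H^C)%VS; pose i0 : 'I_(\dim W) := cast_ord (esym dC) ord0.
have dWH : (W :&: H = 0)%VS by rewrite capvC; apply: capv_compl.
pose a : 'Hom(V, K^o) := 
  (linfun (coord (vbasis W) i0 : V -> K^o) \o daddv_pi W H)%VF.
exists a; apply/eqP/vspaceP => x; rewrite memv_ker comp_lfunE lfunE.
have xWH : x \in (W + H)%VS by rewrite addvC addv_complf memvf.
rewrite -{2}(daddv_pi_add dWH xWH).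
have pW : daddv_pi W H x \in W by apply: memv_pi.
have pH : daddv_pi H W x \in H by apply: memv_pi.
rewrite rpredDr //.
apply/eqP/idP => [c0|pxH].
  have -> : daddv_pi W H x = 0; last exact: mem0v.
  rewrite (coord_vbasis pW) big1 // => i _.
  have -> : i = i0 by apply: val_inj; case: i => -[|k] //=; rewrite dC.
  by rewrite [coord _ _ _]c0 scale0r.
have : daddv_pi W H x \in (W :&: H)%VS by rewrite memv_cap pW.
by rewrite dWH memv0 => /eqP ->; rewrite linear0.
Qed.

(* A chosen linear form alpha_H with kernel H (junk if H is not a
   hyperplane). *)
Definition linear_form (H : {vspace V}) : 'Hom(V, K^o) :=
  xchoose (linear_form_subproof H).

Definition alpha (H : {vspace V}) : S :=
  \sum_(i < l) (linear_form H (delta_mx 0 i) : K) *: 'X_i.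

Definition defpoly (A : {fset {vspace V}}) : S := \prod_(H <- A) alpha H.

Definition log_form (A : {fset {vspace V}}) (p : nat) (w : form) : Prop :=
  regular_form p (defpoly A *: w) /\
  forall H, H \in A -> exists2 v : form, regular_form p.+1 v &
    defpoly A *: wedge (dpoly (alpha H)) w = alpha H *: v.

Definition log_pred (A : {fset {vspace V}}) (p : nat) : {pred form} :=
  fun w => `[< log_form A p w >].

Fact log_pred_submod A p : submod_closed (log_pred A p).
Proof.
split=> [|f w v]; rewrite /in_mem /=.
  apply/asboolP; split=> [|H _]; first by rewrite scaler0; apply: regular_form0.
  by exists 0; rewrite ?wedge0 ?scaler0 //; apply: regular_form0.
move=> /asboolP[rw hw] /asboolP[rv hv]; apply/asboolP; split=> [|H HA].
  by rewrite scalerDr !scalerA mulrC -scalerA; apply: regular_formP.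
have [w' rw' ew] := hw H HA; have [v' rv' ev] := hv H HA.
exists (f *: w' + v'); first exact: regular_formP.
by rewrite wedgeP !scalerDr ev !scalerA ![_ * f]mulrC -!scalerA ew.
Qed.

HB.instance Definition _ A p :=
  GRing.isSubmodClosed.Build S form (log_pred A p) (log_pred_submod A p).

Definition Omega (A : {fset {vspace V}}) (p : nat) : Type :=
  {w : form | w \in log_pred A p}.

HB.instance Definition _ A p := SubChoice.on (Omega A p).
HB.instance Definition _ A p :=
  [SubChoice_isSubLmodule of (Omega A p) by <:].

Definition free_arr (A : {fset {vspace V}}) : Prop :=
  free_of_rank l (Omega A 1 : lmodType S).

Definition tame (A : {fset {vspace V}}) : Prop :=
  forall p, (p <= l)%N -> pd_le p (Omega A p : lmodType S).

Definition localization (A : {fset {vspace V}}) (x : V) : {fset {vspace V}} :=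
  [fset L in A | x \in L]%fset.

Definition locally_free_along (A : {fset {vspace V}}) (X : {pred V}) : Prop :=
  forall x, x \in X -> x != 0 -> free_arr (localization A x).

Definition restriction (A : {fset {vspace V}}) (H : {vspace V}) :
    {fset {vspace V}} :=
  [fset (H :&: L)%VS | L in (A `\ H)%fset]%fset.

End Arrangements.

(* B is an arrangement in the subspace W of K^l, and is transported to K^(\dim W)
   along linear coordinates phi : K^(\dim W) ~ W, which also identify the
   coordinate ring of W with {mpoly K[\dim W]}. All choices of phi are
   considered; they differ by linear changes of variables. *)
Definition tame_in (K : fieldType) (l : nat) (W : {vspace 'rV[K]_l})
    (B : {fset {vspace 'rV[K]_l}}) : Prop :=
  forall phi : 'Hom('rV[K]_(\dim W), 'rV[K]_l),
    lker phi = 0%VS -> limg phi = W ->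
    tame [fset (phi @^-1: M)%VS | M in B]%fset.

(* Sanity checks: the choices made above are never junk or vacuous. *)

Lemma lker_linear_form (K : fieldType) (l : nat) (H : {vspace 'rV[K]_l}) :
  hyperplane H -> lker (linear_form H) = H.
Proof. by move=> hH; have /implyP/(_ hH)/eqP := xchooseP (linear_form_subproof H). Qed.

Lemma coordinates_exist (K : fieldType) (l : nat) (W : {vspace 'rV[K]_l}) :
  exists2 phi : 'Hom('rV[K]_(\dim W), 'rV[K]_l),
    lker phi = 0%VS & limg phi = W.
Proof.
pose f (r : 'rV[K]_(\dim W)) := \sum_i r 0 i *: (vbasis W)`_i.
have fL : linear f.
  move=> a r s; rewrite /f scaler_sumr -big_split /=.
  by apply: eq_bigr => i _; rewrite !mxE scalerDl scalerA.
pose fl := HB.pack_for {linear 'rV[K]_(\dim W) -> 'rV[K]_l} f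
  (GRing.isLinear.Build _ _ _ _ f fL).
have flE r : linfun fl r = f r by rewrite lfunE.
exists (linfun fl).
  apply/eqP; rewrite -subv0; apply/subvP => r; rewrite memv_ker flE memv0 => /eqP r0.
  apply/eqP/rowP => i; rewrite mxE.
  by have /freeP := basis_free (vbasisP W); apply.
apply/vspaceP => x; apply/memv_imgP/idP => [[r _ ->]|xW].
  by rewrite flE; apply: memv_suml => i _; apply/memvZ/vbasis_mem/mem_nth; rewrite size_tuple.
exists (\row_i coord (vbasis W) i x); rewrite ?memvf // flE {1}(coord_vbasis xW).
by apply: eq_bigr => i _; rewrite mxE.
Qed.

Lemma restriction_arrangement (K : fieldType) (l : nat)
    (A : {fset {vspace 'rV[K]_l}}) (H : {vspace 'rV[K]_l})
    (phi : 'Hom('rV[K]_(\dim H), 'rV[K]_l)) :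
  arrangement A -> H \in A -> lker phi = 0%VS -> limg phi = H ->
  arrangement [fset (phi @^-1: M)%VS | M in restriction A H]%fset.
Proof.
move=> hA HA k0 im _ /imfsetP[/= _ /imfsetP[/= L + ->] ->].
rewrite !inE => /andP[LH /hA /eqP dL]; have /eqP dH := hA _ HA.
have M_im : (H :&: L <= limg phi)%VS by rewrite im capvSl.
have -> : hyperplane (phi @^-1: (H :&: L))%VS =
    ((\dim (H :&: L)).+1 == \dim H).
  rewrite /hyperplane -[in RHS](lpreimK M_im) limg_dim_eq //.
  by rewrite k0 capv0.
have dS := dimv_sum_cap H L.
have : (\dim (H + L) <= l)%N.
  by apply: leq_trans (dimvS (subvf _)) _; rewrite dimvf dim_matrix mul1r.
have : (\dim H < \dim (H + L))%N.
  rewrite ltnNge; apply: contra LH => dHL; rewrite eq_sym.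
  have e : H = (H + L)%VS by apply/eqP; rewrite eqEdim addvSl dHL.
  by rewrite eq_sym eqEdim {1}e addvSr /=; lia.
lia.
Qed.

(* Main.v *)
(* Multiplying by Q identifies Omega^p(A) with the module N(A) of polynomial
   p-forms w such that alpha_L divides d(alpha_L) /\ w for all L in A.  An
   element of N(A') restricts to 0 on H if and only if it lies in N(A), so
   restriction to H, divided by the factor by which the restriction of Q(A')
   exceeds Q(A^H), gives an exact sequence 0 -> N(A) -> N(A') -> N(A^H).  The
   image I of the last map has projective dimension at most p + 1 over S, because
   both arrangements are tame.  When A_x is free, the last map is onto for A_x;
   local freeness along H thus makes N(A^H) / I supported at the origin.  For
   p <= l - 3 the Koszul cohomology of I vanishes in degree 1, which forces
   N(A^H) = I.  Hence pd N(A^H) <= p + 1 over S, and passing from S to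
   S / alpha_H lowers this bound by one.  For p >= l - 2 the bound follows from
   Hilbert's syzygy theorem, N(A^H) being a submodule of a free module. *)
Require Import Defs.
From HB Require Import structures.
From mathcomp Require Import boolp classical_sets functions.
From mathcomp Require Import all_boot all_order all_algebra.
From mathcomp Require Import finmap mpoly zify ring.

Set Implicit Arguments.
Unset Strict Implicit.
Unset Printing Implicit Defensive.

Import GRing.Theory.
Local Open Scope ring_scope.

(** Local freeness speaks only of points with coordinates in K, an arbitrary field. This suffices
    because, for z in N(A^H), the multipliers t with t z in I include, for each point y <> 0 of H,
    the product of the forms of the traces missing y; such products replace localization. For a free
    arrangement, a basis of logarithmic 1-forms and its dual vector fields show that N(A) is Q(A)
    times the exterior algebra on that basis, so that divisibility by Q(A^H) can be tested on
    coefficients, one trace at a time. The restriction of Q(A') exceeds Q(A^H) because several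
    hyperplanes may meet H in the same trace; the residue z of w is encoded without division, by
    Q(A^H) w|_H = Q(A')|_H z. The bound p <= l - 3 says that 1 < l - (p + 1), the range in which
    Koszul cohomology of a module of projective dimension p + 1 vanishes; torsion-freeness of N(A^H)
    takes care of degree 0. Projective modules are treated as retracts of iterated polynomial
    extensions, on which every variable acts as a shift, and the passage to S / alpha_H uses a
    first-order deformation in the normal direction. *)

Section LinearMaps.
Variable S : nzRingType.

Definition mklin (M N : lmodType S) (f : M -> N) (fL : linear f) :
    {linear M -> N} :=
  HB.pack_for {linear M -> N} f (GRing.isLinear.Build _ _ _ _ f fL).

Record submodule (M : lmodType S) := Submodule {
  sm_pred : {pred M};
  sm_closed : submod_closed sm_pred }.

HB.instance Definition _ (M : lmodType S) (U : submodule M) :=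
  GRing.isSubmodClosed.Build S M (sm_pred U) (sm_closed U).

Definition sub_mod (M : lmodType S) (U : submodule M) : Type :=
  {x : M | x \in sm_pred U}.

HB.instance Definition _ M U := SubChoice.on (@sub_mod M U).
HB.instance Definition _ M U :=
  [SubChoice_isSubLmodule of (@sub_mod M U) by <:].

Lemma submodule_subproof (M : lmodType S) (P : M -> Prop) :
  P 0 -> (forall a x y, P x -> P y -> P (a *: x + y)) ->
  submod_closed (fun x => `[< P x >]).
Proof.
move=> P0 PD; split=> [|a x y]; rewrite /in_mem /=; first exact/asboolP.
by move=> /asboolP Px /asboolP Py; apply/asboolP/PD.
Qed.

Definition mksub (M : lmodType S) (P : M -> Prop) P0 PD :=
  Submodule (@submodule_subproof M P P0 PD).

Definition sub_incl (M : lmodType S) (U : submodule M) (x : sub_mod U) : M :=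
  val x.

Fact sub_incl_linear (M : lmodType S) (U : submodule M) :
  linear (@sub_incl M U).
Proof. by move=> a x y; rewrite /sub_incl linearP. Qed.

HB.instance Definition _ (M : lmodType S) (U : submodule M) :=
  GRing.isLinear.Build S (sub_mod U) M _ (@sub_incl M U)
    (@sub_incl_linear M U).

Definition to_sub (M : lmodType S) (U : submodule M) (x : M)
  (Ux : x \in sm_pred U) : sub_mod U := exist _ x Ux.

Lemma sub_incl_inj (M : lmodType S) (U : submodule M) :
  injective (@sub_incl M U).
Proof. exact: val_inj. Qed.

Lemma ker_closed (M N : lmodType S) (g : {linear M -> N}) :
  submod_closed (fun x : M => g x == 0).
Proof.
split=> [|a x y]; rewrite /in_mem /= ?linear0 ?eqxx //.
by move=> /eqP gx /eqP gy; rewrite linearP gx gy scaler0 addr0.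
Qed.

Definition ker (M N : lmodType S) (g : {linear M -> N}) : lmodType S :=
  sub_mod (Submodule (ker_closed g)).

Lemma kerP (M N : lmodType S) (g : {linear M -> N}) (x : ker g) :
  g (sub_incl x) = 0.
Proof. by apply/eqP/(valP x). Qed.

Lemma ker_ex (M N : lmodType S) (g : {linear M -> N}) x :
  g x = 0 -> exists y : ker g, sub_incl y = x.
Proof. by move=> /eqP gx; exists (exist _ x gx). Qed.

End LinearMaps.

(** * Projective dimension *)

Section ProjectiveDimension.
Variable S : nzRingType.
Implicit Types M N A B C P Q W X Y : lmodType S.

Definition surj (T T' : Type) (g : T -> T') : Prop := forall y, exists x, g x = y.

Lemma lin_factor A B X (f : {linear A -> B}) (h : {linear X -> B}) :
  injective f -> (forall x, exists a, f a = h x) ->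
  exists k : {linear X -> A}, forall x, f (k x) = h x.
Proof.
move=> fI /choice[k kE].
have kL : linear k.
  by move=> a x y; apply: fI; rewrite kE !linearP !kE.
by exists (mklin kL) => x; rewrite -kE.
Qed.

Lemma lin_descend B C X (g : {linear B -> C}) (h : {linear B -> X}) :
  surj g -> (forall b, g b = 0 -> h b = 0) ->
  exists k : {linear C -> X}, forall b, k (g b) = h b.
Proof.
move=> /choice[s sE] gh.
have hE b c : g b = c -> h (s c) = h b.
  move=> e; apply/eqP; rewrite -subr_eq0 -linearB gh //.
  by rewrite linearB sE e subrr.
have kL : linear (h \o s).
  by move=> a x y /=; rewrite (hE (a *: s x + s y)) ?linearP // !sE.
by exists (mklin kL) => b /=; apply: hE.
Qed.

Lemma projective_retract A P (i : {linear A -> P}) (r : {linear P -> A}) :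
  projective P -> (forall a, r (i a) = a) -> projective A.
Proof.
move=> pP ri M N g f gS; have [h hE] := pP M N g (f \o r) gS.
by exists (h \o i) => x /=; rewrite hE /= ri.
Qed.

Lemma projective_prod P Q :
  projective P -> projective Q -> projective (P * Q)%type.
Proof.
move=> pP pQ M N g f gS.
have fP : linear (fun p : P => f (p, 0)).
  by move=> a x y; rewrite -linearP; congr (f (_, _)); rewrite /= scaler0 addr0.
have fQ : linear (fun q : Q => f (0, q)).
  by move=> a x y; rewrite -linearP; congr (f (_, _)); rewrite /= scaler0 addr0.
have [h1 h1E] := pP M N g (mklin fP) gS.
have [h2 h2E] := pQ M N g (mklin fQ) gS.
have hL : linear (fun x : P * Q => h1 x.1 + h2 x.2).
  by move=> a x y /=; rewrite !linearP scalerDr addrACA.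
exists (mklin hL) => -[p q] /=; rewrite linearD h1E h2E /= -linearD.
by congr (f (_, _)); rewrite /= ?addr0 ?add0r.
Qed.

Definition ses A B C (f : {linear A -> B}) (g : {linear B -> C}) : Prop :=
  [/\ injective f, surj g & forall b, g b = 0 <-> exists a, f a = b].

Lemma ses_ker B C (g : {linear B -> C}) : surj g -> ses (@sub_incl _ _ _ : {linear ker g -> B}) g.
Proof.
move=> gS; split=> [|//|b]; first exact: sub_incl_inj.
by split=> [/ker_ex//|[a <-]]; rewrite kerP.
Qed.

(** Inductive form of [pd_le]: one projective cover is exposed at a time, and its kernel carries the
    rest of the resolution. The cover is existential; [pdl_mid], [pdl_left] and [pdl_right] take the
    place of independence of the resolution. *)
Fixpoint pdl (n : nat) M : Prop :=
  if n is m.+1 then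
    exists P (g : {linear P -> M}), [/\ projective P, surj g & pdl m (ker g)]
  else projective M.

Lemma lin_inv M N (f : {linear M -> N}) : injective f -> surj f ->
  exists k : {linear N -> M}, cancel f k /\ cancel k f.
Proof.
move=> fI fS.
have [k kE] := @lin_factor M N N f (idfun : {linear N -> N}) fI fS.
by exists k; split=> [x|//]; apply: fI; rewrite kE.
Qed.

Lemma pdl_iso n M N (f : {linear M -> N}) :
  injective f -> surj f -> pdl n M -> pdl n N.
Proof.
elim: n M N f => [|n IH] M N f fI fS /=.
  have [k [fK kK]] := lin_inv fI fS.
  by move=> pM; apply: (@projective_retract N M k f).
case=> P [g [pP gS pK]].
exists P, (f \o g : {linear P -> N}); split=> // [y|].
  by have [m <-] := fS y; have [x <-] := gS m; exists x.
have [|x|k kE] := @lin_factor (ker (f \o g : {linear P -> N})) P (ker g)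
  (@sub_incl _ _ _) (@sub_incl _ _ _).
- exact: sub_incl_inj.
- by apply: ker_ex; rewrite /= kerP linear0.
apply: (IH _ _ k) pK.
  by move=> x y e; apply: sub_incl_inj; rewrite -!kE e.
move=> y; have [|x xE] := @ker_ex _ _ _ g (sub_incl y).
  by apply: fI; rewrite linear0; apply: (kerP y).
by exists x; apply: sub_incl_inj; rewrite kE.
Qed.
End ProjectiveDimension.

Section ExactSequences.
Variable S : nzRingType.
Implicit Types M N A B C P Q W X Y : lmodType S.

Lemma pdl_cover n A P C (f : {linear A -> P}) (g : {linear P -> C}) :
  ses f g -> projective P -> pdl n A -> pdl n.+1 C.
Proof.
move=> [fI gS ex] pP pA; exists P, g; split=> //.
have [|x|k kE] := @lin_factor _ (ker g) P A (@sub_incl _ _ _) f.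
- exact: sub_incl_inj.
- by apply/ker_ex/ex; exists x.
apply: (pdl_iso (f := k)) pA.
  by move=> x y e; apply: fI; rewrite -!kE e.
move=> y; have /ex[x xE] := kerP y.
by exists x; apply: sub_incl_inj; rewrite kE.
Qed.

Lemma ses_split A B C (f : {linear A -> B}) (g : {linear B -> C})
    (s : {linear C -> B}) :
  ses f g -> (forall c, g (s c) = c) ->
  exists r : {linear B -> A}, (forall a, r (f a) = a) /\
    forall b, f (r b) + s (g b) = b.
Proof.
move=> [fI gS ex] sE.
have [//|x|r rE] := @lin_factor _ A B B f (idfun \- (s \o g) : {linear B -> B}).
  by apply/ex; rewrite /= linearB sE subrr.
exists r; split=> [a|b]; last by rewrite rE /= subrK.
apply: fI; rewrite rE /=; suff -> : g (f a) = 0 by rewrite linear0 subr0.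
by apply/ex; exists a.
Qed.

Lemma ses_section A B C (f : {linear A -> B}) (g : {linear B -> C}) :
  ses f g -> projective C -> exists s : {linear C -> B}, forall c, g (s c) = c.
Proof. by move=> [_ gS _] pC; apply: (pC B C g idfun gS). Qed.

Lemma pairD_linear A P B (f : {linear A -> B}) (h : {linear P -> B}) :
  linear (fun x : A * P => f x.1 + h x.2).
Proof. by move=> a x y /=; rewrite !linearP scalerDr addrACA. Qed.

Lemma pair_linear A P B (f : {linear A -> B}) (h : {linear A -> P}) :
  linear (fun x : A => (f x, h x)).
Proof. by move=> a x y /=; rewrite !linearP. Qed.

Lemma fst_linear A B : linear (fun x : A * B => x.1).
Proof. by []. Qed.

Lemma snd_linear A B : linear (fun x : A * B => x.2).
Proof. by []. Qed.

(** Horseshoe lemma: with [q'] a lift of [q] to [B], the map (x, y) |-> f (p x) + q' y covers [B],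
    and its kernel is an extension of [ker q] by [ker p]. *)
Lemma pdl_mid n A B C (f : {linear A -> B}) (g : {linear B -> C}) :
  ses f g -> pdl n A -> pdl n C -> pdl n B.
Proof.
elim: n A B C f g => [|n IH] A B C f g fg.
  move=> pA pC; have [s sE] := ses_section fg pC.
  have [r [rf rE]] := ses_split fg sE.
  apply: (@projective_retract _ B (A * C)%type (mklin (pair_linear r g))
    (mklin (pairD_linear f s))); first exact: projective_prod.
  by move=> b /=; rewrite rE.
move=> [P [p [pP pS pK]]] [Q [q [pQ qS qK]]]; have [fI gS ex] := fg.
have [q' q'E] := pQ B C g q gS.
have gf a : g (f a) = 0 by apply/ex; exists a.
pose r := mklin (pairD_linear (f \o p) q').
have rS : surj r.
  move=> b; have [y yE] := qS (g b).
  have [|a aE] := (ex (b - q' y)).1; first by rewrite linearB q'E yE subrr.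
  by have [x xE] := pS a; exists (x, y); rewrite /= xE aE subrK.
exists (P * Q)%type, r; split=> //; first exact: projective_prod.
have inL : linear (fun x : P => (x, 0 : Q)).
  by move=> a x y; congr (_, _); rewrite /= scaler0 addr0.
have [|x|u uE] := @lin_factor _ (ker r) (P * Q)%type (ker p) (@sub_incl _ _ _)
    (mklin inL \o (@sub_incl _ _ _)).
- exact: sub_incl_inj.
- by apply: ker_ex; rewrite /= kerP !linear0 addr0.
have [|x|v vE] := @lin_factor _ (ker q) Q (ker r) (@sub_incl _ _ _)
    (mklin (@snd_linear P Q) \o (@sub_incl _ _ _)).
- exact: sub_incl_inj.
- apply: ker_ex; rewrite /= -q'E.
  have := congr1 g (kerP x); rewrite /= linearD gf add0r linear0; exact: id.
have uv : ses u v.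
  split=> [x y e|y|b].
  - apply: sub_incl_inj; have := congr1 (fun z => sub_incl z) e.
    by rewrite !uE => -[].
  - have := q'E (sub_incl y); rewrite kerP => /ex[a aE].
    have [x xE] := pS a.
    have [|z zE] := @ker_ex _ _ _ r (- x, sub_incl y).
      by rewrite /= linearN xE linearN aE addNr.
    by exists z; apply: sub_incl_inj; rewrite vE /= zE.
  split=> [e|[x <-]]; last by apply: sub_incl_inj; rewrite vE /= uE linear0.
  have b2 : (sub_incl b).2 = 0 by rewrite -[LHS]/(mklin (@snd_linear P Q) (sub_incl b)) -[LHS]vE e linear0.
  have [|x xE] := @ker_ex _ _ _ p (sub_incl b).1.
    by apply: fI; have := kerP b; rewrite /= b2 !linear0 addr0.
  exists x; apply: sub_incl_inj; rewrite uE /= xE.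
  by case: (sub_incl b) b2 => b1 b2' /= ->.
exact: IH uv pK qK.
Qed.

Lemma projective_triv M : (forall x : M, x = 0) -> projective M.
Proof.
move=> M0 X Y g f _; have zL : linear (fun _ : M => 0 : X).
  by move=> a x y; rewrite scaler0 addr0.
by exists (mklin zL) => x; rewrite linear0 (M0 x) linear0.
Qed.

Lemma pdl_mono n M : pdl n M -> pdl n.+1 M.
Proof.
elim: n M => [|n IH] M; last first.
  by case=> P [g [pP gS pK]]; exists P, g; split=> //; apply: IH.
move=> pM; exists M, (idfun : {linear M -> M}); split=> // [y|]; first by exists y.
by apply: projective_triv => x; apply: sub_incl_inj; have := kerP x; rewrite /= linear0.
Qed.

Lemma pdl_leq m n M : (m <= n)%N -> pdl m M -> pdl n M.
Proof.
by move=> /subnK <-; elim: (n - m)%N => [//|k IH] /IH; apply: pdl_mono.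
Qed.

(** For a cover [q] of the product, the part of [Q] lying over A is a direct summand of [Q], because
    P splits off; it covers A with the same kernel as [q]. *)
Lemma pdl_summand n A P : projective P -> pdl n (A * P)%type -> pdl n A.
Proof.
move=> pP; case: n => [|n].
  have iL : linear (fun a : A => (a, 0 : P)).
    by move=> a x y; congr (_, _); rewrite /= scaler0 addr0.
  by move=> pAP; apply: (@projective_retract _ A (A * P)%type (mklin iL)
    (mklin (@fst_linear A P))).
case=> Q [q [pQ qS pK]].
pose q1 := mklin (@fst_linear A P) \o q; pose q2 := mklin (@snd_linear A P) \o q.
have q2S : surj q2 by move=> y; have [x xE] := qS (0, y); exists x; rewrite /q2 /= xE.
have s2 := ses_ker q2S; have [s sE] := ses_section s2 pP.
have [r [rf rE]] := ses_split s2 sE.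
have pQ' : projective (ker q2) by apply: (projective_retract pQ rf).
have [|x|u uE] := @lin_factor _ (ker q2) Q (ker q) (@sub_incl _ _ _) (@sub_incl _ _ _).
- exact: sub_incl_inj.
- by apply: ker_ex; rewrite /= kerP.
apply: (@pdl_cover n (ker q) (ker q2) A u (q1 \o (@sub_incl _ _ _))) => //.
split=> [x y e|a|b].
- by apply: sub_incl_inj; rewrite -!uE e.
- have [x xE] := qS (a, 0).
  have [|y yE] := @ker_ex _ _ _ q2 x; first by rewrite /q2 /= xE.
  by exists y; rewrite /q1 /= yE xE.
split=> [e|[x <-]]; last by rewrite /q1 /= uE kerP.
have [|x xE] := @ker_ex _ _ _ q (sub_incl b).
  by move: e (kerP b); rewrite /q1 /q2 /=; case: (q _) => ? ? /= -> ->.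
by exists x; apply: sub_incl_inj; rewrite uE.
Qed.

(** Lifting a cover P -> C to [p'] : P -> B makes the product of A and P surject onto B, with kernel
    isomorphic to [ker p]. Hence this product, and with it A, has projective dimension at most n. *)
Lemma pdl_left n A B C (f : {linear A -> B}) (g : {linear B -> C}) :
  ses f g -> pdl n B -> pdl n.+1 C -> pdl n A.
Proof.
move=> [fI gS ex] pB [P [p [pP pS pK]]].
apply: (pdl_summand pP); have [p' p'E] := pP B C g p gS.
have gf a : g (f a) = 0 by apply/ex; exists a.
pose r := mklin (pairD_linear f p').
have [//|x|t tE] := @lin_factor _ A B (ker p) f (p' \o (@sub_incl _ _ _)).
  by apply/ex; rewrite /= p'E kerP.
pose u := mklin (pair_linear (\- t : {linear ker p -> A}) (@sub_incl _ _ _ : {linear ker p -> P})).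
apply: (@pdl_mid n (ker p) (A * P)%type B u r) => //.
split=> [x y|b|[a x]].
- by case=> _ e; apply: sub_incl_inj.
- have [x xE] := pS (g b).
  have /ex[a aE] : g (b - p' x) = 0 by rewrite linearB p'E xE subrr.
  by exists (a, x); rewrite /= aE subrK.
split=> [e|[y [<- <-]]]; last by rewrite /= linearN tE /= addNr.
have [|y yE] := @ker_ex _ _ _ p x.
  by have := congr1 g e; rewrite /= linearD gf add0r p'E linear0.
exists y; congr (_, _); rewrite //=.
apply: fI; rewrite linearN tE /= yE.
by have /eqP := e; rewrite /= addrC addr_eq0 => /eqP->; rewrite opprK.
Qed.

(** A cover of B also covers C, and the new kernel is an extension of A by [ker p]. *)
Lemma pdl_right n A B C (f : {linear A -> B}) (g : {linear B -> C}) :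
  ses f g -> pdl n A -> pdl n.+1 B -> pdl n.+1 C.
Proof.
move=> [fI gS ex] pA [P [p [pP pS pK]]].
pose q := g \o p : {linear P -> C}.
have qS : surj q.
  by move=> c; have [b <-] := gS c; have [x <-] := pS b; exists x.
exists P, q; split=> //.
have [|x|u uE] := @lin_factor _ (ker q) P (ker p) (@sub_incl _ _ _) (@sub_incl _ _ _).
- exact: sub_incl_inj.
- by apply: ker_ex; rewrite /= kerP linear0.
have [//|x|v vE] := @lin_factor _ A B (ker q) f (p \o (@sub_incl _ _ _)).
  by apply/ex; have := kerP x.
apply: (@pdl_mid n (ker p) (ker q) A u v) => //; split=> [x y e|a|b].
- by apply: sub_incl_inj; rewrite -!uE e.
- have [x xE] := pS (f a); have [|y yE] := @ker_ex _ _ _ q x.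
    by rewrite /= xE; apply/ex; exists a.
  by exists y; apply: fI; rewrite vE /= yE.
split=> [e|[x <-]]; last by apply: fI; rewrite vE /= uE kerP linear0.
have [|x xE] := @ker_ex _ _ _ p (sub_incl b).
  by have := vE b; rewrite e linear0.
by exists x; apply: sub_incl_inj; rewrite uE.
Qed.

Lemma pd_le_pdl n M : pd_le n M -> pdl n M.
Proof.
elim: n M => [|n IH] M [P [d [e [pP eS e0 dd P0]]]].
  (* For n = 0 the vanishing of [P 1] makes the augmentation injective. *)
  apply: (@pdl_iso _ 0 (P 0) M e) => //; last exact: pP.
  move=> x y exy; apply/eqP; rewrite -subr_eq0.
  have /e0[z <-] : e (x - y) = 0 by rewrite linearB exy subrr.
  by rewrite (P0 1%N isT z) linear0.
exists (P 0), e; split=> //.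
have [|x|k kE] := @lin_factor _ (ker e) (P 0) (P 1) (@sub_incl _ _ _) (d 0).
- exact: sub_incl_inj.
- by apply/ker_ex/e0; exists x.
apply: IH; exists (fun i => P i.+1), (fun i => d i.+1), k.
split=> [i|y|x|i x|i ni x] //; last exact: P0.
- have /e0[z zE] := kerP y.
  by exists z; apply: sub_incl_inj; rewrite kE.
rewrite -dd -kE; split=> [->|e1]; first by rewrite linear0.
by apply: sub_incl_inj; rewrite e1 linear0.
Qed.

Lemma pdl_pd_le n M : pdl n M -> pd_le n M.
Proof.
elim: n M => [|n IH] M.
  move=> pM.
  pose Z := ker (idfun : {linear M -> M}).
  have Z0 (x : Z) : x = 0 by apply: sub_incl_inj; have := kerP x; rewrite /= linear0.
  pose P (i : nat) : lmodType S := if i is _.+1 then Z else M.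
  have zL X : linear (fun _ : Z => 0 : X) by move=> a x y; rewrite scaler0 addr0.
  exists P, (fun i => mklin (@zL (P i))), (idfun : {linear M -> M}).
  split=> [i|m|x|i x|[//|i] _ x].
  - by case: i => // i; apply: projective_triv.
  - by exists m.
  - by split=> [/= ->|[y <-]//]; exists 0.
  - by split=> _; [exists 0; rewrite linear0 (Z0 x)|case: i x => [|i] x; rewrite ?(Z0 x) linear0].
  - exact: (Z0 x).
case=> Q [g [pQ gS /IH[P [d [e [pP eS e0 dd P0]]]]]].
pose P' (i : nat) : lmodType S := if i is j.+1 then P j else Q.
pose d' (i : nat) : {linear P' i.+1 -> P' i} :=
  if i is j.+1 then d j else @sub_incl _ _ _ \o e.
exists P', d', g; split=> [[|i]|m|x|[|i] x|[//|i] ni x] //=.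
- split=> [/ker_ex[y <-]|[y <-]]; last by rewrite /= kerP.
  by have [z <-] := eS y; exists z.
- rewrite -e0; split=> [e1|->]; last by rewrite linear0.
  by apply: sub_incl_inj; rewrite linear0.
- exact: dd.
- exact: (P0 i ni x).
Qed.
End ExactSequences.

(** * Koszul complexes *)

Section Koszul.
Variable R : comNzRingType.
Implicit Types (s : seq R) (M N A B C P : lmodType R).

(** The Koszul cochain complex of M on s as an iterated mapping cone: adjoining a forms the cone of
    multiplication by a. All degrees live in one module, of which [Khd] picks out the homogeneous
    parts. *)
Fixpoint Kz s M : lmodType R :=
  if s is _ :: s' then (Kz s' M * Kz s' M)%type else M.

Fixpoint Kd s M : Kz s M -> Kz s M :=
  if s is a :: s' then fun c => (Kd c.1, a *: c.1 - Kd c.2) else fun=> 0.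

(* Cohomological degrees are shifted by one: [Khd i.+1] is degree [i]. *)
Fixpoint Khd s M (i : nat) : Kz s M -> Prop :=
  if s is _ :: s' then fun c => Khd i c.1 /\ Khd i.-1 c.2
  else fun c => i != 1%N -> c = 0.

Fixpoint Kmap s M N (f : M -> N) : Kz s M -> Kz s N :=
  if s is _ :: s' then fun c => (Kmap f c.1, Kmap f c.2) else f.

Definition acyc s M (i : nat) : Prop :=
  forall c : Kz s M, Khd i.+1 c -> Kd c = 0 -> exists2 b, Khd i b & Kd b = c.

Lemma KdB s M (x y : Kz s M) : Kd (x - y) = Kd x - Kd y.
Proof.
elim: s M x y => [|a s IH] M x y /=; first by rewrite subr0.
by rewrite !IH scalerBr -[RHS]/(_, _) /= !opprD addrACA.
Qed.

Lemma Kd0 s M : Kd (0 : Kz s M) = 0.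
Proof. by rewrite -{1}(subrr 0) KdB subrr. Qed.

Lemma KdD s M (x y : Kz s M) : Kd (x + y) = Kd x + Kd y.
Proof.
by rewrite -[in LHS](opprK y) KdB -[- y]sub0r KdB Kd0 sub0r opprK.
Qed.

Lemma KdZ s M a (x : Kz s M) : Kd (a *: x) = a *: Kd x.
Proof.
elim: s M x => [|b s IH] M x /=; first by rewrite scaler0.
rewrite !IH; congr (_, _); rewrite /= scalerBr !scalerA mulrC //.
Qed.

Lemma Kdd s M (x : Kz s M) : Kd (Kd x) = 0.
Proof.
elim: s M x => [//|a s IH] M x /=.
by rewrite IH KdB KdZ IH subr0 subrr.
Qed.

Lemma Khd0 s M i : Khd i (0 : Kz s M).
Proof. by elim: s i => [//|a s IH] i /=. Qed.

Lemma KhdP s M i a (x y : Kz s M) : Khd i x -> Khd i y -> Khd i (a *: x + y).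
Proof.
elim: s i x y => [|b s IH] i x y /=.
  by move=> x0 y0 ni; rewrite x0 // y0 // scaler0 addr0.
by move=> [x1 x2] [y1 y2]; split; apply: IH.
Qed.

Lemma KhdB s M i (x y : Kz s M) : Khd i x -> Khd i y -> Khd i (x - y).
Proof. by move=> hx hy; rewrite addrC -scaleN1r; apply: KhdP. Qed.

Lemma KhdZ s M i a (x : Kz s M) : Khd i x -> Khd i (a *: x).
Proof. by move=> hx; rewrite -[_ *: _]addr0; apply: KhdP => //; apply: Khd0. Qed.

Lemma KhdN s M i (x : Kz s M) : Khd i x -> Khd i (- x).
Proof. by move=> hx; rewrite -scaleN1r; apply: KhdZ. Qed.

Lemma Khd_triv s M (x : Kz s M) : Khd 0 x -> x = 0.
Proof.
elim: s x => [|a s IH] /=; first by move=> x ->.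
by case=> x y /= [/IH-> /IH->].
Qed.

Lemma Khd_Kd s M i (x : Kz s M) : Khd i x -> Khd i.+1 (Kd x).
Proof.
elim: s i x => [//|a s IH] i [x y] /= [hx hy]; split; first exact: IH.
apply: KhdB; first exact: KhdZ.
case: i hx hy => [|i] _ hy; last exact: IH.
by rewrite (Khd_triv hy) Kd0; apply: Khd0.
Qed.

Section Kmap.
Variables (s : seq R) (M N : lmodType R) (f : M -> N).
Hypothesis fB : forall x y, f (x - y) = f x - f y.

Lemma Kmap_f0 : f 0 = 0.
Proof. by rewrite -{1}(subrr 0) fB subrr. Qed.

Lemma KmapB (x y : Kz s M) : Kmap f (x - y) = Kmap f x - Kmap f y.
Proof. by elim: s x y => [//|a s' IH] [x1 x2] [y1 y2] /=; rewrite !IH. Qed.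

Lemma Kmap0 : Kmap f (0 : Kz s M) = 0.
Proof. by rewrite -{1}(subrr 0) KmapB subrr. Qed.

Lemma Kmap_hd i (x : Kz s M) : Khd i x -> Khd i (Kmap f x).
Proof.
elim: s i x => [|a s' IH] i x /=; first by move=> x0 ni; rewrite x0 // Kmap_f0.
by move=> [h1 h2]; split; apply: IH.
Qed.

Lemma Kmap_surj i (y : Kz s N) : surj f -> Khd i y ->
  exists2 x, Khd i x & Kmap f x = y.
Proof.
move=> fS; elim: s i y => [|a s' IH] i /= y.
  have [_ _|ni ->//] := eqVneq i 1%N.
    by have [x xE] := fS y; exists x.
  by exists 0 => //; apply: Kmap_f0.
move=> [/IH[x1 h1 e1] /IH[x2 h2 e2]]; exists (x1, x2) => //=.
by rewrite e1 e2; case: (y).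
Qed.

Lemma Kmap_inj (x : Kz s M) : injective f -> Kmap f x = 0 -> x = 0.
Proof.
move=> fI; elim: s x => [|a s' IH] /= x; first by rewrite -Kmap_f0 => /fI.
by case: x => x y /= [/IH-> /IH->].
Qed.
End Kmap.

(** The differential sees only the scalars in s. Maps such as taking the constant term of a
    polynomial commute with those scalars without being linear over the whole ring. *)
Lemma Kmap_Kd s M N (f : M -> N) (x : Kz s M) :
  (forall x y, f (x - y) = f x - f y) ->
  (forall a x, a \in s -> f (a *: x) = a *: f x) ->
  Kd (Kmap f x) = Kmap f (Kd x).
Proof.
move=> fB; elim: s x => [|a s IH] x fZ /=; first by rewrite Kmap_f0.
have fZs b y : b \in s -> f (b *: y) = b *: f y.
  by move=> bs; apply: fZ; rewrite inE bs orbT.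
rewrite !IH // KmapB //; congr (_, _ - _).
have: forall y, f (a *: y) = a *: f y by move=> y; apply: fZ; rewrite inE eqxx.
move: (x.1) => y fZa {IH fZ fZs x}.
by elim: s y => [|b s IH] y /=; rewrite ?fZa // -!IH.
Qed.

Lemma Kmap_exact s A B C (f : A -> B) (g : B -> C) i (c : Kz s B) :
  f 0 = 0 -> (forall b, g b = 0 -> exists a, f a = b) ->
  Khd i c -> Kmap g c = 0 -> exists2 x, Khd i x & Kmap f x = c.
Proof.
move=> f0 ex; elim: s i c => [|a s IH] i /=.
  move=> c; have [_ _ /ex[x xE]|ni ->// _] := eqVneq i 1%N; first by exists x.
  by exists 0.
move=> [c1 c2] /= [h1 h2] [q1 q2]; have [x1 ? e1] := IH _ _ h1 q1.
by have [x2 ? e2] := IH _ _ h2 q2; exists (x1, x2) => //=; rewrite e1 e2.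
Qed.

Lemma Kmap_comp s A B C (f : A -> B) (g : B -> C) (c : Kz s A) :
  Kmap g (Kmap f c) = Kmap (g \o f) c.
Proof. by elim: s c => [//|a s IH] c /=; rewrite !IH. Qed.

Lemma eq_Kmap s A B (f g : A -> B) (c : Kz s A) :
  f =1 g -> Kmap f c = Kmap g c.
Proof. by move=> fg; elim: s c => [|a s IH] c /=; rewrite ?fg // !IH. Qed.

(** The portion H^i(B) -> H^i(C) -> H^(i+1)(A) of the long exact sequence, as a diagram chase. *)
Lemma acyc_quotient s A B C (f : {linear A -> B}) (g : {linear B -> C}) i :
  ses f g -> acyc s B i -> acyc s A i.+1 -> acyc s C i.
Proof.
move=> [fI gS ex] aB aA c hc dc.
have fB := linearB f; have gB := linearB g.
have fZ a x : a \in s -> f (a *: x) = a *: f x by rewrite linearZ.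
have gZ a x : a \in s -> g (a *: x) = a *: g x by rewrite linearZ.
have exB b : g b = 0 -> exists a, f a = b by move/ex.
have gf a : g (f a) = 0 by apply/ex; exists a.
have [b hb be] := Kmap_surj gB gS hc.
have [|e he ee] := Kmap_exact (linear0 f) exB (Khd_Kd hb).
  by rewrite -Kmap_Kd // be.
have [|e' he' ee'] := aA e he.
  by apply: (Kmap_inj fB fI); rewrite -Kmap_Kd // ee Kdd.
have [||b' hb' be'] := aB (b - Kmap f e').
- by apply: KhdB => //; apply: Kmap_hd.
- by rewrite KdB Kmap_Kd // ee' ee subrr.
exists (Kmap g b'); first exact: Kmap_hd.
rewrite Kmap_Kd // be' KmapB // be Kmap_comp.
suff -> : Kmap (g \o f) e' = 0 by rewrite subr0.
rewrite (eq_Kmap _ (gf : g \o f =1 (fun=> 0))).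
by elim: (s) (e') => [//|a s' IH] x /=; rewrite !IH.
Qed.

Lemma acyc_retract s A P (i : {linear A -> P}) (r : {linear P -> A}) k :
  (forall a, r (i a) = a) -> acyc s P k -> acyc s A k.
Proof.
move=> ri aP c hc dc.
have iB := linearB i; have rB := linearB r.
have iZ a x : a \in s -> i (a *: x) = a *: i x by rewrite linearZ.
have rZ a x : a \in s -> r (a *: x) = a *: r x by rewrite linearZ.
have [||b hb be] := aP (Kmap i c); first exact: Kmap_hd.
  by rewrite Kmap_Kd // dc Kmap0.
exists (Kmap r b); first exact: Kmap_hd.
rewrite Kmap_Kd // be Kmap_comp (eq_Kmap _ (ri : r \o i =1 id)).
by elim: (s) (c) => [//|a s' IH] [x y] /=; rewrite !IH.
Qed.

(** Dimension shifting: passing to the kernel of a cover lowers q by one and raises the degree by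
    one, so that i + q is preserved. *)
Lemma acyc_pdl s n q M i :
  (forall P j, projective P -> (j < n)%N -> acyc s P j) ->
  pdl q M -> (i + q < n)%N -> acyc s M i.
Proof.
move=> aP; elim: q M i => [|q IH] M i; first by rewrite addn0; apply: aP.
case=> P [g [pP gS pK]]; rewrite addnS -addSn => iq.
apply: (acyc_quotient (ses_ker gS)); last exact: IH.
by apply: aP => //; lia.
Qed.

Fixpoint K0 s M (m : M) : Kz s M :=
  if s is _ :: s' then (K0 s' m, 0) else m.

Lemma K0B s M (x y : M) : K0 s (x - y) = K0 s x - K0 s y.
Proof. by elim: s => [//|a s IH] /=; rewrite IH -[in LHS](subrr 0). Qed.

Lemma K0Z s M a (x : M) : K0 s (a *: x) = a *: K0 s x.
Proof. by elim: s => [//|b s IH] /=; rewrite IH -[in LHS](scaler0 _ a). Qed.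

Lemma K0_eq0 s M (x : M) : K0 s x = 0 -> x = 0.
Proof. by elim: s => [//|a s IH] /= [/IH]. Qed.

Lemma K0_hd s M (x : M) : Khd 1 (K0 s x).
Proof. by elim: s => [//|a s IH] /=; split=> //; apply: Khd0. Qed.

Lemma K0_surj s M (c : Kz s M) : Khd 1 c -> exists x, K0 s x = c.
Proof.
elim: s c => [|a s IH] /= c; first by exists c.
case: c => c1 c2 /= [/IH[x <-] /Khd_triv->].
by exists x.
Qed.

Lemma K0_map s M N (f : M -> N) x : f 0 = 0 -> Kmap f (K0 s x) = K0 s (f x).
Proof.
move=> f0; elim: s => [//|a s IH] /=; rewrite IH; congr (_, _).
by elim: (s) => [//|b s' IH'] /=; rewrite IH'.
Qed.

Lemma Kd_K0 s M (x : M) : Kd (K0 s x) = 0 -> {in s, forall a, a *: x = 0}.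
Proof.
elim: s => [//|b s IH] /= [/IH sx]; rewrite Kd0 subr0 -K0Z => /K0_eq0 bx a.
by rewrite inE => /predU1P[->|/sx].
Qed.

(* Vanishing of the first cohomology is a saturation property. *)
Lemma acyc_saturated s M N (f : {linear M -> N}) (x : N) :
  acyc s M 1 -> injective f -> {in s, forall a, exists y, f y = a *: x} ->
  exists y, {in s, forall a, a *: (f y - x) = 0}.
Proof.
move=> aM fI fx; have fB := linearB f.
have fZ a y : a \in s -> f (a *: y) = a *: f y by rewrite linearZ.
(* The coboundary of x has all its coefficients in the image of f, so it comes from a 1-cochain of
   M, which is a cocycle; a 0-cochain bounding it is the wanted y. *)
have [c hc ce] : exists2 c : Kz s M, Khd 2 c & Kmap f c = Kd (K0 s x).
  elim: (s) fx {aM fZ} => [|a s' IH] fx; first by exists 0 => //; apply: linear0.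
  have [|c1 h1 e1] := IH; first by move=> b bs; apply: fx; rewrite inE bs orbT.
  have [y yE] := fx a (mem_head _ _).
  exists (c1, K0 s' y); first by split=> //; apply: K0_hd.
  by rewrite /= e1 K0_map ?linear0 // yE K0Z Kd0 subr0.
have [|b hb be] := aM c hc.
  by apply: (Kmap_inj fB fI); rewrite -Kmap_Kd // ce Kdd.
have [y yE] := K0_surj hb; exists y; apply: Kd_K0.
rewrite K0B KdB -K0_map ?linear0 // yE Kmap_Kd // be ce subrr //.
Qed.
End Koszul.

(** * Polynomial extensions *)

Section OperatorAction.
Variables (R : comNzRingType) (V : lmodType R) (t : {linear V -> V}).
Implicit Types (p q : {poly R}) (v w : V).

Definition pact (p : {poly R}) (v : V) : V :=
  \sum_(i < size p) p`_i *: iter i t v.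

Lemma pact_wide n p v : (size p <= n)%N ->
  pact p v = \sum_(i < n) p`_i *: iter i t v.
Proof.
move=> pn; rewrite /pact (big_ord_widen _ (fun i => p`_i *: iter i t v) pn).
rewrite big_mkcond; apply: eq_bigr => i _; case: ltnP => // le.
by rewrite nth_default // scale0r.
Qed.

Lemma pactDl v : {morph pact^~ v : p q / p + q}.
Proof.
move=> p q; set n := maxn (size p) (size q).
rewrite (@pact_wide n (p + q)) ?size_polyD //.
rewrite (@pact_wide n p) ?leq_maxl // (@pact_wide n q) ?leq_maxr //.
by rewrite -big_split; apply: eq_bigr => i _; rewrite coefD scalerDl.
Qed.

Lemma iter_linear i a v w : iter i t (a *: v + w) = a *: iter i t v + iter i t w.
Proof. by elim: i => //= i ->; rewrite linearP. Qed.

Lemma pact_linear p : linear (pact p).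
Proof.
move=> a v w; rewrite /pact scaler_sumr -big_split; apply: eq_bigr => i _.
by rewrite iter_linear scalerDr !scalerA mulrC.
Qed.

HB.instance Definition _ p := GRing.isLinear.Build R V V _ (pact p) (pact_linear p).

Lemma pactC c v : pact c%:P v = c *: v.
Proof. by rewrite (@pact_wide 1) ?size_polyC_leq1 // big_ord1 coefC. Qed.

Lemma pactX v : pact 'X v = t v.
Proof.
rewrite (@pact_wide 2) ?size_polyX // !big_ord_recl big_ord0 !coefX /=.
by rewrite scale0r scale1r add0r addr0.
Qed.

Lemma pact_t p v : pact p (t v) = t (pact p v).
Proof.
rewrite /pact linear_sum; apply: eq_bigr => i _.
by rewrite linearZ -iterS -iterSr.
Qed.

Lemma pactMX p v : pact (p * 'X) v = t (pact p v).
Proof.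
rewrite (@pact_wide (size p).+1); last by rewrite (leq_trans (size_polyMleq _ _)) // size_polyX addn2.
rewrite big_ord_recl coefMX /= scale0r add0r -pact_t /pact; apply: eq_bigr => i _.
by rewrite coefMX /= -iterSr.
Qed.

Lemma pactZ c q v : pact (c *: q) v = c *: pact q v.
Proof.
rewrite (@pact_wide (size q)) ?size_scale_leq // /pact scaler_sumr.
by apply: eq_bigr => i _; rewrite coefZ scalerA.
Qed.

Lemma pactM p q v : pact (p * q) v = pact p (pact q v).
Proof.
elim/poly_ind: p => [|p c IH]; first by rewrite mul0r /pact size_poly0 !big_ord0.
rewrite mulrDl !pactDl -mulrA ['X * q]mulrC mulrA !pactMX IH; congr (_ + _).
by rewrite pactC mul_polyC pactZ.
Qed.
End OperatorAction.

(* [V] with a scalar [r] acting as the polynomial [psi r] in [t]. *)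
Definition twist (R : comNzRingType) (V : lmodType R) (t : {linear V -> V})
  (psi : {rmorphism R -> {poly R}}) : Type := V.

Section Twist.
Variables (R : comNzRingType) (V : lmodType R) (t : {linear V -> V}).
Variable psi : {rmorphism R -> {poly R}}.
Local Notation twist := (twist t psi).

HB.instance Definition _ := GRing.Zmodule.on twist.

Definition twist_scale (r : R) (v : twist) : twist := pact t (psi r) v.

Fact twist_scaleA a b v : twist_scale a (twist_scale b v) = twist_scale (a * b) v.
Proof. by rewrite /twist_scale rmorphM pactM. Qed.

Fact twist_scale1 : left_id 1 twist_scale.
Proof. by move=> v; rewrite /twist_scale rmorph1 pactC scale1r. Qed.

Fact twist_scaleDr : right_distributive twist_scale +%R.
Proof. by move=> a v w; rewrite /twist_scale linearD. Qed.

Fact twist_scaleDl v : {morph twist_scale^~ v : a b / a + b}.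
Proof. by move=> a b; rewrite /twist_scale rmorphD pactDl. Qed.

HB.instance Definition _ := GRing.Zmodule_isLmodule.Build R twist
  twist_scaleA twist_scale1 twist_scaleDr twist_scaleDl.
End Twist.

Section FiniteSequences.
Variables (R : comNzRingType) (N : lmodType R).

Definition fin_supp (u : nat -> N) : Prop := exists b, forall k, (b <= k)%N -> u k = 0.

Lemma fin_supp0 : fin_supp 0.
Proof. by exists 0. Qed.

Lemma fin_suppP a u v : fin_supp u -> fin_supp v -> fin_supp (a *: u + v).
Proof.
move=> [b bu] [c cv]; exists (maxn b c) => k; rewrite geq_max => /andP[bk ck].
by rewrite !fctE bu // cv // scaler0 addr0.
Qed.

(** The module N[t], as finitely supported sequences of coefficients; [shift] is multiplication by
    t. *)
Definition fs : Type := sub_mod (mksub fin_supp0 fin_suppP).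
HB.instance Definition _ := GRing.Lmodule.on fs.

Definition fs_fun (u : fs) : nat -> N := sub_incl (u : sub_mod _).
Coercion fs_fun : fs >-> Funclass.

Lemma fs_ext (u v : fs) : (forall k, u k = v k) -> u = v.
Proof. by move=> e; apply/sub_incl_inj/funext. Qed.

Lemma fs_lin a (u v : fs) k : (a *: u + v : fs) k = a *: u k + v k.
Proof. by rewrite /fs_fun linearP. Qed.

Lemma fs_add (u v : fs) k : (u + v : fs) k = u k + v k.
Proof. by rewrite /fs_fun linearD. Qed.

Lemma fs_sub (u v : fs) k : (u - v : fs) k = u k - v k.
Proof. by rewrite /fs_fun linearB. Qed.

Lemma fs_opp (u : fs) k : (- u : fs) k = - u k.
Proof. by rewrite /fs_fun linearN. Qed.

Lemma fs_scale a (u : fs) k : (a *: u : fs) k = a *: u k.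
Proof. by rewrite /fs_fun linearZ. Qed.

Definition mkfs (u : nat -> N) (h : fin_supp u) : fs := to_sub (introT (asboolP _) h : u \in sm_pred (mksub fin_supp0 fin_suppP)).

Lemma fs_0 k : (0 : fs) k = 0.
Proof. by []. Qed.

Lemma fs_suppP (u : fs) : fin_supp u.
Proof. by have := valP u => /asboolP. Qed.

Fact shift_supp (u : fs) : fin_supp (fun k => if k is j.+1 then u j else 0).
Proof.
have [b bu] := fs_suppP u; exists b.+1 => -[//|k] bk; exact: bu.
Qed.

Definition shift (u : fs) : fs := mkfs (shift_supp u).

Fact shift_linear : linear shift.
Proof.
by move=> a u v; apply: fs_ext => -[|k]; rewrite fs_lin //= scaler0 addr0.
Qed.

HB.instance Definition _ := GRing.isLinear.Build R fs fs _ shift shift_linear.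

Fact unshift_supp (u : fs) : fin_supp (fun k => u k.+1).
Proof. by have [b bu] := fs_suppP u; exists b => k bk; apply/bu/leqW. Qed.

Definition unshift (u : fs) : fs := mkfs (unshift_supp u).

Fact const_supp (x : N) : fin_supp (fun k => if k is j.+1 then 0 else x).
Proof. by exists 1%N => -[]. Qed.

Definition fs_const (x : N) : fs := mkfs (const_supp x).

Lemma shift_inj : injective shift.
Proof.
move=> u v e; apply: fs_ext => k.
by have := congr1 (fun w : fs => w k.+1) e.
Qed.

Lemma fs_decomp (u : fs) : u = shift (unshift u) + fs_const (u 0).
Proof. by apply: fs_ext => -[|k]; rewrite fs_add /= ?add0r ?addr0. Qed.

Lemma fs_constB x y : fs_const (x - y) = fs_const x - fs_const y.
Proof. by apply: fs_ext => -[|k]; rewrite fs_sub //= subrr. Qed.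

Lemma fs_ind (Q : fs -> Prop) : Q 0 ->
  (forall x u, Q u -> Q (shift u + fs_const x)) -> forall u, Q u.
Proof.
move=> Q0 QS u; have [b bu] := fs_suppP u.
elim: b u bu => [|b IH] u bu.
  by rewrite (_ : u = 0) //; apply: fs_ext => k; rewrite bu.
by rewrite (fs_decomp u); apply/QS/IH => k bk; apply: bu.
Qed.
End FiniteSequences.

Section Evaluation.
Variables (R : comNzRingType) (N X : lmodType R) (a : R) (h : N -> X).
Hypothesis hD : forall x y, h (x + y) = h x + h y.

(** Applies h to the coefficients and puts t := a. Only additivity of h is assumed, since
    [Gproj_text] uses maps linear over part of the ring. The summation bound is a chosen one; by
    [fs_eval_wide] any bound on the support gives the same value. *)
Definition fs_eval (u : fs N) : X :=
  \sum_(k < sval (cid (fs_suppP u))) a ^+ k *: h (u k).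

Lemma fs_eval_h0 : h 0 = 0.
Proof. by apply: (addrI (h 0)); rewrite -hD !addr0. Qed.

Lemma fs_eval_wide n (u : fs N) : (forall k, (n <= k)%N -> u k = 0) ->
  fs_eval u = \sum_(k < n) a ^+ k *: h (u k).
Proof.
rewrite /fs_eval; case: cid => /= b bu nu.
have wide c m : (c <= m)%N -> (forall k, (c <= k)%N -> u k = 0) ->
    \sum_(k < c) a ^+ k *: h (u k) = \sum_(k < m) a ^+ k *: h (u k).
  move=> cm cu; rewrite (big_ord_widen _ (fun k => a ^+ k *: h (u k)) cm).
  rewrite big_mkcond; apply: eq_bigr => i _; case: ltnP => // /cu ->.
  by rewrite fs_eval_h0 scaler0.
by rewrite (wide b (maxn b n)) ?leq_maxl // (wide n (maxn b n)) ?leq_maxr.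
Qed.

Lemma fs_evalD u v : fs_eval (u + v) = fs_eval u + fs_eval v.
Proof.
have [b bu] := fs_suppP u; have [c cv] := fs_suppP v.
have w0 (w : fs N) d k : (forall k, (d <= k)%N -> w k = 0) -> (d <= maxn b c)%N ->
    (maxn b c <= k)%N -> w k = 0.
  by move=> dw db bk; apply/dw/(leq_trans db).
have uw := w0 u b _ bu (leq_maxl _ _); have vw := w0 v c _ cv (leq_maxr _ _).
rewrite (fs_eval_wide uw) (fs_eval_wide vw) (@fs_eval_wide (maxn b c)).
  by rewrite -big_split; apply: eq_bigr => i _; rewrite fs_add hD scalerDr.
by move=> k bk; rewrite fs_add uw // vw // addr0.
Qed.

Lemma fs_eval0 : fs_eval 0 = 0.
Proof. by rewrite (@fs_eval_wide 0) ?big_ord0. Qed.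

Lemma fs_eval_const x : fs_eval (fs_const x) = h x.
Proof.
by rewrite (@fs_eval_wide 1) => [|[]//]; rewrite big_ord1 scale1r.
Qed.

Lemma fs_eval_shift u : fs_eval (shift u) = a *: fs_eval u.
Proof.
have [b bu] := fs_suppP u.
rewrite (@fs_eval_wide b.+1) => [|[|k] //]; last exact: bu.
rewrite (@fs_eval_wide b) // big_ord_recl /= fs_eval_h0 scaler0 add0r scaler_sumr.
by apply: eq_bigr => i _; rewrite scalerA -exprS.
Qed.

Lemma fs_eval_scale r u :
  (forall x, h (r *: x) = r *: h x) -> fs_eval (r *: u) = r *: fs_eval u.
Proof.
move=> hr; have [b bu] := fs_suppP u.
rewrite !(@fs_eval_wide b) // => [|k bk]; last by rewrite fs_scale bu // scaler0.
rewrite scaler_sumr; apply: eq_bigr => i _.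
by rewrite fs_scale hr !scalerA mulrC.
Qed.
End Evaluation.

Section PolynomialExtension.
Variables (R : comNzRingType) (N : lmodType R).
Variables (psi : {rmorphism R -> {poly R}}).

(** If R is a polynomial ring in a over a subring whose elements psi keeps as constants, and psi
    sends a to 'X, this is the extension of scalars of N from that subring to R. *)
Definition text : lmodType R := twist (@shift R N : {linear fs N -> fs N}) psi.

Lemma text_scaleE r (u : text) :
  r *: u = pact (@shift R N : {linear _ -> _}) (psi r) u :> fs N.
Proof. by []. Qed.

Lemma text_scaleC r (u : text) : psi r = r%:P -> r *: u = r *: (u : fs N).
Proof. by move=> e; rewrite text_scaleE e pactC. Qed.

Lemma text_scaleX r (u : text) : psi r = 'X -> r *: u = shift (u : fs N).
Proof. by move=> e; rewrite text_scaleE e pactX. Qed.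

Variable (a : R).
Hypothesis psia : forall r, (psi r).[a] = r.

Definition text_eval (u : text) : N := fs_eval a id u.

Fact text_eval_linear : linear text_eval.
Proof.
move=> r u v; rewrite /text_eval fs_evalD //; congr (_ + _).
rewrite text_scaleE -[in RHS](psia r) horner_coef scaler_suml /pact.
rewrite (big_morph (fs_eval a id) (fs_evalD _ _) (fs_eval0 _ _)) //.
apply: eq_bigr => i _; rewrite fs_eval_scale // -scalerA; congr (_ *: _).
by elim: (i : nat) => [|k IH]; rewrite ?scale1r // exprS -scalerA -IH /= fs_eval_shift.
Qed.

HB.instance Definition _ := GRing.isLinear.Build R text N _ text_eval text_eval_linear.

Definition text_mulXa (u : text) : text := shift (u : fs N) - a *: (u : fs N).

Fact text_mulXa_linear : linear text_mulXa.
Proof.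
move=> r u v; rewrite /text_mulXa linearD scalerDr opprD addrACA; congr (_ + _).
rewrite text_scaleE -pact_t -linearZ -linearN -linearD text_scaleE //.
Qed.

HB.instance Definition _ :=
  GRing.isLinear.Build R text text _ text_mulXa text_mulXa_linear.

Lemma text_eval_surj : surj text_eval.
Proof. by move=> x; exists (fs_const x); rewrite /text_eval fs_eval_const. Qed.

(** The standard resolution N[t] -> N[t] -> N, by t - a and t := a; [psia] is what makes the
    evaluation linear for the twisted action. *)
Lemma text_ses : ses text_mulXa text_eval.
Proof.
split=> [u v e||u].
- apply/eqP; rewrite -subr_eq0; apply/eqP; move: (u - v) (linearB text_mulXa u v) => w.
  rewrite e subrr => {u v e} /eqP; rewrite subr_eq0 => /eqP e.
  (* A sequence killed by t - a satisfies w_k = a w_(k+1), and so vanishes by descent from the bound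
     on its support. *)
  have wE k : (w : fs N) k = a *: (w : fs N) k.+1.
    by have := congr1 (fun x : fs N => x k.+1) e; rewrite fs_scale.
  apply: fs_ext => k; rewrite fs_0; have [b bw] := fs_suppP (w : fs N).
  have [/bw//|] := leqP b k; move=> /ltnW/subnK; move: (b - k)%N => m.
  elim: m k => [|m IH] k mk; first by rewrite bw // -mk.
  by rewrite wE IH ?scaler0 //; lia.
- exact: text_eval_surj.
(* Division with remainder by t - a, following the Horner scheme. *)
have step (x : text) : exists v, x = text_mulXa v + fs_const (text_eval x).
  move: x; apply: fs_ind => [|x w [v e]].
    by exists 0; rewrite !linear0 add0r; apply: fs_ext => -[].
  set c := text_eval w in e *; exists (shift (v : fs N) + fs_const c).
  have -> : text_eval (shift w + fs_const x) = a *: c + x.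
    by rewrite /text_eval fs_evalD // fs_eval_shift // fs_eval_const.
  apply: fs_ext => -[|k]; rewrite !(fs_add, fs_opp, fs_scale) /=.
    by rewrite !add0r addrA addNr add0r.
  have ek : (w : fs N) k = (text_mulXa v + fs_const c : fs N) k by rewrite -e.
  rewrite -[X in X + _ = _]/((w : fs N) k) ek.
  by rewrite !(fs_add, fs_opp, fs_scale) /= !addr0 addrAC.
split=> [e|[v <-]].
  by have [v ->] := step u; exists v; rewrite e (_ : fs_const 0 = 0) ?addr0 //; apply: fs_ext => -[].
transitivity (fs_eval a id (shift (v : fs N) + (- a) *: (v : fs N))).
  by rewrite scaleNr.
by rewrite fs_evalD // fs_eval_shift // fs_eval_scale // scaleNr subrr.
Qed.

Lemma text_cover : exists g : {linear text -> N}, surj g.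
Proof. by exists (text_eval : {linear text -> N}); apply: text_eval_surj. Qed.

Lemma pdl_text n : pdl n text -> pdl n.+1 N.
Proof. by move=> pT; apply: (pdl_right text_ses) => //; apply: pdl_mono. Qed.

End PolynomialExtension.

Section KoszulExtension.
Variables (R : comNzRingType) (N : lmodType R) (psi : {rmorphism R -> {poly R}}).
Local Notation T := (text N psi).

Lemma Kmap_sum s (A B : lmodType R) (f g : A -> B) (c : Kz s A) :
  Kmap (fun u => f u + g u) c = Kmap f c + Kmap g c.
Proof. by elim: s c => [//|a s IH] c /=; rewrite !IH. Qed.

Lemma Kmap_scaler s (A : lmodType R) a (c : Kz s A) :
  Kmap (fun u => a *: u) c = a *: c.
Proof. by elim: s c => [//|b s IH] [c d] /=; rewrite !IH. Qed.

Lemma Kmap_id s (A : lmodType R) (f : A -> A) (c : Kz s A) :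
  f =1 id -> Kmap f c = c.
Proof. by move=> fE; elim: s c => [//|b s IH] [c d] /=; rewrite !IH. Qed.

Lemma Kmap_const0 s (A B : lmodType R) (c : Kz s A) : Kmap (fun=> 0 : B) c = 0.
Proof. by elim: s c => [//|b s IH] [c d] /=; rewrite !IH. Qed.

(** As a acts by t, it is injective on N[t] with cokernel N; the cone on a therefore has the
    cohomology of s on N, one degree up. Cochains are moved between N and N[t] by [cst] and [ev0],
    both compatible with the scalars in s. *)
Lemma acyc_text s a k : psi a = 'X -> {in s, forall b, psi b = b%:P} ->
  (forall i, (i < k)%N -> acyc s N i) ->
  forall i, (i < k.+1)%N -> acyc (a :: s) T i.
Proof.
move=> psa pss aN i ik [c1 c2] /= [h1 h2] [d1 /eqP]; rewrite subr_eq0 => /eqP d2.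
have aI : injective (fun u : T => a *: u).
  by move=> u v; rewrite !text_scaleX // => /shift_inj.
have aB (x y : T) : a *: (x - y) = a *: x - a *: y by rewrite scalerBr.
have KaI (x y : Kz s T) : a *: x = a *: y -> x = y.
  move=> e; apply/eqP; rewrite -subr_eq0; apply/eqP.
  by apply: (Kmap_inj aB aI); rewrite Kmap_scaler scalerBr e subrr.
case: i ik h1 h2 => [|i] ik h1 h2.
  exists 0; first by split; apply: Khd0.
  have c20 := Khd_triv h2; rewrite Kd0 c20 scaler0 subr0; congr (_, _).
  by apply: KaI; rewrite d2 c20 Kd0 scaler0.
pose ev0 (u : T) : N := (u : fs N) 0.
have ev0B x y : ev0 (x - y) = ev0 x - ev0 y by rewrite /ev0 fs_sub.
have ev0Z b x : b \in s -> ev0 (b *: x) = b *: ev0 x.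
  by move=> /pss bs; rewrite /ev0 text_scaleC // fs_scale.
pose cst (x : N) : T := fs_const x.
have cstB x y : cst (x - y) = cst x - cst y by rewrite /cst fs_constB.
have cstZ b x : b \in s -> cst (b *: x) = b *: cst x.
  move=> /pss bs; rewrite [RHS]text_scaleC //; apply: fs_ext => -[|k']; by rewrite fs_scale /= ?scaler0.
pose un (u : T) : T := unshift (u : fs N).
have unB x y : un (x - y) = un x - un y by apply: fs_ext => j; rewrite [RHS]fs_sub; apply: fs_sub.
have decomp (u : T) : a *: un u + cst (ev0 u) = u by rewrite text_scaleX // -fs_decomp.
have [|||b hb db] := aN i _ (Kmap ev0 c2).
- exact: ltnSE.
- exact: Kmap_hd.
- rewrite Kmap_Kd // -d2 -Kmap_scaler Kmap_comp.
  rewrite (eq_Kmap (g := fun=> 0)) ?Kmap_const0 // => u /=.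
  by rewrite text_scaleX.
pose g := Kmap un c2.
(* Modulo t the second component is a coboundary, by acyclicity of N; removing it leaves a multiple
   of t, and the quotient [g] is the first component of the required cochain. *)
have c2E : c2 = a *: g + Kd (Kmap cst b).
  rewrite Kmap_Kd // db /g -Kmap_scaler !Kmap_comp -Kmap_sum.
  by rewrite Kmap_id.
have c1E : c1 = Kd g by apply: KaI; rewrite d2 c2E KdD KdZ Kdd addr0.
exists (g, - Kmap cst b).
  by split; [apply: Kmap_hd|apply/KhdN/Kmap_hd].
by rewrite /= -c1E -[- Kmap _ _]sub0r KdB Kd0 sub0r opprK -c2E.
Qed.
End KoszulExtension.

(** * Modules over polynomial rings *)

Section RelativeProjectivity.
Variable R : comNzRingType.
Implicit Types (N X Y : lmodType R) (G : R -> Prop).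

Definition Glin G N Y (f : N -> Y) : Prop :=
  (forall x y, f (x + y) = f x + f y) /\ (forall r x, G r -> f (r *: x) = r *: f x).

(** A lifting property that interpolates between the constants, over which every module has it, and
    the whole ring, where it is projectivity; each polynomial extension enlarges G by one
    variable. *)
Definition Gproj G N : Prop :=
  forall X Y (g : {linear X -> Y}), surj g ->
  forall f : N -> Y, Glin G f -> exists2 h : N -> X, Glin G h & forall x, g (h x) = f x.

(** A map on N[t] is determined by its values on constants; these are lifted by hypothesis, and
    evaluation at a extends the lift. *)
Lemma Gproj_text G N a (psi : {rmorphism R -> {poly R}}) :
  psi a = 'X -> (forall r, G r -> psi r = r%:P) ->
  Gproj G N -> Gproj (fun r => G r \/ r = a) (text N psi).
Proof.
move=> psa psG pN X Y g gS f [fD fZ].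
have [|h [hD hZ] hE] := pN X Y g gS (fun x => f (fs_const x : text N psi)).
  split=> [x y|r x Gr] /=.
    rewrite -[RHS]fD; congr f; apply: fs_ext => -[|k]; by rewrite fs_add /= ?addr0.
  rewrite -fZ; last by left.
  congr f; rewrite [RHS]text_scaleC ?psG //; apply: fs_ext => -[|k]; by rewrite fs_scale /= ?scaler0.
have f0 : f 0 = 0 by apply: (addrI (f 0)); rewrite -fD !addr0.
exists (fs_eval a h); first split.
- exact: fs_evalD.
- move=> r x [Gr|->]; first by rewrite text_scaleC ?psG // fs_eval_scale // => y; apply: hZ.
  by rewrite text_scaleX // fs_eval_shift.
move=> x; move: x; apply: fs_ind => [|x u e]; first by rewrite fs_eval0 ?linear0.
rewrite fs_evalD // fs_eval_shift // fs_eval_const // linearD linearZ e hE.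
have fu : f (a *: (u : text N psi)) = a *: f u by apply: fZ; right.
by rewrite text_scaleX // in fu; rewrite /= -fu -fD.
Qed.

Lemma Gproj_projective G N : (forall Y (f : N -> Y), Glin G f -> linear f) ->
  Gproj G N -> projective N.
Proof.
move=> Glin pN X Y g f gS.
have [|h hG hE] := pN X Y g gS f.
  by split=> [x y|r x _]; rewrite ?linearD ?linearZ.
by exists (mklin (Glin _ _ hG)) => x /=.
Qed.
End RelativeProjectivity.

Section ScalarLifting.
Variables (K : fieldType) (n : nat).
Local Notation S := {mpoly K[n]}.
Local Open Scope classical_set_scope.

Definition const_scalar (s : S) : Prop := exists c : K, s = c%:MP.

Section GoodGraph.
Variables (N X Y : lmodType S) (g : {linear X -> Y}) (f : N -> Y).

(** Graphs of partial K-linear lifts of f through g, taken as relations so that unions of chains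
    make sense. *)
Definition good_graph (W : N -> X -> Prop) : Prop :=
  [/\ W 0 0,
      forall (c : K) x y u v, W x u -> W y v -> W (c%:MP *: x + y) (c%:MP *: u + v),
      forall u, W 0 u -> u = 0
    & forall x u, W x u -> g u = f x].

(** The pair (0, 0) is adjoined so that the union of the empty chain is a good graph too. *)
Definition graph0 (W : set (N * X)) (x : N) (u : X) : Prop :=
  W (x, u) \/ (x = 0 /\ u = 0).

Lemma maximal_graph : Glin const_scalar f ->
  exists A : set (N * X), good_graph (graph0 A) /\
    forall B : set (N * X), A `<` B -> ~ good_graph (graph0 B).
Proof.
move=> [fD fZ]; apply: (Zorn_bigcup (P := [set W | good_graph (graph0 W)])).
move=> F FP Ftot; split=> [|c x y u v|u|x u].
- by right.
- have both W : F W -> graph0 W x u -> graph0 W y v ->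
      graph0 (\bigcup_(Z in F) Z) (c%:MP *: x + y) (c%:MP *: u + v).
    move=> FW hx hy; have [_ cl _ _] := FP _ FW.
    by case: (cl c x y u v hx hy) => [h|h]; [left; exists W|right].
  case=> [[W FW Wx]|[-> ->]]; case=> [[Z FZ Zy]|[-> ->]].
  + case: (Ftot _ _ FW FZ) => sub.
      by apply: (both Z) => //; left => //; apply: sub.
    by apply: (both W) => //; left => //; apply: sub.
  + by rewrite !addr0; move: both => /(_ W FW (or_introl Wx)); 
      have := FP _ FW; case=> _ cl _ _ _; have := cl c x 0 u 0 (or_introl Wx) (or_intror (conj erefl erefl));
      rewrite !addr0 => -[h|h]; [left; exists W|right].
  + by rewrite !scaler0 !add0r; left; exists Z.
  + by rewrite !scaler0 !addr0; right.
- case=> [[W FW W0]|[_ ->//]]; have [_ _ f0 _] := FP _ FW.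
  by apply: f0; left.
- case=> [[W FW Wx]|[-> ->]]; first by have [_ _ _ gE] := FP _ FW; apply: gE; left.
  by rewrite linear0; apply: (addrI (f 0)); rewrite -fD !addr0.
Qed.
End GoodGraph.

Lemma Gproj_const (N : lmodType S) : Gproj const_scalar N.
Proof.
move=> X Y g gS f fG; have [fD fZ] := fG.
have [A [gA maxA]] := maximal_graph g fG.
have [A0 AP Af Ag] := gA.
have Atot x : exists u, graph0 A x u.
  apply: contrapT => noA; have [v vE] := gS (f x).
  (* A point x outside the domain is adjoined with value v: the graph is extended by the line
     through (x, v). *)
  pose B : set (N * X) := [set yw | exists c : K, graph0 A (yw.1 - c%:MP *: x) (yw.2 - c%:MP *: v)].
  apply: (maxA B).
    split; last first.
      move=> /(_ (x, v)); have : B (x, v) by exists 1; rewrite mpolyC1 !scale1r !subrr.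
      by move=> /[swap]/[apply] Ax; apply: noA; exists v; left.
    move=> -[y w] Ay; exists 0; rewrite mpolyC0 !scale0r !subr0; left => //.
  have B0 : graph0 B = fun y w => B (y, w).
    apply/funext => y; apply/funext => w; apply/propext; split=> [[//|[-> ->]]|]; last by left.
    by exists 0; rewrite mpolyC0 !scale0r !subr0.
  rewrite B0; split.
  - by exists 0; rewrite mpolyC0 !scale0r !subr0.
  - move=> c y z u w [d hd] [e he]; exists (c * d + e) => /=.
    have comb (V : lmodType S) (a b b' : S) (y' z' x' : V) :
        a *: (y' - b *: x') + (z' - b' *: x') = a *: y' + z' - (a * b + b') *: x'.
      by rewrite scalerBr scalerA scalerDl opprD addrACA.
    by have := AP c _ _ _ _ hd he; rewrite /= mpolyCD mpolyCM !comb.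
  - move=> w [c /= hc]; have [c0|cn0] := eqVneq c 0.
      by apply: Af; move: hc; rewrite c0 mpolyC0 !scale0r !subr0; apply.
    (* For c <> 0 the point x would already be in the domain: scale the pair (- c x, w - c v) of the
       old graph by - 1 / c. *)
    case: noA; exists (- c^-1%:MP *: (w - c%:MP *: v)).
    have := AP (- c^-1) _ _ _ _ hc A0.
    by rewrite !addr0 mpolyCN sub0r scalerN scaleNr opprK scalerA -mpolyCM mulVf // mpolyC1 scale1r.
  - move=> y w [c /= /Ag]; rewrite linearB linearZ /= vE => /eqP.
    have -> : f (y - c%:MP *: x) = f y - c%:MP *: f x.
      by apply/eqP; rewrite eq_sym subr_eq -fZ -?fD ?subrK //; exists c.
    by rewrite subr_eq subrK => /eqP.
have /choice[h hE] := Atot.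
have hU x u v : graph0 A x u -> graph0 A x v -> u = v.
  move=> hu hv; apply/eqP; rewrite -subr_eq0; apply/eqP/Af.
  have := AP (-1) _ _ _ _ hv hu.
  by rewrite mpolyCN mpolyC1 !scaleN1r addNr [- v + u]addrC.
exists h; last by move=> x; apply: Ag.
split=> [x y|r x [c ->]]; apply: hU (hE _) _.
  by have := AP 1 _ _ _ _ (hE x) (hE y); rewrite mpolyC1 !scale1r.
by have := AP c _ _ _ _ (hE x) A0; rewrite !addr0.
Qed.
End ScalarLifting.

Section PolynomialModules.
Variables (K : fieldType) (n : nat).
Local Notation S := {mpoly K[n]}.

Lemma mpoly_gen_ind (Q : S -> Prop) :
  (forall c, Q c%:MP) -> (forall i, Q 'X_i) ->
  (forall p q, Q p -> Q q -> Q (p + q)) -> (forall p q, Q p -> Q q -> Q (p * q)) ->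
  forall p, Q p.
Proof.
move=> QC QX QD QM p; rewrite (mpolyE p).
apply: (big_ind Q); [by rewrite -mpolyC0|exact: QD|move=> m _].
rewrite -mul_mpolyC; apply: (QM _ _ (QC _)); rewrite mpolyXE_id.
apply: (big_ind Q); [by rewrite -mpolyC1|exact: QM|move=> i _].
by elim: (m i) => [|k IH]; rewrite ?expr0 ?exprS -?mpolyC1 //; exact: QM.
Qed.

Lemma eq_mpoly_rmorph (T : comNzRingType) (f g : {rmorphism S -> T}) :
  (forall c, f c%:MP = g c%:MP) -> (forall i, f 'X_i = g 'X_i) -> f =1 g.
Proof.
move=> fC fX; apply: mpoly_gen_ind => // p q.
  by rewrite !rmorphD => -> ->.
by rewrite !rmorphM => -> ->.
Qed.

Lemma gen_linear (N Y : lmodType S) (f : N -> Y) :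
  (forall x y, f (x + y) = f x + f y) ->
  (forall (c : K) x, f (c%:MP *: x) = c%:MP *: f x) ->
  (forall i x, f ('X_i *: x) = 'X_i *: f x) -> linear f.
Proof.
move=> fD fC fX; suff fZ p x : f (p *: x) = p *: f x by move=> p x y; rewrite fD fZ.
move: p x; apply: mpoly_gen_ind => [//|//|p q fp fq|p q fp fq] x.
  by rewrite !scalerDl fD fp fq.
by rewrite -!scalerA fp fq.
Qed.

Section Shear.
Variables (al : S) (u : 'I_n -> K).

(* Substitute al := 'X, the variable of {poly S}, in the decomposition
   X_j = (X_j - u_j al) + u_j al. *)
Definition shear : S -> {poly S} :=
  mmap (polyC \o @mpolyC n K)
    (fun j => ('X_j - (u j)%:MP * al)%:P + ((u j)%:MP)%:P * 'X).

HB.instance Definition _ := GRing.RMorphism.on shear.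

Lemma shearC c : shear c%:MP = c%:MP%:P.
Proof. by rewrite /shear mmapC. Qed.

Lemma shearX j : shear 'X_j = ('X_j - (u j)%:MP * al)%:P + ((u j)%:MP)%:P * 'X.
Proof. by rewrite /shear mmapX mmap1U. Qed.

Lemma shear_eval p : (shear p).[al] = p.
Proof.
have := @eq_mpoly_rmorph _ (horner_eval al \o shear) idfun.
apply=> [c|j] /=; rewrite /horner_eval; first by rewrite shearC hornerC.
by rewrite shearX !hornerE subrK.
Qed.

Lemma shear_lin (a : 'I_n -> K) :
  al = \sum_j (a j)%:MP * 'X_j -> \sum_j a j * u j = 1 -> shear al = 'X.
Proof.
move=> alE au; have -> : shear al = \sum_j ((a j)%:MP%:P * shear 'X_j).
  by rewrite {1}alE rmorph_sum; apply: eq_bigr => j _; rewrite rmorphM /= shearC.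
have -> : \sum_j (a j)%:MP%:P * shear 'X_j =
    \sum_j ((a j)%:MP * 'X_j)%:P + \sum_j (a j * u j)%:MP%:P * ('X - al%:P).
  rewrite -big_split; apply: eq_bigr => j _ /=.
  rewrite shearX polyCB !polyCM mpolyCM !polyCM; ring.
rewrite -mulr_suml -!rmorph_sum /= au -alE mpolyC1 mul1r addrC subrK //.
Qed.
End Shear.

(** A section of the evaluation P[t] -> P embeds P in a module on which al acts as the shift, which
    is injective. *)
Lemma projective_regular (al : S) (a u : 'I_n -> K) (P : lmodType S) :
  al = \sum_j (a j)%:MP * 'X_j -> \sum_j a j * u j = 1 -> projective P ->
  forall x : P, al *: x = 0 -> x = 0.
Proof.
move=> alE au pP x; set psi : {rmorphism S -> {poly S}} := shear al u.
have [s sE] := ses_section (text_ses P (shear_eval al u)) pP.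
rewrite -{2}(sE x) => ax.
have -> : s x = 0; last by rewrite linear0.
apply: (@shift_inj S P); rewrite -(text_scaleX (psi := psi) (r := al)).
  by rewrite -linearZ /= ax !linear0.
exact: shear_lin alE au.
Qed.

Definition var_shear (j : 'I_n) : {rmorphism S -> {poly S}} :=
  shear 'X_j (fun i => (i == j)%:R).

Lemma var_shear_eq j : var_shear j 'X_j = 'X.
Proof. by rewrite [LHS]shearX eqxx mpolyC1 mul1r subrr add0r mul1r. Qed.

Lemma var_shear_neq i j : i != j -> var_shear j 'X_i = ('X_i)%:P.
Proof. by move=> /negbTE ij; rewrite [LHS]shearX ij mpolyC0 !mul0r subr0 addr0. Qed.

(** The variables in r act as independent shifts, the others as on N. When r lists all variables,
    this is S tensored over K with the vector space N. *)
Fixpoint itext (r : seq 'I_n) (N : lmodType S) : lmodType S :=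
  if r is j :: r' then text (itext r' N) (var_shear j) else N.

Lemma itext_surj r N : exists g : {linear itext r N -> N}, surj g.
Proof.
elim: r => [|j r [g gS]] /=; first by exists idfun => x; exists x.
have [h hS] := text_cover (itext r N) (shear_eval 'X_j (fun i => (i == j)%:R)).
exists (g \o h) => x; have [y <-] := gS x; have [z <-] := hS y.
by exists z.
Qed.

Lemma pdl_itext r N m : pdl m (itext r N) -> pdl (m + size r) N.
Proof.
elim: r m => [|j r IH] m /=; first by rewrite addn0.
by move=> /(pdl_text (shear_eval _ _)) /IH; rewrite addnS.
Qed.

Lemma acyc_itext r N i : uniq r -> (i < size r)%N ->
  acyc [seq 'X_j | j <- r] (itext r N) i.
Proof.
elim: r i => [//|j r IH] i /= /andP[jr ur] ir.
apply: (acyc_text (k := size r)) => //; first exact: var_shear_eq.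
  move=> _ /mapP[k kr ->]; apply: var_shear_neq.
  by apply: contraNneq jr => <-.
by move=> k kr; apply: IH.
Qed.

Lemma Gproj_itext r N : uniq r ->
  Gproj (fun s => @const_scalar K n s \/ exists2 j, j \in r & s = 'X_j) (itext r N).
Proof.
elim: r => [|j r IH] /=.
  move=> _ X Y g gS f [fD fZ]; have [|h [hD hZ] hE] := Gproj_const gS (f := f).
    by split=> // s x cs; apply: fZ; left.
  by exists h => //; split=> // s x [cs|[]//]; apply: hZ.
move=> /andP[jr /IH pN] X Y g gS f [fD fZ].
have [||h [hD hZ] hE] := Gproj_text (var_shear_eq j) _ pN gS (f := f).
- move=> s [[c ->]|[k kr ->]]; first exact: shearC.
  by apply: var_shear_neq; apply: contraNneq jr => <-.
- split=> // s x [[cs|[k kr ->]]|->]; apply: fZ; first by left.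
    by right; exists k; rewrite // inE kr orbT.
  by right; exists j; rewrite // inE eqxx.
exists h => //; split=> // s x [cs|[k]]; first by apply: hZ; left; left.
rewrite inE => /predU1P[-> ->|kr ->]; apply: hZ; first by right.
by left; right; exists k.
Qed.

Lemma itext_projective N : projective (itext (enum 'I_n) N).
Proof.
apply: (Gproj_projective _ (Gproj_itext (enum_uniq _))) => Y f [fD fZ].
apply: gen_linear => // [c x|i x]; apply: fZ; first by left; exists c.
by right; exists i; rewrite ?mem_enum.
Qed.

(** Hilbert's syzygy theorem: N is recovered from the projective module [itext (enum 'I_n) N] by n
    evaluations, each raising the dimension by at most one. *)
Lemma syzygy (N : lmodType S) : pdl n N.
Proof.
have /pdl_itext : pdl 0 (itext (enum 'I_n) N) by apply: itext_projective.
by rewrite size_enum_ord.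
Qed.

(** P is a retract of [itext (enum 'I_n) P], on which the variables act as independent shifts. *)
Lemma projective_acyc (P : lmodType S) i : projective P -> (i < n)%N ->
  acyc [seq 'X_j : S | j <- enum 'I_n] P i.
Proof.
move=> pP ni; have [g gS] := itext_surj (enum 'I_n) P.
have [s sE] := pP _ _ g idfun gS.
by apply: (acyc_retract sE); apply: acyc_itext; rewrite ?enum_uniq ?size_enum_ord.
Qed.
End PolynomialModules.

(** * Change of rings along a hyperplane *)

Section Quotient.
Variables (R : nzRingType) (M : lmodType R) (U : submodule M).

Definition quo_rep (x : M) : M := choose (fun y => x - y \in sm_pred U) x.

Lemma quo_repP x : x - quo_rep x \in sm_pred U.
Proof. by apply: (chooseP (P := fun y => x - y \in sm_pred U)); rewrite subrr rpred0. Qed.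

Lemma quo_rep_eq x y : x - y \in sm_pred U -> quo_rep x = quo_rep y.
Proof.
move=> xy; rewrite /quo_rep.
rewrite (eq_choose (Q := fun z => y - z \in sm_pred U)); last first.
  move=> z; apply/idP/idP => h.
    have -> : y - z = (x - z) - (x - y) by rewrite opprB [RHS]addrC addrA subrK.
    exact: rpredB.
  by have := rpredD xy h; rewrite addrA subrK.
by apply: choose_id; rewrite ?subrr ?rpred0 // -opprB rpredN.
Qed.

(** The quotient M / U, carried by the fixed points of a choice of representatives. *)
Definition quo : Type := {x : M | quo_rep x == x}.
HB.instance Definition _ := Choice.on quo.

Lemma quo_repK x : quo_rep (quo_rep x) == quo_rep x.
Proof. by apply/eqP/quo_rep_eq; rewrite -opprB rpredN quo_repP. Qed.

Definition quo_class (x : M) : quo := exist _ (quo_rep x) (quo_repK x).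

Lemma quo_classP x y : reflect (quo_class x = quo_class y) (x - y \in sm_pred U).
Proof.
apply: (iffP idP) => [xy|/(congr1 val) /= e].
  by apply: val_inj; apply: quo_rep_eq.
have -> : x - y = (x - quo_rep x) - (y - quo_rep y) by rewrite -e opprB addrA subrK.
by rewrite rpredB ?quo_repP.
Qed.

Lemma quo_classK (x : quo) : quo_class (val x) = x.
Proof. by apply: val_inj; apply/eqP/(valP x). Qed.

Definition quo_add (x y : quo) := quo_class (val x + val y).
Definition quo_opp (x : quo) := quo_class (- val x).
Definition quo_scale a (x : quo) := quo_class (a *: val x).

Lemma quo_valP x : val (quo_class x) - x \in sm_pred U.
Proof. by rewrite -opprB rpredN; apply: quo_repP. Qed.

Lemma quo_addE x y : quo_add (quo_class x) (quo_class y) = quo_class (x + y).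
Proof. by apply/quo_classP; rewrite opprD addrACA rpredD ?quo_valP. Qed.

Lemma quo_oppE x : quo_opp (quo_class x) = quo_class (- x).
Proof. by apply/quo_classP; rewrite -opprD rpredN quo_valP. Qed.

Lemma quo_scaleE a x : quo_scale a (quo_class x) = quo_class (a *: x).
Proof. by apply/quo_classP; rewrite -scalerBr rpredZ ?quo_valP. Qed.

Fact quo_addA : associative quo_add.
Proof.
move=> x y z; rewrite -[x]quo_classK -[y]quo_classK -[z]quo_classK.
by rewrite !quo_addE addrA.
Qed.

Fact quo_addC : commutative quo_add.
Proof. by move=> x y; rewrite /quo_add addrC. Qed.

Fact quo_add0 : left_id (quo_class 0) quo_add.
Proof. by move=> x; rewrite -[x]quo_classK quo_addE add0r. Qed.

Fact quo_addN : left_inverse (quo_class 0) quo_opp quo_add.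
Proof. by move=> x; rewrite -[x]quo_classK quo_oppE quo_addE addNr. Qed.

HB.instance Definition _ :=
  GRing.isZmodule.Build quo quo_addA quo_addC quo_add0 quo_addN.

Fact quo_scaleA a b x : quo_scale a (quo_scale b x) = quo_scale (a * b) x.
Proof. by rewrite -[x]quo_classK !quo_scaleE scalerA. Qed.

Fact quo_scale1 : left_id 1 quo_scale.
Proof. by move=> x; rewrite -[x]quo_classK quo_scaleE scale1r. Qed.

Fact quo_scaleDr : right_distributive quo_scale +%R.
Proof.
move=> a x y; rewrite -[x]quo_classK -[y]quo_classK.
by rewrite [_ + _]quo_addE !quo_scaleE [RHS]quo_addE scalerDr.
Qed.

Fact quo_scaleDl x : {morph quo_scale^~ x : a b / a + b}.
Proof.
by move=> a b; rewrite -[x]quo_classK !quo_scaleE [RHS]quo_addE scalerDl.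
Qed.

HB.instance Definition _ := GRing.Zmodule_isLmodule.Build R quo
  quo_scaleA quo_scale1 quo_scaleDr quo_scaleDl.

Lemma quotient_exists : exists (Q : lmodType R) (p : {linear M -> Q}),
  surj p /\ forall x, p x = 0 <-> x \in sm_pred U.
Proof.
have pL : linear quo_class.
  by move=> a x y; rewrite -quo_addE -quo_scaleE.
exists (quo : lmodType R), (mklin pL); split=> [x|x /=].
  by exists (val x); apply: quo_classK.
by split=> [/quo_classP|xU]; rewrite ?subr0 //; apply/quo_classP; rewrite subr0.
Qed.
End Quotient.

Section Restriction.
Variables (S T : nzRingType) (f : {rmorphism S -> T}).

Definition restr (f : {rmorphism S -> T}) (M : lmodType T) : Type := M.

HB.instance Definition _ (M : lmodType T) := GRing.Zmodule.on (restr f M).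

Definition restr_scale (M : lmodType T) (s : S) (x : restr f M) : restr f M :=
  f s *: (x : M).

Fact restr_scaleA M a b x : @restr_scale M a (@restr_scale M b x) = @restr_scale M (a * b) x.
Proof. by rewrite /restr_scale scalerA rmorphM. Qed.

Fact restr_scale1 M : left_id 1 (@restr_scale M).
Proof. by move=> x; rewrite /restr_scale rmorph1 scale1r. Qed.

Fact restr_scaleDr M : right_distributive (@restr_scale M) +%R.
Proof. by move=> a x y; rewrite /restr_scale scalerDr. Qed.

Fact restr_scaleDl M x : {morph (@restr_scale M)^~ x : a b / a + b}.
Proof. by move=> a b; rewrite /restr_scale rmorphD scalerDl. Qed.

HB.instance Definition _ M := GRing.Zmodule_isLmodule.Build S (restr f M)
  (@restr_scaleA M) (@restr_scale1 M) (@restr_scaleDr M) (@restr_scaleDl M).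

Lemma restrE M s (x : restr f M) : s *: x = f s *: (x : M).
Proof. by []. Qed.

Lemma restr_linear (M N : lmodType T) (g : {linear M -> N}) :
  linear (g : restr f M -> restr f N).
Proof. by move=> s x y; rewrite linearD; congr (_ + _); rewrite !restrE linearZ. Qed.

Lemma unrestr_linear (M N : lmodType T) (g : {linear restr f M -> restr f N}) :
  surj f -> linear (g : M -> N).
Proof.
move=> fS t x y; have [s <-] := fS t.
by rewrite -[_ *: x](restrE (M := M) s) linearP.
Qed.
End Restriction.

Section ChangeOfRings.
Variables (S T : comNzRingType) (f : {rmorphism S -> T}) (sig : {rmorphism T -> S}).
Variables (al : S) (D : S -> T).
Hypotheses (fsig : forall t, f (sig t) = t) (fal : f al = 0).
Hypothesis fker : forall s, exists c, s = sig (f s) + c * al.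
Hypotheses (DD : forall s t, D (s + t) = D s + D t).
Hypotheses (DM : forall s t, D (s * t) = f s * D t + D s * f t) (Dal : D al = 1).
Hypothesis al_reg : forall (P : lmodType S), projective P ->
  forall x : P, al *: x = 0 -> x = 0.

Let fS : surj f. Proof. by move=> t; exists (sig t). Qed.

(* First-order deformation of [M] along the normal direction [al]. *)
Definition deform (M : lmodType T) : Type := (M * M)%type.
HB.instance Definition _ M := GRing.Zmodule.on (deform M).

Definition deform_scale (M : lmodType T) (s : S) (x : deform M) : deform M :=
  (f s *: x.1, f s *: x.2 + D s *: x.1).

Let D1 : D 1 = 0.
Proof. by apply: (addrI (D 1)); rewrite addr0 -{3}(mulr1 1) DM rmorph1 mul1r mulr1. Qed.

Fact deform_scaleA M a b x :
  @deform_scale M a (@deform_scale M b x) = @deform_scale M (a * b) x.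
Proof.
rewrite /deform_scale /= rmorphM DM !scalerA; congr (_, _).
by rewrite scalerDr scalerDl !scalerA addrA.
Qed.

Fact deform_scale1 M : left_id 1 (@deform_scale M).
Proof. by move=> [x y]; rewrite /deform_scale rmorph1 D1 !scale1r scale0r addr0. Qed.

Fact deform_scaleDr M : right_distributive (@deform_scale M) +%R.
Proof.
move=> a x y; rewrite /deform_scale /= !scalerDr.
by congr (_, _); rewrite addrACA.
Qed.

Fact deform_scaleDl M x : {morph (@deform_scale M)^~ x : a b / a + b}.
Proof.
move=> a b; rewrite /deform_scale rmorphD DD !scalerDl.
by congr (_, _); rewrite addrACA.
Qed.

HB.instance Definition _ M := GRing.Zmodule_isLmodule.Build S (deform M)
  (@deform_scaleA M) (@deform_scale1 M) (@deform_scaleDr M) (@deform_scaleDl M).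

Lemma deformE M s (x : deform M) : s *: x = (f s *: x.1, f s *: x.2 + D s *: x.1).
Proof. by []. Qed.

(** The lift [lft] of p to the deformation of M restricts on [ker p] to a linear map delta, its
    second component, with delta (al x) = p x because D al = 1. Projectivity of [ker p] lifts h \o
    delta to r : ker p -> X, and x |-> r (al x) lifts h \o p; it descends to M because al acts as 0
    on X. *)
Lemma restr_pd1_projective (M : lmodType T) :
  pdl 1 (restr f M : lmodType S) -> projective M.
Proof.
move=> [P [p [pP pS /= pK]]] X Y g h gS.
have fstL : linear (fun x : deform M => x.1 : restr f M) by [].
have [|lft lftE] := pP _ _ (mklin fstL : {linear (deform M : lmodType S) -> _}) p.
  by move=> x; exists (x, 0).
have dL : linear (fun x : ker p => (lft (sub_incl x)).2 : restr f M).
  move=> s x y; rewrite [sub_incl _]linearP [lft _]linearP.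
  have x0 : (lft (sub_incl x)).1 = 0.
    by apply: etrans (lftE _) (kerP x).
  by rewrite deformE /= x0 scaler0 addr0.
pose hr := mklin (restr_linear (f:=f) h); pose gr := mklin (restr_linear (f:=f) g).
have [|r rE] := pK _ _ gr (hr \o mklin dL).
  by move=> y; have [x xE] := gS y; exists x.
have alL : linear (fun x : P => al *: x).
  by move=> s x y; rewrite scalerDr !scalerA mulrC.
have [|x|m mE] := @lin_factor _ (ker p) P P (@sub_incl _ _ _) (mklin alL).
- exact: sub_incl_inj.
- by apply: ker_ex; rewrite /= linearZ /= restrE fal scale0r.
have [|k kE] := lin_descend pS (h := r \o m).
  move=> x px /=; have [y yE] := ker_ex px.
  have -> : m x = al *: y by apply: sub_incl_inj; rewrite mE [RHS]linearZ /= yE.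
  by rewrite linearZ /= restrE fal scale0r.
exists (mklin (unrestr_linear k fS)) => x /=.
have [y yE] := pS x; rewrite -yE kE /=.
have -> : g (r (m y)) = gr (r (m y)) by [].
rewrite rE /= mE /= linearZ /= fal Dal scale0r scale1r add0r.
by rewrite -[p y]lftE.
Qed.

Lemma quotient_restr (P : lmodType S) :
  exists (F : lmodType T) (q : {linear P -> restr f F}),
    surj q /\ forall x, q x = 0 <-> exists y, x = al *: y.
Proof.
have aP : exists y : P, 0 = al *: y by exists 0; rewrite scaler0.
have aD a (x y : P) : (exists x', x = al *: x') -> (exists y', y = al *: y') ->
    exists z, a *: x + y = al *: z.
  move=> [x' ->] [y' ->]; exists (a *: x' + y').
  by rewrite scalerDr !scalerA mulrC.
have [Q [q [qS qE]]] := quotient_exists (mksub aP aD).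
have qal x : q (al *: x) = 0 by apply/qE/asboolP; exists x.
have qL : linear (q : P -> restr f (restr sig Q)).
  move=> s x y; rewrite linearD; congr (_ + _); rewrite restrE restrE.
  have [c {1}->] := fker s; rewrite scalerDl linearD -scalerA linearZ.
  by rewrite [X in _ + X]linearZ /= qal scaler0 addr0.
exists (restr sig Q), (mklin qL); split=> [//|x] /=.
by rewrite qE; split=> [/asboolP|?]; last exact/asboolP.
Qed.

(** P / al P is a projective T-module covering M, with kernel (ker p) / al P. As al is injective on
    P, that kernel has projective dimension at most k + 1 over S, and the induction applies. The
    gain of one comes from the base case. *)
Lemma pdl_change_rings k (M : lmodType T) :
  pdl k.+1 (restr f M : lmodType S) -> pdl k M.
Proof.
elim: k M => [|k IH] M; first exact: restr_pd1_projective.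
move=> [P [p [pP pS pK]]].
have [F [q [qS qE]]] := quotient_restr P.
have pal x : p (al *: x) = 0 by rewrite linearZ /= restrE fal scale0r.
have pF : projective F.
  move=> X Y g h gS.
  have [|l lE] := pP _ _ (mklin (restr_linear (f:=f) g)) (mklin (restr_linear (f:=f) h) \o q).
    by move=> y; have [x xE] := gS y; exists x.
  have [|m mE] := lin_descend qS (h := l).
    by move=> x /qE[y ->]; rewrite linearZ /= restrE fal scale0r.
  exists (mklin (unrestr_linear m fS)) => x /=; have [y <-] := qS x.
  by rewrite mE; apply: (lE y).
have [|d dE] := lin_descend qS (h := p); first by move=> x /qE[y ->].
pose dT := mklin (unrestr_linear d fS).
have dS : surj dT by move=> y; have [x <-] := pS y; exists (q x); rewrite /= dE.
exists F, dT; split=> //; apply: IH.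
have alL : linear (fun x : P => al *: x).
  by move=> s x y; rewrite scalerDr !scalerA mulrC.
have [|x|u uE] := @lin_factor _ (ker p) P P (@sub_incl _ _ _) (mklin alL).
- exact: sub_incl_inj.
- by apply: ker_ex; apply: pal.
have [|x|v vE] := @lin_factor _ (restr f (ker dT)) (restr f F) (ker p)
    (mklin (restr_linear (f:=f) (@sub_incl _ _ _))) (q \o (@sub_incl _ _ _)).
- exact: sub_incl_inj.
- by apply: (ker_ex (g := dT)); rewrite /= dE kerP.
apply: (pdl_right (n := k) (f := u) (g := v)) => //; last exact: (@pdl_leq _ 0).
split=> [x y e|y|b].
- apply/eqP; rewrite -subr_eq0; apply/eqP/al_reg => //.
  by rewrite scalerBr -[al *: x]uE -[al *: y]uE e subrr.
- have [x xE] := qS (sub_incl (y : ker dT)).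
  have [|z zE] := @ker_ex _ _ _ p x; first by rewrite -dE xE; apply: (kerP (y : ker dT)).
  by exists z; apply: sub_incl_inj; apply: etrans (vE z) _; rewrite /= zE.
have vq : v b = 0 <-> q (sub_incl b) = 0.
  split=> [e|e]; first by apply: etrans (esym (vE b)) _; rewrite e linear0.
  by apply: sub_incl_inj; apply: etrans (vE b) e.
rewrite vq qE; split=> [[y e]|[y <-]]; last by exists y; rewrite uE.
by exists y; apply: sub_incl_inj; rewrite uE.
Qed.
End ChangeOfRings.

(** * Exterior algebra *)

Definition form (R : comNzRingType) (l : nat) : Type := {ffun {set 'I_l} -> R}.

Section FormModule.
Variables (R : comNzRingType) (l : nat).

HB.instance Definition _ := GRing.Zmodule.copy (form R l) {ffun {set 'I_l} -> R}.

Definition form_scale (c : R) (w : form R l) : form R l :=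
  [ffun I : {set 'I_l} => c * w I].

Fact form_scaleA a b w : form_scale a (form_scale b w) = form_scale (a * b) w.
Proof. by apply/ffunP => I; rewrite !ffunE mulrA. Qed.

Fact form_scale1 : left_id 1 form_scale.
Proof. by move=> w; apply/ffunP => I; rewrite !ffunE mul1r. Qed.

Fact form_scaleDr : right_distributive form_scale +%R.
Proof. by move=> a w v; apply/ffunP => I; rewrite !ffunE mulrDr. Qed.

Fact form_scaleDl w : {morph form_scale^~ w : a b / a + b}.
Proof. by move=> a b; apply/ffunP => I; rewrite !ffunE mulrDl. Qed.

HB.instance Definition _ := GRing.Zmodule_isLmodule.Build R (form R l)
  form_scaleA form_scale1 form_scaleDr form_scaleDl.
End FormModule.

Section Forms.
Variables (R : comNzRingType) (l : nat).
Local Notation form := (form R l).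
Implicit Types (w v : form) (I J : {set 'I_l}) (i j : 'I_l) (a b : 'I_l -> R).

(** The exponent of the sign in dx_i /\ dx_J. *)
Definition below i J : nat := #|[set u in J | (u < i)%N]|.

Lemma belowD1 i j J : j \in J -> below i J = ((j < i) + below i (J :\ j))%N.
Proof.
move=> jJ; rewrite /below (cardsD1 j) inE jJ /=; congr (_ + _)%N.
by apply: eq_card => u; rewrite !inE andbA.
Qed.

Lemma belowU1 i j J : j \notin J -> below i (j |: J) = ((j < i) + below i J)%N.
Proof. by move=> jJ; rewrite (@belowD1 i j) ?setU11 // setU1K. Qed.

(** Exterior product by dx_i. Its adjoint [con1 i] is contraction with the i-th coordinate vector
    field; the two satisfy the Clifford relations [con1_ext1] and [con1_ext1_same]. *)
Definition ext1 i w : form :=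
  [ffun J : {set 'I_l} => if i \in J then (-1) ^+ below i J * w (J :\ i) else 0].

Definition con1 i w : form :=
  [ffun J : {set 'I_l} => if i \in J then 0 else (-1) ^+ below i J * w (i |: J)].

Fact ext1_linear i : linear (ext1 i).
Proof.
move=> a w v; apply/ffunP => J; rewrite !ffunE.
by case: ifP => _; rewrite ?mulr0 ?addr0 // mulrDr mulrCA.
Qed.

Fact con1_linear i : linear (con1 i).
Proof.
move=> a w v; apply/ffunP => J; rewrite !ffunE.
by case: ifP => _; rewrite ?mulr0 ?addr0 // mulrDr mulrCA.
Qed.

HB.instance Definition _ i := GRing.isLinear.Build R form form _ (ext1 i) (ext1_linear i).
HB.instance Definition _ i := GRing.isLinear.Build R form form _ (con1 i) (con1_linear i).

Lemma ext1_same i w : ext1 i (ext1 i w) = 0.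
Proof.
apply/ffunP => J; rewrite !ffunE; case: ifP => // iJ.
by rewrite !inE eqxx mulr0.
Qed.

Lemma ext1_anti i j w : i != j -> ext1 i (ext1 j w) = - ext1 j (ext1 i w).
Proof.
move=> ij; apply/ffunP => J; rewrite !ffunE !inE (eq_sym j) ij /=.
case iJ: (i \in J); case jJ: (j \in J); rewrite ?mulr0 ?oppr0 //.
rewrite (@belowD1 i j J) // (@belowD1 j i J) // [J :\ i :\ j]setDDl [J :\ j :\ i]setDDl setUC.
by rewrite !exprD; case: ltngtP ij => [||/val_inj->]; rewrite ?eqxx //= => _ _; ring.
Qed.

Lemma con1_ext1 i j w : i != j -> con1 i (ext1 j w) = - ext1 j (con1 i w).
Proof.
move=> ij; apply/ffunP => J; rewrite !ffunE !inE (eq_sym j) (negbTE ij) /=.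
case iJ: (i \in J); case jJ: (j \in J); rewrite ?mulr0 ?oppr0 //.
rewrite (@belowD1 i j J) // (@belowU1 j i J) ?iJ //.
have -> : (i |: J) :\ j = i |: (J :\ j).
  by apply/setP => u; rewrite !inE; case: (eqVneq u i) => [->|_] /=; rewrite ?ij.
by rewrite !exprD; case: ltngtP ij => [||/val_inj->]; rewrite ?eqxx //= => _ _; ring.
Qed.

Lemma con1_ext1_same i w : con1 i (ext1 i w) + ext1 i (con1 i w) = w.
Proof.
apply/ffunP => J; rewrite !ffunE; case: ifP => iJ; rewrite ?ffunE !inE eqxx /= ?add0r ?addr0.
  rewrite setD1K // (@belowD1 i i J) // ltnn add0n mulrA -exprD addnn -mul2n exprM sqrrN.
  by rewrite expr1n expr1n mul1r.
rewrite setU1K ?iJ // belowU1 ?iJ // ltnn add0n mulrA -exprD addnn -mul2n exprM sqrrN.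
by rewrite expr1n expr1n mul1r.
Qed.

(** Exterior product with the 1-form, and for [conv] contraction with the vector field, whose
    coefficients are a. *)
Definition extv a w : form := \sum_i a i *: ext1 i w.
Definition conv a w : form := \sum_i a i *: con1 i w.

Fact extv_linear a : linear (extv a).
Proof.
move=> c w v; rewrite /extv scaler_sumr -big_split; apply: eq_bigr => i _ /=.
by rewrite linearP scalerDr !scalerA mulrC.
Qed.

Fact conv_linear a : linear (conv a).
Proof.
move=> c w v; rewrite /conv scaler_sumr -big_split; apply: eq_bigr => i _ /=.
by rewrite linearP scalerDr !scalerA mulrC.
Qed.

HB.instance Definition _ a := GRing.isLinear.Build R form form _ (extv a) (extv_linear a).
HB.instance Definition _ a := GRing.isLinear.Build R form form _ (conv a) (conv_linear a).

Lemma sum_alternating (V : zmodType) (F : 'I_l -> 'I_l -> V) :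
  (forall i, F i i = 0) -> (forall i j, F i j + F j i = 0) ->
  \sum_i \sum_j F i j = 0.
Proof.
move=> F0 FN; elim: (index_enum _) => [|x s IH]; first by rewrite big_nil.
rewrite big_cons; under [X in _ + X]eq_bigr do rewrite big_cons.
rewrite big_split /= IH addr0 big_cons F0 add0r -big_split big1 // => i _.
exact: FN.
Qed.

Lemma extv_same a w : extv a (extv a w) = 0.
Proof.
rewrite /extv.
under eq_bigr => i _ do rewrite linear_sum scaler_sumr.
apply: sum_alternating => [i|i j] /=; first by rewrite linearZ /= ext1_same !scaler0.
rewrite !linearZ /= !scalerA; have [<-|ij] := eqVneq i j.
  by rewrite ext1_same scaler0 addr0.
by rewrite ext1_anti // scalerN mulrC addNr.
Qed.

Lemma extvD a b w : extv (fun i => a i + b i) w = extv a w + extv b w.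
Proof. by rewrite /extv -big_split; apply: eq_bigr => i _; rewrite scalerDl. Qed.

Lemma extvZ c a w : extv (fun i => c * a i) w = c *: extv a w.
Proof. by rewrite /extv scaler_sumr; apply: eq_bigr => i _; rewrite scalerA. Qed.

Lemma eq_extv a b w : a =1 b -> extv a w = extv b w.
Proof. by move=> ab; apply: eq_bigr => i _; rewrite ab. Qed.

Lemma extv_anti a b w : extv a (extv b w) = - extv b (extv a w).
Proof.
apply/eqP; rewrite -addr_eq0; apply/eqP.
have := extv_same (fun i => a i + b i) w.
by rewrite !extvD !linearD /= !extv_same add0r addr0.
Qed.

Lemma extv_delta i w : extv (fun j => (j == i)%:R) w = ext1 i w.
Proof.
rewrite /extv (bigD1 i) //= eqxx scale1r big1 ?addr0 // => j /negbTE ->.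
by rewrite scale0r.
Qed.

Lemma con1_extv i a w : con1 i (extv a w) = a i *: w - extv a (con1 i w).
Proof.
apply/eqP; rewrite eq_sym subr_eq eq_sym; apply/eqP.
rewrite /extv linear_sum -big_split (bigD1 i) //= linearZ /= -scalerDr con1_ext1_same.
rewrite big1 ?addr0 // => j ji; rewrite linearZ /= con1_ext1 1?eq_sym //.
by rewrite scalerN addNr.
Qed.

Lemma conv_extv b a w : conv b (extv a w) = (\sum_i a i * b i) *: w - extv a (conv b w).
Proof.
rewrite [in LHS]/conv; under eq_bigr => i _ do rewrite con1_extv scalerBr scalerA mulrC.
rewrite big_split /= -scaler_suml; congr (_ + _).
rewrite -[conv b w]/(\sum_i b i *: con1 i w).
rewrite [extv a _]linear_sum -sumrN.
by apply: eq_bigr => i _ /=; rewrite [extv a (_ *: _)]linearZ.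
Qed.

Lemma extv_conv b a w : extv a (conv b w) = (\sum_i a i * b i) *: w - conv b (extv a w).
Proof. by rewrite conv_extv opprB addrC subrK. Qed.

Definition form1 : form := [ffun J : {set 'I_l} => (J == finset.set0)%:R].
Definition dform I : form := [ffun J : {set 'I_l} => (J == I)%:R].

Lemma ext1_dform i I :
  ext1 i (dform I) = if i \in I then 0 else (-1) ^+ below i I *: dform (i |: I).
Proof.
apply/ffunP => J; rewrite !ffunE.
case: ifP => iJ; case: ifP => iI; rewrite ?ffunE.
- case: eqP => [e|_]; last by rewrite mulr0.
  by move: iI; rewrite -e !inE eqxx.
- have [->|JiI] := eqVneq J (i |: I).
    by rewrite setU1K ?iI // eqxx belowU1 ?iI // ltnn.
  rewrite (_ : (J :\ i == I) = false) ?mulr0 ?scaler0 //.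
  by apply: contra_neqF JiI => /eqP <-; rewrite setD1K.
- by [].
rewrite (_ : (J == i |: I) = false) ?mulr0 //.
by apply/negbTE/eqP => e; move: iJ; rewrite e setU11.
Qed.

Lemma dform_expand w : w = \sum_I w I *: dform I.
Proof.
apply/ffunP => J; rewrite sum_ffunE (bigD1 J) //= !ffunE eqxx mulr1.
rewrite big1 ?addr0 // => I IJ; rewrite !ffunE eq_sym (negbTE IJ).
by rewrite mulr0.
Qed.

Lemma dform_ind (P : form -> Prop) :
  (forall c x y, P x -> P y -> P (c *: x + y)) -> P 0 -> (forall I, P (dform I)) ->
  forall w, P w.
Proof.
move=> PL P0 PB w; rewrite (dform_expand w); apply: (big_ind P) => //.
  by move=> x y Px Py; rewrite -[x]scale1r; apply: PL.
by move=> I _; rewrite -[_ *: _]addr0; apply: PL.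
Qed.

(** The exterior algebra is generated from 1 by the products with the dx_i; identities between
    pull-backs are checked on these generators. *)
Lemma form_ind (P : form -> Prop) :
  (forall c x y, P x -> P y -> P (c *: x + y)) -> P form1 ->
  (forall i w, P w -> P (ext1 i w)) -> forall w, P w.
Proof.
move=> PL P1 PE.
have P0 : P 0 by rewrite -(addNr form1) -scaleN1r; apply: PL.
apply: dform_ind => // I; move: {2}#|I| (erefl #|I|) => k.
elim: k I => [|k IH] I.
  by move/eqP; rewrite cards_eq0 => /eqP ->; rewrite (_ : dform _ = form1).
move=> Ik; have [i iI] : exists i, i \in I by apply/card_gt0P; rewrite Ik.
have := PE i _ (IH (I :\ i) _); rewrite ext1_dform !inE eqxx /= setD1K //.
have -> : #|I :\ i| = k by move: Ik; rewrite (cardsD1 i) iI => -[].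
move=> /(_ erefl) /(PL ((-1) ^+ below i (I :\ i)) _ 0) /(_ P0).
by rewrite addr0 scalerA -exprD addnn -mul2n exprM sqrrN !expr1n scale1r.
Qed.

Lemma extv_set0 a w : extv a w finset.set0 = 0.
Proof.
rewrite /extv sum_ffunE big1 // => i _.
by rewrite !ffunE inE mulr0.
Qed.

Lemma extv_set1 a w j : extv a w [set j]%SET = a j * w finset.set0.
Proof.
rewrite /extv sum_ffunE (bigD1 j) //= !ffunE inE eqxx big1 ?addr0.
  have -> : [set j] :\ j = finset.set0 by apply/setP => u; rewrite !inE andNb.
  rewrite (_ : below j [set j] = 0%N) ?expr0 ?mul1r //.
  apply/eqP; rewrite cards_eq0; apply/eqP/setP => u; rewrite !inE.
  by case: eqVneq => [->|]; rewrite ?ltnn.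
by move=> i ij; rewrite !ffunE inE (negbTE ij) mulr0.
Qed.

Definition pform (p : nat) w : Prop := forall I, #|I| != p -> w I = 0.

Definition hpart (p : nat) w : form := [ffun I : {set 'I_l} => if #|I| == p then w I else 0].

Fact hpart_linear p : linear (hpart p).
Proof.
move=> c w v; apply/ffunP => I; rewrite !ffunE.
by case: ifP => _; rewrite ?mulr0 ?addr0.
Qed.

HB.instance Definition _ p := GRing.isLinear.Build R form form _ (hpart p) (hpart_linear p).

Lemma hpart_pform p w : pform p (hpart p w).
Proof. by move=> I /negbTE Ip; rewrite ffunE Ip. Qed.

Lemma hpart_id p w : pform p w -> hpart p w = w.
Proof. by move=> hw; apply/ffunP => I; rewrite ffunE; case: eqVneq => // /hw. Qed.

Lemma hpart_ext1 p i w : hpart p (ext1 i w) = if p is q.+1 then ext1 i (hpart q w) else 0.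
Proof.
case: p => [|p]; apply/ffunP => I; rewrite !ffunE.
  by case: ifP => //; rewrite cards_eq0 => /eqP ->; rewrite inE.
case: (boolP (i \in I)) => iI; last by case: ifP.
by rewrite (cardsD1 i) iI eqSS; case: ifP => _; rewrite ?mulr0.
Qed.

Lemma hpart_extv p a w : hpart p.+1 (extv a w) = extv a (hpart p w).
Proof.
by rewrite /extv linear_sum; apply: eq_bigr => i _; rewrite linearZ /= hpart_ext1.
Qed.

Lemma pform_extv p a w : pform p w -> pform p.+1 (extv a w).
Proof. by move=> /hpart_id <-; rewrite -hpart_extv; apply: hpart_pform. Qed.
End Forms.

(** * Pull-back of differential forms *)

Section Pullback.
Variables (S T : comNzRingType) (f : {rmorphism S -> T}) (l m : nat).
Variable G : 'I_l -> 'I_m -> T.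
Local Notation ext_G i := (extv (G i)).

(* The image of dx_J when dx_i is sent to the 1-form with coefficients G i. *)
Definition pull_basis (s : seq 'I_l) (J : {set 'I_l}) : form T m :=
  foldr (fun i w => if i \in J then ext_G i w else w) (form1 T m) s.

Lemma pull_basis_notin s i J : i \notin s -> pull_basis s (i |: J) = pull_basis s J.
Proof.
elim: s => [//|a s IH]; rewrite inE negb_or => /andP[ia /IH /= ->].
by rewrite !inE eq_sym (negbTE ia).
Qed.

(** Moving the new factor past those of smaller index in J produces the sign; a repeated factor
    gives 0. *)
Lemma ext_pull_basis s i J : sorted ltn (map val s) -> i \in s ->
  ext_G i (pull_basis s J) = if i \in J then 0 else
    (-1) ^+ count (fun j => (j \in J) && (j < i)%N) s *: pull_basis s (i |: J).
Proof.
elim: s => [//|a s IH] /= ps.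
have sa j : j \in s -> (a < j)%N.
  move=> js; move: ps; rewrite path_sortedE; last exact: ltn_trans.
  by case/andP=> /allP h _; apply/h/map_f.
have as' : a \notin s by apply/negP => /sa; rewrite ltnn.
rewrite inE; have [-> _|ia /= is'] := eqVneq i a.
  case: ifP => aJ; first by rewrite extv_same.
  rewrite !inE eqxx /= pull_basis_notin // (eq_in_count (a2 := pred0)).
    by rewrite count_pred0 scale1r.
  by move=> j /sa aj /=; rewrite ltnNge (ltnW aj) andbF.
rewrite !inE [a == i]eq_sym (negbTE ia) /= sa // andbT.
have {}IH := IH (path_sorted ps) is'; case: ifP => aJ; last exact: IH.
rewrite extv_anti IH; case: ifP => iJ; first by rewrite linear0 oppr0.
by rewrite linearZ /= exprS mulN1r scaleNr.
Qed.

Definition pull (w : form S l) : form T m :=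
  \sum_J f (w J) *: pull_basis (enum 'I_l) J.

Lemma pullP c x y : pull (c *: x + y) = f c *: pull x + pull y.
Proof.
rewrite /pull scaler_sumr -big_split; apply: eq_bigr => J _ /=.
by rewrite !ffunE rmorphD rmorphM scalerDl scalerA.
Qed.

Lemma pullD x y : pull (x + y) = pull x + pull y.
Proof. by rewrite -[x]scale1r pullP rmorph1 !scale1r. Qed.

Lemma pull0 : pull 0 = 0.
Proof. by apply: (addrI (pull 0)); rewrite -pullD !addr0. Qed.

Lemma pullZ c x : pull (c *: x) = f c *: pull x.
Proof. by rewrite -[c *: x]addr0 pullP pull0 addr0. Qed.

Lemma pullN x : pull (- x) = - pull x.
Proof. by rewrite -scaleN1r pullZ rmorphN1 scaleN1r. Qed.

Lemma pullB x y : pull (x - y) = pull x - pull y.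
Proof. by rewrite pullD pullN. Qed.

Lemma pull_sum (I : Type) (r : seq I) (F : I -> form S l) :
  pull (\sum_(i <- r) F i) = \sum_(i <- r) pull (F i).
Proof. exact: (big_morph pull pullD pull0). Qed.

Lemma pull_dform J : pull (dform S J) = pull_basis (enum 'I_l) J.
Proof.
rewrite /pull (bigD1 J) //= ffunE eqxx rmorph1 scale1r big1 ?addr0 // => I IJ.
by rewrite ffunE (negbTE IJ) rmorph0 scale0r.
Qed.

Lemma pull_form1 : pull (form1 S l) = form1 T m.
Proof.
rewrite [form1 S l](_ : _ = dform S finset.set0) // pull_dform /pull_basis.
by elim: (enum _) => [//|a s IH] /=; rewrite inE.
Qed.

Lemma pull_ext1 i w : pull (ext1 i w) = ext_G i (pull w).
Proof.
apply: (@dform_ind S l (fun w => pull (ext1 i w) = ext_G i (pull w))) => [c x y hx hy||I].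
- by rewrite linearP !pullP hx hy linearP.
- by rewrite linear0 !pull0 linear0.
rewrite ext1_dform pull_dform ext_pull_basis ?mem_enum //; last first.
  by rewrite val_enum_ord iota_ltn_sorted.
case: ifP => iI; first by rewrite pull0.
rewrite pullZ pull_dform rmorphXn rmorphN1; congr (_ ^+ _ *: _).
by rewrite /below cardE enumT -size_filter /enum_mem filter_predI; congr (size _);
  rewrite -filter_predI; apply: eq_filter => j; rewrite !inE.
Qed.

Lemma pull_extv a w :
  pull (extv a w) = extv (fun k => \sum_i f (a i) * G i k) (pull w).
Proof.
rewrite [extv a w]/extv pull_sum /extv.
under [RHS]eq_bigr => k _ do rewrite scaler_suml.
rewrite [RHS]exchange_big /=; apply: eq_bigr => i _.
rewrite pullZ pull_ext1 /extv scaler_sumr; apply: eq_bigr => k _.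
by rewrite scalerA.
Qed.

Lemma pull_hpart p w : pull (hpart p w) = hpart p (pull w).
Proof.
move: w p; apply: form_ind => [c x y hx hy p||i w hw p].
- by rewrite linearP !pullP hx hy linearP.
- move=> p; have h1 (R : comNzRingType) k : hpart p (form1 R k) = if p is 0 then form1 R k else 0.
    apply/ffunP => J; case: p => [|p]; rewrite !ffunE.
      by rewrite cards_eq0; case: eqP.
    by case: (eqVneq J finset.set0) => [->|_]; rewrite ?cards0 //; case: ifP.
  by rewrite pull_form1 !h1; case: (p); rewrite ?pull_form1 ?pull0.
rewrite hpart_ext1 pull_ext1; case: p => [|p].
  rewrite pull0; apply/ffunP => J; rewrite !ffunE; case: ifP => //.
  by rewrite cards_eq0 => /eqP ->; rewrite extv_set0.
by rewrite pull_ext1 hw hpart_extv.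
Qed.

Lemma pull_set0 w : pull w finset.set0 = f (w finset.set0).
Proof.
move: w; apply: form_ind => [c x y hx hy||i w hw].
- by rewrite pullP !ffunE hx hy rmorphD rmorphM.
- rewrite pull_form1 !ffunE !eqxx; symmetry; exact: (rmorph1 f).
by rewrite pull_ext1 extv_set0 -(extv_delta i) extv_set0 rmorph0.
Qed.

Lemma pull_unique (F : form S l -> form T m) :
  (forall c x y, F (c *: x + y) = f c *: F x + F y) ->
  F (form1 S l) = form1 T m -> (forall i w, F (ext1 i w) = ext_G i (F w)) ->
  forall w, F w = pull w.
Proof.
move=> FP F1 FE; apply: form_ind => [c x y hx hy||i w hw].
- by rewrite FP pullP hx hy.
- by rewrite F1 pull_form1.
by rewrite FE pull_ext1 hw.
Qed.

(* Contraction with a vector field v is carried to contraction with a vector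
   field v' as soon as the two agree on the pulled-back functions. *)
Lemma conv_pull (v : 'I_m -> T) (v' : 'I_l -> S) w :
  (forall i, \sum_k G i k * v k = f (v' i)) ->
  conv v (pull w) = pull (conv v' w).
Proof.
move=> vv; move: w; apply: form_ind => [c x y hx hy||i w hw].
- by rewrite pullP [conv v _]linearP /= hx hy [conv v' (_ + _)]linearP /= pullP.
- have c0 (R : comNzRingType) n (u : 'I_n -> R) : conv u (form1 R n) = 0.
    rewrite /conv big1 // => i _; apply/ffunP => J; rewrite !ffunE.
    case: ifP => iJ; rewrite ?mulr0 //; case: eqP => [e|_]; last by rewrite !mulr0.
    by have := setU11 i J; rewrite e inE.
  by rewrite pull_form1 !c0 pull0.
rewrite pull_ext1 -(extv_delta i w) !conv_extv hw vv pullB pullZ.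
rewrite (bigD1 i) //= eqxx mul1r big1 ?addr0 => [|j /negbTE ->]; last by rewrite mul0r.
by rewrite extv_delta pull_ext1.
Qed.
End Pullback.

Lemma pull_comp (S T U : comNzRingType) (f : {rmorphism S -> T}) (g : {rmorphism T -> U})
    (l m n : nat) (G : 'I_l -> 'I_m -> T) (H : 'I_m -> 'I_n -> U) w :
  pull g H (pull f G w) = pull (g \o f) (fun i k => \sum_j g (G i j) * H j k) w.
Proof.
apply: (@pull_unique _ _ (g \o f) _ _ _ (fun w => pull g H (pull f G w))).
- by move=> c x y; rewrite !pullP.
- by rewrite !pull_form1.
by move=> i v; rewrite pull_ext1 pull_extv.
Qed.

Lemma pull_id (S : comNzRingType) (l : nat) (f : {rmorphism S -> S}) (G : 'I_l -> 'I_l -> S) w :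
  f =1 id -> (forall i k, G i k = (k == i)%:R) -> pull f G w = w.
Proof.
move=> fE GE; symmetry; apply: (@pull_unique _ _ f _ _ G id) => //.
  by move=> c x y; rewrite fE.
by move=> i v; rewrite (eq_extv _ (GE i)) extv_delta.
Qed.

(** * Divisibility of forms by polynomials, and coprimality *)

Section Divisibility.
Variables (K : fieldType) (l : nat).
Local Notation S := {mpoly K[l]}.
Implicit Types (p q r : S) (w v : form S l).

Definition fdvd p w : Prop := exists v, w = p *: v.

(* Coprimality of p with q, in the form in which it gets used. *)
Definition cop p q : Prop := forall w, fdvd p (q *: w) -> fdvd p w.

Lemma form_scaleI p w v : p != 0 -> p *: w = p *: v -> w = v.
Proof.
move=> p0 e; apply/ffunP => I.
by have := congr1 (fun u : form S l => u I) e; rewrite !ffunE => /(mulfI p0).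
Qed.

Lemma fdvdP p c w v : fdvd p w -> fdvd p v -> fdvd p (c *: w + v).
Proof.
move=> [w' ->] [v' ->]; exists (c *: w' + v').
by rewrite scalerDr !scalerA mulrC.
Qed.

Lemma fdvd0 p : fdvd p 0.
Proof. by exists 0; rewrite scaler0. Qed.

Lemma fdvdZ p c w : fdvd p w -> fdvd p (c *: w).
Proof. by move=> pw; rewrite -[_ *: _]addr0; apply/fdvdP/fdvd0. Qed.

Lemma fdvdD p w v : fdvd p w -> fdvd p v -> fdvd p (w + v).
Proof. by move=> pw pv; rewrite -[w]scale1r; apply: fdvdP. Qed.

Lemma fdvdN p w : fdvd p w -> fdvd p (- w).
Proof. by rewrite -scaleN1r; apply: fdvdZ. Qed.

Lemma fdvdB p w v : fdvd p w -> fdvd p v -> fdvd p (w - v).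
Proof. by move=> pw /fdvdN; apply: fdvdD. Qed.

Lemma fdvdl p q w : fdvd p w -> fdvd (q * p) (q *: w).
Proof. by move=> [v ->]; exists v; rewrite scalerA. Qed.

Lemma fdvd_mull p q w : fdvd (p * q) w -> fdvd p w.
Proof. by move=> [v ->]; exists (q *: v); rewrite scalerA. Qed.

Lemma fdvd_scale p q w : (exists c, q = p * c) -> fdvd p (q *: w).
Proof. by move=> [c ->]; exists (c *: w); rewrite scalerA. Qed.

Lemma fdvd_lin p (F : form S l -> form S l) w :
  (forall c x, F (c *: x) = c *: F x) -> fdvd p w -> fdvd p (F w).
Proof. by move=> FZ [v ->]; exists (F v); rewrite FZ. Qed.

Lemma fdvd_mulI p q w : q != 0 -> fdvd (q * p) (q *: w) -> fdvd p w.
Proof.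
by move=> q0 [v]; rewrite -scalerA => /(form_scaleI q0) ->; exists v.
Qed.

Lemma cop_mulr p q r : cop p q -> cop p r -> cop p (q * r).
Proof. by move=> pq pr w; rewrite -scalerA => /pq/pr. Qed.

Lemma cop_mull p q r : p != 0 -> cop p r -> cop q r -> cop (p * q) r.
Proof.
move=> p0 pr qr w h; have [w' e] := pr w (fdvd_mull h).
rewrite e; apply: fdvdl; apply: qr; apply: (fdvd_mulI p0).
have -> : p *: (r *: w') = r *: w by rewrite e !scalerA mulrC.
by [].
Qed.

Lemma cop1 p : cop p 1.
Proof. by move=> w; rewrite scale1r. Qed.

Lemma cop1l p : cop 1 p.
Proof. by move=> w _; exists w; rewrite scale1r. Qed.

Lemma cop_unit (c : K) p : c != 0 -> cop p c%:MP.
Proof.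
move=> c0 w /(fdvdZ (c^-1)%:MP); rewrite scalerA -mpolyCM mulVf //.
by rewrite mpolyC1 scale1r.
Qed.

Lemma cop_prodr (I : eqType) (s : seq I) (F : I -> S) p :
  (forall x, x \in s -> cop p (F x)) -> cop p (\prod_(x <- s) F x).
Proof.
move=> h; rewrite big_seq; apply: (big_ind (cop p)) => //; first exact: cop1.
exact: cop_mulr.
Qed.

Lemma cop_prodl (I : eqType) (s : seq I) (F : I -> S) p :
  (forall x, x \in s -> F x != 0 /\ cop (F x) p) -> cop (\prod_(x <- s) F x) p.
Proof.
elim: s => [|x s IH] h; first by rewrite big_nil; apply: cop1l.
rewrite big_cons; have [x0 cx] := h x (mem_head _ _).
apply: cop_mull => //; apply: IH => y ys; apply: h.
by rewrite inE ys orbT.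
Qed.

Lemma fdvd_prod (I : eqType) (s : seq I) (F : I -> S) w : uniq s ->
  (forall x y, x \in s -> y \in s -> x != y -> cop (F x) (F y)) ->
  (forall x, x \in s -> fdvd (F x) w) -> fdvd (\prod_(x <- s) F x) w.
Proof.
elim: s w => [|x s IH] w /= us c h.
  by rewrite big_nil; exists w; rewrite scale1r.
move: us => /andP[xs us]; rewrite big_cons.
have [v e] := h x (mem_head _ _); rewrite e; apply: fdvdl; apply: IH => //.
  by move=> y z ys zs; apply: c; rewrite inE ?ys ?zs orbT.
move=> y ys; apply: (c y x); rewrite ?inE ?ys ?eqxx ?orbT //.
  by apply: contraNneq xs => <-.
by rewrite -e; apply: h; rewrite inE ys orbT.
Qed.

End Divisibility.

(** * Linear forms and hyperplanes *)

Section LinearForms.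
Variable K : fieldType.

Definition lin (l : nat) (a : 'I_l -> K) : {mpoly K[l]} := \sum_i (a i)%:MP * 'X_i.

(* d(lin a) /\ w *)
Definition dlin (l : nat) (a : 'I_l -> K) (w : form {mpoly K[l]} l) :
  form {mpoly K[l]} l := extv (fun i => (a i)%:MP) w.

Fact dlin_linear l (a : 'I_l -> K) : linear (@dlin l a).
Proof. exact: extv_linear. Qed.

HB.instance Definition _ l a :=
  GRing.isLinear.Build {mpoly K[l]} (form {mpoly K[l]} l) (form {mpoly K[l]} l) _
    (@dlin l a) (@dlin_linear l a).

Section Substitution.
Variables (l n : nat) (G : 'I_l -> 'I_n -> K).

Definition subst : {mpoly K[l]} -> {mpoly K[n]} :=
  mmap (@mpolyC n K) (fun j => lin (G j)).

HB.instance Definition _ := GRing.RMorphism.on subst.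

Lemma substC c : subst c%:MP = c%:MP.
Proof. by rewrite /subst mmapC. Qed.

Lemma substX j : subst 'X_j = lin (G j).
Proof. by rewrite /subst mmapX mmap1U. Qed.

Definition fpull : form {mpoly K[l]} l -> form {mpoly K[n]} n :=
  pull subst (fun j i => (G j i)%:MP).

Lemma fpullP c x y : fpull (c *: x + y) = subst c *: fpull x + fpull y.
Proof. exact: pullP. Qed.

Lemma fpullD x y : fpull (x + y) = fpull x + fpull y.
Proof. exact: pullD. Qed.

Lemma fpullB x y : fpull (x - y) = fpull x - fpull y.
Proof. exact: pullB. Qed.

Lemma fpullZ c x : fpull (c *: x) = subst c *: fpull x.
Proof. exact: pullZ. Qed.

Lemma fpull0 : fpull 0 = 0.
Proof. exact: pull0. Qed.

Lemma subst_lin a : subst (lin a) = lin (fun k => \sum_j a j * G j k).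
Proof.
rewrite /lin rmorph_sum.
under [RHS]eq_bigr => k _ do rewrite rmorph_sum mulr_suml.
rewrite [RHS]exchange_big /=; apply: eq_bigr => j _.
rewrite rmorphM /= substC substX mulr_sumr; apply: eq_bigr => k _.
by rewrite mulrA -mpolyCM.
Qed.

Lemma fpull_dlin a w : fpull (dlin a w) = dlin (fun k => \sum_j a j * G j k) (fpull w).
Proof.
rewrite /fpull pull_extv; apply: eq_extv => k.
by rewrite rmorph_sum; apply: eq_bigr => j _; rewrite /= substC mpolyCM.
Qed.

End Substitution.

Lemma eq_lin l (a b : 'I_l -> K) : a =1 b -> lin a = lin b.
Proof. by move=> ab; apply: eq_bigr => i _; rewrite ab. Qed.

Lemma eq_dlin l (a b : 'I_l -> K) w : a =1 b -> dlin a w = dlin b w.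
Proof. by move=> ab; apply: eq_extv => i; rewrite ab. Qed.

Lemma linZ l c (a : 'I_l -> K) : lin (fun i => c * a i) = c%:MP * lin a.
Proof. by rewrite /lin mulr_sumr; apply: eq_bigr => i _; rewrite mpolyCM mulrA. Qed.

Lemma linD l (a b : 'I_l -> K) : lin (fun i => a i + b i) = lin a + lin b.
Proof. by rewrite /lin -big_split; apply: eq_bigr => i _; rewrite mpolyCD mulrDl. Qed.

Lemma dlinZ l c (a : 'I_l -> K) w : dlin (fun i => c * a i) w = c%:MP *: dlin a w.
Proof. by rewrite /dlin -extvZ; apply: eq_extv => i; rewrite mpolyCM. Qed.

Lemma dlinD l (a b : 'I_l -> K) w : dlin (fun i => a i + b i) w = dlin a w + dlin b w.
Proof. by rewrite /dlin -extvD; apply: eq_extv => i; rewrite mpolyCD. Qed.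

Lemma subst_comp l m n (G : 'I_l -> 'I_m -> K) (H : 'I_m -> 'I_n -> K) p :
  subst H (subst G p) = subst (fun i k => \sum_j G i j * H j k) p.
Proof.
apply: (@eq_mpoly_rmorph K l _ (subst H \o subst G)
  (subst (fun i k => \sum_j G i j * H j k))) => [c|i] /=.
  by rewrite !substC.
by rewrite !substX subst_lin.
Qed.

Lemma fpull_comp l m n (G : 'I_l -> 'I_m -> K) (H : 'I_m -> 'I_n -> K) w :
  fpull H (fpull G w) = fpull (fun i k => \sum_j G i j * H j k) w.
Proof.
rewrite /fpull pull_comp; apply: pull_unique => [c x y||i v].
- by rewrite pullP /= subst_comp.
- exact: pull_form1.
rewrite pull_ext1; apply: eq_extv => k.
by rewrite rmorph_sum; apply: eq_bigr => j _; rewrite /= substC mpolyCM.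
Qed.

(* G is a parametrization of the hyperplane (lin a = 0), with left inverse Rh
   whose kernel is spanned by u. *)
Record splitting (l n : nat) (a : 'I_l -> K) (G : 'I_l -> 'I_n -> K)
    (Rh : 'I_n -> 'I_l -> K) (u : 'I_l -> K) : Prop := Splitting {
  split_RG : forall i k, \sum_j Rh i j * G j k = (i == k)%:R;
  split_au : \sum_i a i * u i = 1;
  split_GR : forall j i, \sum_k G j k * Rh k i = (j == i)%:R - u j * a i }.

Section Splitting.
Variables (l n : nat) (a : 'I_l -> K) (G : 'I_l -> 'I_n -> K).
Variables (Rh : 'I_n -> 'I_l -> K) (u : 'I_l -> K).
Hypothesis sp : splitting a G Rh u.
Local Notation f := (subst G).
Local Notation sig := (subst Rh).

Lemma sum_delta (R : nzRingType) m (F : 'I_m -> R) k : \sum_j F j * (j == k)%:R = F k.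
Proof.
rewrite (bigD1 k) //= eqxx mulr1 big1 ?addr0 // => j /negbTE ->; exact: mulr0.
Qed.

Lemma vanishing_functional (b : 'I_l -> K) :
  (forall k, \sum_j b j * G j k = 0) -> forall i, b i = (\sum_j b j * u j) * a i.
Proof.
move=> bG i; apply/eqP; rewrite -subr_eq0; apply/eqP.
transitivity (\sum_j b j * \sum_k G j k * Rh k i).
  under [RHS]eq_bigr => j _ do rewrite (split_GR sp) mulrBr mulrA.
  by rewrite sumrB sum_delta mulr_suml.
under eq_bigr => j _ do rewrite mulr_sumr.
rewrite exchange_big big1 //= => k _.
under eq_bigr => j _ do rewrite mulrA.
by rewrite -mulr_suml bG mul0r.
Qed.

(** Computing the product G Rh G in two ways gives u_j X = 0 for all j, and the pairing of a with u
    is 1. *)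
Lemma split_aG k : \sum_j a j * G j k = 0.
Proof.
set X := \sum_j a j * G j k; suff uX j : u j * X = 0.
  rewrite -[LHS]mul1r -(split_au sp) mulr_suml big1 // => i _.
  by rewrite -mulrA uX mulr0.
have : G j k = G j k - u j * X.
  rewrite -{1}(sum_delta (G j)).
  under eq_bigr => i _ do rewrite -(split_RG sp) mulr_sumr.
  rewrite exchange_big /=.
  under eq_bigr => j' _.
    under eq_bigr => i _ do rewrite mulrA.
    rewrite -mulr_suml (split_GR sp) mulrBl -mulrA.
  over.
  rewrite sumrB -mulr_sumr; congr (_ - _).
  under eq_bigr => j' _ do rewrite mulrC eq_sym.
  exact: (sum_delta (fun j' => G j' k)).
by move/eqP; rewrite eq_sym -subr_eq0 addrAC subrr sub0r oppr_eq0 => /eqP.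
Qed.

Lemma lin0 m (b : 'I_m -> K) : (forall i, b i = 0) -> lin b = 0.
Proof. by move=> b0; rewrite /lin big1 // => i _; rewrite b0 mpolyC0 mul0r. Qed.

Lemma dlin0 m (b : 'I_m -> K) w : (forall i, b i = 0) -> dlin b w = 0.
Proof. by move=> b0; rewrite /dlin /extv big1 // => i _; rewrite b0 mpolyC0 scale0r. Qed.

Lemma subst_a : f (lin a) = 0.
Proof. by rewrite subst_lin; apply/lin0/split_aG. Qed.

Lemma fpull_a w : fpull G (dlin a w) = 0.
Proof. by rewrite fpull_dlin; apply/dlin0/split_aG. Qed.

Lemma lin_delta m (k : 'I_m) : lin (fun i => (k == i)%:R) = 'X_k :> {mpoly K[m]}.
Proof.
rewrite /lin (bigD1 k) //= eqxx mpolyC1 mul1r big1 ?addr0 // => i.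
by rewrite eq_sym => /negbTE ->; rewrite mpolyC0 mul0r.
Qed.

Lemma subst_section p : f (sig p) = p.
Proof.
rewrite subst_comp; apply: (@eq_mpoly_rmorph K n _ (subst _) idfun) => [c|i] /=.
  by rewrite substC.
by rewrite substX -[RHS]lin_delta; apply: eq_lin => k; apply: (split_RG sp).
Qed.

Lemma fpull_section w : fpull G (fpull Rh w) = w.
Proof.
rewrite fpull_comp; apply: pull_id => [p|i k].
  by have := subst_section p; rewrite subst_comp.
by rewrite (split_RG sp) eq_sym; case: (k == i); rewrite ?mpolyC1 ?mpolyC0.
Qed.

Lemma subst_retract p : exists c, p = sig (f p) + c * lin a.
Proof.
move: p; apply: mpoly_gen_ind => [c|i|p q [c e] [d e']|p q [c e] [d e']].
- by exists 0; rewrite !substC mul0r addr0.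
- exists (u i)%:MP; rewrite substX subst_lin -linZ -linD -[LHS]lin_delta.
  by apply: eq_lin => k; rewrite (split_GR sp) subrK.
- by exists (c + d); rewrite {1}e {1}e' !rmorphD mulrDl addrACA.
have expand (A B C D x y : {mpoly K[l]}) :
    y = B + D * x -> (A + C * x) * y = A * B + (A * D + C * y) * x.
  by move=> ->; ring.
by exists (sig (f p) * d + c * q); rewrite !rmorphM {1}e; apply: expand.
Qed.

Lemma subst_ker p : f p = 0 <-> exists c, p = lin a * c.
Proof.
split=> [fp|[c ->]]; last by rewrite rmorphM /= subst_a mul0r.
have [c e] := subst_retract p; exists c.
by rewrite e fp rmorph0 add0r mulrC.
Qed.

Lemma lin_neq0 : lin a != 0.
Proof.
apply/eqP => a0; have := split_au sp.
rewrite big1 => [/eqP|i _]; first by rewrite eq_sym oner_eq0.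
suff -> : a i = 0 by rewrite mul0r.
have := congr1 (fun p : {mpoly K[l]} => p@_(U_(i))%MM) a0.
rewrite mcoeff0 /lin raddf_sum (bigD1 i) //= mcoeffCM mcoeffX eqxx mulr1.
rewrite big1 ?addr0 // => j ji; rewrite mcoeffCM mcoeffX.
by rewrite eq_mnm1 (negbTE ji) mulr0.
Qed.

(** The quotient by lin a is a polynomial ring, hence a domain, so lin a is prime. *)
Lemma lin_cop p : f p != 0 -> cop (lin a) p.
Proof.
move=> fp w [v e].
have h I : exists c, w I = lin a * c.
  apply/subst_ker/eqP; have := congr1 (fun x : form _ _ => f (x I)) e.
  rewrite !ffunE !rmorphM /= subst_a mul0r => /eqP.
  by rewrite mulf_eq0 (negbTE fp).
have [c cE] := choice h.
by exists [ffun I => c I]; apply/ffunP => I; rewrite !ffunE.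
Qed.

Definition vec m (v : 'I_m -> K) : 'I_m -> {mpoly K[m]} := fun i => (v i)%:MP.

(** Contraction with u is a contracting homotopy for the exterior product with d(lin a), as a pairs
    with u to 1. *)
Lemma conv_u_dlin w : conv (vec u) (dlin a w) = w - dlin a (conv (vec u) w).
Proof.
rewrite /dlin conv_extv; congr (_ - _); rewrite -[RHS]scale1r; congr (_ *: _).
rewrite -mpolyC1 -(split_au sp) rmorph_sum; apply: eq_bigr => i _.
by rewrite [RHS]mpolyCM.
Qed.

Lemma dlin_delta m (i : 'I_m) w : dlin (fun j => (i == j)%:R) w = ext1 i w.
Proof.
rewrite -extv_delta; apply: eq_extv => j; rewrite eq_sym.
by case: (j == i); rewrite ?mpolyC1 ?mpolyC0.
Qed.

Lemma fpull_proj_ext1 i w : fpull Rh (fpull G (ext1 i w)) =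
  ext1 i (fpull Rh (fpull G w)) - (u i)%:MP *: dlin a (fpull Rh (fpull G w)).
Proof.
rewrite -dlin_delta !fpull_dlin -dlin_delta -scaleNr -mpolyCN -dlinZ -dlinD.
apply: eq_dlin => j; rewrite mulNr -(split_GR sp); apply: eq_bigr => k _.
congr (_ * _); rewrite (bigD1 i) //= eqxx mul1r big1 ?addr0 // => j'.
by rewrite eq_sym => /negbTE ->; rewrite mul0r.
Qed.

(* Modulo lin a, every form is the sum of a multiple of d(lin a) and of a form
   pulled back from the hyperplane. *)
Lemma dlin_proj w : fdvd (lin a) (dlin a (fpull Rh (fpull G w)) - dlin a w).
Proof.
move: w; apply: form_ind => [c x y hx hy||i w hw].
- have [d e] := subst_retract c; rewrite !fpullP.
  set X := fpull Rh (fpull G x) in hx *; set Y := fpull Rh (fpull G y) in hy *.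
  have eC z : c *: z = sig (f c) *: z + (d * lin a) *: z by rewrite {1}e scalerDl.
  rewrite ![dlin a (_ *: _ + _)]linearP /= eC.
  have -> : sig (f c) *: dlin a X + dlin a Y -
      (sig (f c) *: dlin a x + (d * lin a) *: dlin a x + dlin a y) =
    sig (f c) *: (dlin a X - dlin a x) + (dlin a Y - dlin a y) - (d * lin a) *: dlin a x.
    by rewrite scalerBr [_ + _ + dlin a y]addrAC opprD addrA; congr (_ - _);
      rewrite opprD addrACA.
  apply: fdvdB; last by apply: fdvd_scale; exists d; rewrite mulrC.
  exact: fdvdP.
- by rewrite /fpull !pull_form1 subrr; apply: fdvd0.
rewrite fpull_proj_ext1 [dlin a (_ - _)]linearB /= [dlin a (_ *: _)]linearZ /=.
rewrite [dlin a (dlin a _)]extv_same scaler0 subr0.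
rewrite -!dlin_delta ![dlin a (dlin _ _)]extv_anti -opprD -linearN -linearD.
by apply: fdvdN; apply: fdvd_lin hw => c' x; rewrite linearZ.
Qed.

(** If d(lin a) /\ w = q mu, then mu = d(lin a) /\ nu by the homotopy; so w is q nu plus a multiple
    of d(lin a), and restriction to the hyperplane kills the latter. *)
Lemma fpull_dvd q w : fdvd q (dlin a w) -> q != 0 -> fdvd (f q) (fpull G w).
Proof.
move=> [mu e] q0; have mu0 : dlin a mu = 0.
  by apply: (form_scaleI q0); rewrite -[LHS]linearZ -e scaler0 [LHS]extv_same.
have muE : mu = dlin a (conv (vec u) mu).
  have := conv_u_dlin mu; rewrite mu0 linear0 => /esym/eqP.
  by rewrite subr_eq0 => /eqP.
have w0 : dlin a (w - q *: conv (vec u) mu) = 0.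
  by rewrite linearB linearZ /= -muE e subrr.
have wE : w = q *: conv (vec u) mu + dlin a (conv (vec u) (w - q *: conv (vec u) mu)).
  have := conv_u_dlin (w - q *: conv (vec u) mu); rewrite w0 linear0 => /esym/eqP.
  by rewrite subr_eq0 => /eqP <-; rewrite addrC subrK.
exists (fpull G (conv (vec u) mu)).
by rewrite {1}wE fpullD fpull_a addr0 fpullZ.
Qed.

Lemma fpull_ker w : fpull G w = 0 <-> fdvd (lin a) (dlin a w).
Proof.
split=> [e|/fpull_dvd /(_ lin_neq0) [v ->]]; last by rewrite subst_a scale0r.
have := dlin_proj w; rewrite e fpull0 linear0 sub0r.
by move/fdvdN; rewrite opprK.
Qed.

End Splitting.
End LinearForms.

Section HyperplaneCoordinates.
Variable K : fieldType.

Definition co (l : nat) (L : {vspace 'rV[K]_l}) (i : 'I_l) : K :=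
  linear_form L (delta_mx 0 i).

Definition dual l (b : 'I_l -> K) (x : 'rV[K]_l) : K := \sum_i b i * x 0 i.

Lemma alphaE l (L : {vspace 'rV[K]_l}) : alpha L = lin (co L).
Proof. by apply: eq_bigr => i _; rewrite mul_mpolyC. Qed.

Lemma dual_linear l (b : 'I_l -> K) c x y : dual b (c *: x + y) = c * dual b x + dual b y.
Proof.
rewrite /dual mulr_sumr -big_split; apply: eq_bigr => i _.
by rewrite !mxE mulrDr mulrCA.
Qed.

Lemma dual_delta l (b : 'I_l -> K) k : dual b (delta_mx 0 k) = b k.
Proof.
by rewrite /dual (bigD1 k) //= mxE !eqxx mulr1 big1 ?addr0 // => i /negbTE ik; rewrite mxE ik mulr0.
Qed.

Lemma memE l (L : {vspace 'rV[K]_l}) x : hyperplane L -> (x \in L) = (dual (co L) x == 0).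
Proof.
move=> hL; rewrite -{1}(lker_linear_form hL) memv_ker; congr (_ == 0).
rewrite [in LHS](row_sum_delta x) linear_sum; apply: eq_bigr => i _.
by rewrite linearZ mulrC.
Qed.

Lemma lin_eq0 l (b : 'I_l -> K) : lin b = 0 -> forall i, b i = 0.
Proof.
move=> b0 i; have := congr1 (fun p : {mpoly K[l]} => p@_(U_(i))%MM) b0.
rewrite mcoeff0 /lin raddf_sum (bigD1 i) //= mcoeffCM mcoeffX eqxx mulr1.
rewrite big1 ?addr0 // => j ji; rewrite mcoeffCM mcoeffX.
by rewrite eq_mnm1 (negbTE ji) mulr0.
Qed.

Lemma hyperplane_eq l (L M : {vspace 'rV[K]_l}) :
  hyperplane L -> hyperplane M -> (L <= M)%VS -> L = M.
Proof.
move=> /eqP hL /eqP hM LM; apply/eqP; rewrite eqEdim LM /=.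
by rewrite -ltnS hL hM.
Qed.

Definition mat_of n l (phi : 'Hom('rV[K]_n, 'rV[K]_l)) (j : 'I_l) (k : 'I_n) : K :=
  phi (delta_mx 0 k) 0 j.

Lemma mat_ofE n l (phi : 'Hom('rV[K]_n, 'rV[K]_l)) y j :
  phi y 0 j = \sum_k mat_of phi j k * y 0 k.
Proof.
rewrite {1}(row_sum_delta y) linear_sum summxE; apply: eq_bigr => k _.
by rewrite linearZ mxE mulrC.
Qed.

Lemma dual_mat_of n l (phi : 'Hom('rV[K]_n, 'rV[K]_l)) b y :
  dual b (phi y) = dual (fun k => \sum_j b j * mat_of phi j k) y.
Proof.
rewrite /dual; under [RHS]eq_bigr => k _ do rewrite mulr_suml.
rewrite exchange_big; apply: eq_bigr => j _; rewrite mat_ofE mulr_sumr.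
by apply: eq_bigr => k _; rewrite mulrA.
Qed.

Lemma hyperplane_transversal l (L : {vspace 'rV[K]_l}) : hyperplane L ->
  exists u, dual (co L) u = 1.
Proof.
move=> hL; have [v vL] : exists v, v \notin L.
  apply: contrapT => h; have : L = fullv.
    by apply/vspaceP => v; rewrite memvf; apply: contrapT => /negP vL; apply: h; exists v.
  by move=> e; move: hL; rewrite /hyperplane e dimvf dim_matrix mul1r eqn_leq ltnn.
have v0 : dual (co L) v != 0 by rewrite -memE.
exists ((dual (co L) v)^-1 *: v).
have := dual_linear (co L) (dual (co L) v)^-1 v 0.
rewrite addr0 => ->; rewrite mulVf // -[RHS]addr0; congr (_ + _).
by rewrite /dual big1 // => i _; rewrite mxE mulr0.
Qed.

Lemma mem_limg n l (L : {vspace 'rV[K]_l}) (phi : 'Hom('rV[K]_n, 'rV[K]_l)) y :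
  limg phi = L -> phi y \in L.
Proof. by move=> <-; apply: memv_img; apply: memvf. Qed.

(** Rh is the projection onto L along a transversal vector u, normalized by the form of L, followed
    by the inverse of phi. *)
Lemma split_exists n l (L : {vspace 'rV[K]_l}) (phi : 'Hom('rV[K]_n, 'rV[K]_l)) :
  hyperplane L -> lker phi = 0%VS -> limg phi = L ->
  exists Rh u, splitting (co L) (mat_of phi) Rh u.
Proof.
move=> hL k0 im; have [u u1] := hyperplane_transversal hL.
pose rho (v : 'rV[K]_l) : 'rV[K]_n := (phi^-1)%VF (v - dual (co L) v *: u).
have rhoL c x y : rho (c *: x + y) = c *: rho x + rho y.
  rewrite /rho -linearP dual_linear; congr (_ _).
  by rewrite scalerDl -scalerA opprD addrACA scalerBr.
have phirho v : phi (rho v) = v - dual (co L) v *: u.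
  rewrite /rho limg_lfunVK // im memE // -scaleNr addrC dual_linear u1 mulr1 addNr //.
have rhophi y : rho (phi y) = y.
  have : phi y \in L by apply: mem_limg.
  rewrite memE // /rho => /eqP ->; rewrite scale0r subr0.
  by apply: lker0_lfunK; rewrite k0.
exists (fun i j => rho (delta_mx 0 j) 0 i), (fun i => u 0 i); split.
- move=> i k; transitivity (rho (phi (delta_mx 0 k)) 0 i); last first.
    by rewrite rhophi mxE eqxx.
  have rho0 : rho 0 = 0 by have := rhoL (-1) 0 0; rewrite scaler0 addr0 scaleN1r addNr.
  have rhoD : {morph rho : x y / x + y} by move=> x y; have := rhoL 1 x y; rewrite !scale1r.
  rewrite [phi _]row_sum_delta (big_morph rho rhoD rho0) summxE.
  apply: eq_bigr => j _; have := rhoL (phi (delta_mx 0 k) 0 j) (delta_mx 0 j) 0.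
  by rewrite rho0 !addr0 => ->; rewrite mxE mulrC.
- exact: u1.
by move=> j i; rewrite -mat_ofE phirho !mxE dual_delta mulrC; congr (_ - _).
Qed.

Lemma vanishing_on_hyperplane l (L : {vspace 'rV[K]_l}) (b : 'I_l -> K) :
  hyperplane L -> (forall x, x \in L -> dual b x = 0) ->
  exists c, forall i, b i = c * co L i.
Proof.
move=> hL bL; have [phi k0 im] := coordinates_exist L.
have [Rh [u sp]] := split_exists hL k0 im.
exists (\sum_j b j * u j); apply: (vanishing_functional sp) => k.
have := dual_mat_of phi b (delta_mx 0 k); rewrite dual_delta => <-.
by apply: bL; apply: mem_limg.
Qed.

Lemma alpha_cop l (L M : {vspace 'rV[K]_l}) :
  hyperplane L -> hyperplane M -> L != M -> cop (alpha L) (alpha M).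
Proof.
move=> hL hM LM; have [phi k0 im] := coordinates_exist L.
have [Rh [u sp]] := split_exists hL k0 im.
rewrite !alphaE; apply: (lin_cop sp); rewrite subst_lin.
apply: contra_neq LM => /lin_eq0 e; apply: hyperplane_eq => //.
apply/subvP => x; rewrite -im => /memv_imgP[y _ ->].
rewrite memE // dual_mat_of /dual big1 // => k _.
by rewrite e mul0r.
Qed.

Lemma alpha_neq0 l (L : {vspace 'rV[K]_l}) : hyperplane L -> alpha L != 0.
Proof.
move=> hL; have [phi k0 im] := coordinates_exist L.
by have [Rh [u sp]] := split_exists hL k0 im; rewrite alphaE (lin_neq0 sp).
Qed.

Lemma restr_alpha n l (H L : {vspace 'rV[K]_l}) (phi : 'Hom('rV[K]_n, 'rV[K]_l)) :
  hyperplane H -> hyperplane L -> L != H -> limg phi = H ->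
  hyperplane (phi @^-1: (H :&: L))%VS ->
  exists2 c, c != 0 & forall k,
    \sum_j co L j * mat_of phi j k = c * co (phi @^-1: (H :&: L))%VS k.
Proof.
move=> hH hL LH im hX.
have [c cE] : exists c, forall k, \sum_j co L j * mat_of phi j k =
    c * co (phi @^-1: (H :&: L))%VS k.
  apply: vanishing_on_hyperplane => // y; rewrite -memv_preim memv_cap => /andP[_].
  by rewrite memE // dual_mat_of => /eqP.
exists c => //; apply: contra_neq LH => c0; apply/esym/hyperplane_eq => //.
apply/subvP => x; rewrite -im => /memv_imgP[y _ ->].
rewrite memE // dual_mat_of /dual big1 // => k _.
by rewrite cE c0 !mul0r.
Qed.
End HyperplaneCoordinates.

(** * Logarithmic forms and restriction *)

Section LogForms.
Variable K : fieldType.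

(** The module N(A) with all degrees at once; homogeneity is imposed in [logP]. *)
Definition logN (l : nat) (A : {fset {vspace 'rV[K]_l}}) (w : form {mpoly K[l]} l) : Prop :=
  forall L, L \in A -> fdvd (alpha L) (dlin (co L) w).

Lemma logNP l (A : {fset {vspace 'rV[K]_l}}) c w v :
  logN A w -> logN A v -> logN A (c *: w + v).
Proof. by move=> hw hv L LA; rewrite linearP; apply: fdvdP; [apply: hw|apply: hv]. Qed.

Lemma logN0 l (A : {fset {vspace 'rV[K]_l}}) : logN A 0.
Proof. by move=> L LA; rewrite linear0; apply: fdvd0. Qed.

Lemma logNZ l (A : {fset {vspace 'rV[K]_l}}) c w : logN A w -> logN A (c *: w).
Proof. by move=> hw; rewrite -[_ *: _]addr0; apply/logNP/logN0. Qed.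

Lemma logNB l (A : {fset {vspace 'rV[K]_l}}) w v : logN A w -> logN A v -> logN A (w - v).
Proof. by move=> hw hv; rewrite addrC -scaleN1r; apply: logNP. Qed.

Lemma logN_sub l (A A' : {fset {vspace 'rV[K]_l}}) w :
  {subset A <= A'} -> logN A' w -> logN A w.
Proof. by move=> sub h L /sub; apply: h. Qed.

(** Contraction is an antiderivation: d alpha_L /\ (contraction of w) is v(alpha_L) w minus the
    contraction of d alpha_L /\ w, and alpha_L divides both terms when v is a logarithmic vector
    field. *)
Lemma logN_conv l (A : {fset {vspace 'rV[K]_l}}) (v : 'I_l -> {mpoly K[l]}) w :
  (forall L, L \in A -> exists s, \sum_i (co L i)%:MP * v i = alpha L * s) ->
  logN A w -> logN A (conv v w).
Proof.
move=> hv hw L LA; rewrite /dlin extv_conv; have [s ->] := hv L LA.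
apply: fdvdB; first by apply: fdvd_scale; exists s.
by apply: fdvd_lin (hw L LA) => c x; rewrite linearZ.
Qed.

Lemma logN_hpart l (A : {fset {vspace 'rV[K]_l}}) p w : logN A w -> logN A (hpart p w).
Proof.
move=> hw L LA; rewrite /dlin -hpart_extv.
by apply: fdvd_lin (hw L LA) => c x; rewrite linearZ.
Qed.

Lemma cop_unitl l (c : K) (p : {mpoly K[l]}) : c != 0 -> cop c%:MP p.
Proof.
move=> c0 w _; exists (c^-1%:MP *: w).
by rewrite scalerA -mpolyCM mulfV // mpolyC1 scale1r.
Qed.

Section Restrict.
Variables (l : nat) (A : {fset {vspace 'rV[K]_l}}) (H : {vspace 'rV[K]_l}).
Variable phi : 'Hom('rV[K]_(\dim H), 'rV[K]_l).
Hypotheses (hA : arrangement A) (HA : H \in A).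
Hypotheses (k0 : lker phi = 0%VS) (im : limg phi = H).
Local Notation n := (\dim H).
Local Notation G := (mat_of phi).
Local Notation f := (subst G).
Local Notation S := {mpoly K[l]}.
Local Notation T := {mpoly K[n]}.
Local Notation A' := (A `\ H)%fset.

Definition trace (L : {vspace 'rV[K]_l}) : {vspace 'rV[K]_n} := (phi @^-1: (H :&: L))%VS.

Definition traces : {fset {vspace 'rV[K]_n}} :=
  [fset (phi @^-1: M)%VS | M in restriction A H]%fset.

Lemma tracesP X : reflect (exists2 L, L \in A' & X = trace L) (X \in traces).
Proof.
apply: (iffP idP) => [/imfsetP[/= _ /imfsetP[/= L LA ->] ->]|[L LA ->]].
  by exists L.
by apply/imfsetP; exists (H :&: L)%VS => //; apply/imfsetP; exists L.
Qed.

Lemma traces_arr : arrangement traces.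
Proof. exact: restriction_arrangement. Qed.

Lemma delA L : L \in A' -> hyperplane L /\ L != H.
Proof. by rewrite !inE => /andP[LH /hA]. Qed.

Lemma mem_trace L y : (y \in trace L) = (phi y \in L).
Proof. by rewrite -memv_preim memv_cap (mem_limg _ im). Qed.

Lemma co_trace L : L \in A' ->
  exists2 c, c != 0 & forall k, \sum_j co L j * G j k = c * co (trace L) k.
Proof.
move=> LA; have [hL LH] := delA LA.
by apply: restr_alpha => //; [apply: hA|apply: traces_arr; apply/tracesP; exists L].
Qed.

Lemma subst_alpha L : L \in A' ->
  exists2 c, c != 0 & f (alpha L) = c%:MP * alpha (trace L).
Proof.
move=> /co_trace[c c0 cE]; exists c => //.
by rewrite !alphaE subst_lin -linZ; apply: eq_lin.
Qed.

Lemma defpoly_neq0 m (B : {fset {vspace 'rV[K]_m}}) : arrangement B -> defpoly B != 0.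
Proof.
move=> hB; rewrite /defpoly prodf_seq_neq0; apply/allP => X XB /=.
exact/alpha_neq0/hB.
Qed.

Lemma subst_defpoly_neq0 : f (defpoly A') != 0.
Proof.
rewrite /defpoly rmorph_prod prodf_seq_neq0; apply/allP => L LA /=.
have [c c0 ->] := subst_alpha LA.
rewrite mulf_neq0 ?mpolyC_eq0 //; apply/alpha_neq0/traces_arr.
by apply/tracesP; exists L.
Qed.

(** Gathers the hyperplanes meeting H in the same trace X; on H the product becomes a nonzero
    constant times a power of alpha_X. *)
Definition block (X : {vspace 'rV[K]_n}) : S := \prod_(L <- A' | trace L == X) alpha L.

Lemma defpoly_blocks : defpoly A' = \prod_(X <- traces) block X.
Proof.
rewrite /defpoly /block.
under [RHS]eq_bigr => X _ do rewrite big_mkcond.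
rewrite exchange_big /= !big_seq; apply: eq_bigr => L LA.
have Lt : trace L \in traces by apply/tracesP; exists L.
rewrite (bigD1_seq (trace L)) ?fset_uniq //= eqxx big1 ?mulr1 // => X.
by rewrite eq_sym => /negbTE ->.
Qed.

Lemma block_cop X p : X \in traces -> cop (alpha X) p -> cop (f (block X)) p.
Proof.
move=> XB cX; rewrite /block -big_filter rmorph_prod; apply: cop_prodl => L /=.
rewrite mem_filter => /andP[/eqP tL LA]; have [c c0 ->] := subst_alpha LA.
have a0 := alpha_neq0 (traces_arr XB).
rewrite tL mulf_neq0 ?mpolyC_eq0 //; split=> //.
by apply: cop_mull; rewrite ?mpolyC_eq0 //; apply: cop_unitl.
Qed.

Lemma cop_block X p : X \in traces -> cop p (alpha X) -> cop p (f (block X)).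
Proof.
move=> XB cX; rewrite /block -big_filter rmorph_prod; apply: cop_prodr => L /=.
rewrite mem_filter => /andP[/eqP tL LA]; have [c c0 ->] := subst_alpha LA.
by rewrite tL; apply: cop_mulr => //; apply: cop_unit.
Qed.

Lemma traces_cop X Y : X \in traces -> Y \in traces -> X != Y -> cop (alpha X) (alpha Y).
Proof. by move=> XB YB; apply: alpha_cop; apply: traces_arr. Qed.

Lemma H_split : exists Rh u, splitting (co H) G Rh u.
Proof. by apply: split_exists => //; apply: hA. Qed.

(** Let [bt] be a form on V restricting to that of X. For L in the block, alpha_L is a combination
    of [bt], with nonzero coefficient, and alpha_H, so alpha_L divides d alpha_H /\ d bt /\ w. The
    alpha_L are pairwise coprime, and [fpull_dvd] carries the divisibility to H. *)
Lemma block_dvd_dlin X w : X \in traces -> logN A' w ->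
  fdvd (f (block X)) (dlin (co X) (fpull G w)).
Proof.
move=> XB hw; have [Rh [u sp]] := H_split.
pose bt i := \sum_k co X k * Rh k i.
have btG k : \sum_j bt j * G j k = co X k.
  rewrite /bt; under eq_bigr => j _ do rewrite mulr_suml.
  rewrite exchange_big /=; under eq_bigr => i _.
    under eq_bigr => j _ do rewrite -mulrA.
    rewrite -mulr_sumr (split_RG sp).
  over.
  exact: sum_delta.
have -> : dlin (co X) (fpull G w) = fpull G (dlin bt w).
  by rewrite fpull_dlin; apply: eq_dlin => k; rewrite btG.
apply: (fpull_dvd sp); last first.
  rewrite /block prodf_seq_neq0; apply/allP => L LA; apply/implyP => _.
  by apply: alpha_neq0; have [] := delA LA.
rewrite /block -big_filter; apply: fdvd_prod.
- by rewrite filter_uniq ?fset_uniq.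
- move=> L M; rewrite !mem_filter => /andP[_ /delA[hL _]] /andP[_ /delA[hM _]].
  exact: alpha_cop.
move=> L; rewrite mem_filter => /andP[/eqP tL LA].
have [c c0 cE] := co_trace LA; rewrite tL in cE.
have vb k : \sum_j (co L j - c * bt j) * G j k = 0.
  transitivity (\sum_j co L j * G j k - c * \sum_j bt j * G j k).
    by rewrite mulr_sumr -sumrB; apply: eq_bigr => j _; rewrite mulrBl mulrA.
  by rewrite cE btG subrr.
have bE i : co L i = c * bt i + (\sum_j (co L j - c * bt j) * u j) * co H i.
  by rewrite -(vanishing_functional sp vb) addrC subrK.
have := hw L LA; rewrite (eq_dlin _ bE) dlinD !dlinZ => /(fdvd_lin (F := dlin (co H))) h.
apply: (cop_unit (p := alpha L) c0); move: h.
rewrite linearD !linearZ /= [dlin (co H) (dlin (co H) w)]extv_same scaler0 addr0.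
by apply=> d x; rewrite linearZ.
Qed.

Definition eulerv (m : nat) (i : 'I_m) : {mpoly K[m]} := 'X_i.

(** With E the Euler field, alpha_X w is on H the sum of the contraction of d alpha_X /\ w by E and
    of d alpha_X /\ (contraction of w by E). The contraction of w is again in N(A'), so
    [block_dvd_dlin] applies to both terms. *)
Lemma block_dvd X w : X \in traces -> logN A' w ->
  fdvd (f (block X)) (alpha X *: fpull G w).
Proof.
move=> XB hw.
have hEw : logN A' (conv (@eulerv l) w).
  by apply: logN_conv => // L LA; exists 1; rewrite mulr1 alphaE.
have pE : fpull G (conv (@eulerv l) w) = conv (@eulerv n) (fpull G w).
  by rewrite /fpull (@conv_pull _ _ f l n _ (@eulerv n) (@eulerv l)) // => i; rewrite /= /eulerv substX.
have := block_dvd_dlin XB hEw; rewrite pE /dlin extv_conv => h1.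
have := block_dvd_dlin XB hw => h2.
have h3 : fdvd (f (block X)) (conv (@eulerv n) (dlin (co X) (fpull G w))).
  by apply: fdvd_lin h2 => c x; rewrite linearZ.
have := fdvdD h1 h3; rewrite subrK.
by rewrite alphaE.
Qed.

Definition resrel (w : form S l) (z : form T n) : Prop :=
  defpoly traces *: fpull G w = f (defpoly A') *: z.

Lemma res_exists w : logN A' w -> exists2 z, resrel w z & logN traces z.
Proof.
move=> hw; rewrite /resrel.
have uB : uniq traces by apply: fset_uniq.
have [z zE] : fdvd (f (defpoly A')) (defpoly traces *: fpull G w).
  rewrite defpoly_blocks rmorph_prod; apply: fdvd_prod => //.
    by move=> X Y XB YB XY; apply/block_cop => //; apply/cop_block => //; apply: traces_cop.
  move=> X XB; rewrite /defpoly (bigD1_seq X) //= mulrC -scalerA.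
  by apply/fdvdZ/block_dvd.
exists z => // X XB; have [mu muE] := block_dvd_dlin XB hw.
(* The other blocks are coprime to alpha_X, so the condition at X can be checked after cancelling
   the block of X alone. *)
have fA : f (defpoly A') = f (block X) * \prod_(Y <- traces | Y != X) f (block Y).
  by rewrite defpoly_blocks (bigD1_seq X) //= rmorphM; congr (_ * _); apply: rmorph_prod.
have P0 : f (block X) != 0.
  by have := subst_defpoly_neq0; rewrite fA mulf_eq0 negb_or => /andP[].
have := congr1 (dlin (co X)) zE; rewrite !linearZ /= muE fA.
rewrite scalerA mulrC -!scalerA => /(form_scaleI P0) e.
have cR : cop (alpha X) (\prod_(Y <- traces | Y != X) f (block Y)).
  rewrite -big_filter; apply: cop_prodr => Y; rewrite mem_filter => /andP[YX YB].
  by apply: cop_block => //; apply: traces_cop => //; rewrite eq_sym.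
apply: cR; rewrite -e /defpoly (bigD1_seq X) //= -scalerA.
by apply: fdvd_scale; exists 1; rewrite mulr1.
Qed.

Lemma resrel_uniq w z z' : resrel w z -> resrel w z' -> z = z'.
Proof.
by move=> e e'; apply: (form_scaleI subst_defpoly_neq0); rewrite -[LHS]e -[RHS]e'.
Qed.

Lemma resrelP c w w' z z' : resrel w z -> resrel w' z' ->
  resrel (c *: w + w') (f c *: z + z').
Proof.
rewrite /resrel => e e'.
have sw p q (x : form T n) : p *: (q *: x) = q *: (p *: x) by rewrite !scalerA mulrC.
rewrite fpullP !scalerDr (sw (defpoly traces) (f c)) e.
by rewrite (sw _ (f c)) e'.
Qed.

Lemma fpull_ker_logN w : logN A' w -> fpull G w = 0 -> logN A w.
Proof.
move=> hw w0 L LA; have [Rh [u sp]] := H_split.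
have [->|LH] := eqVneq L H; first by rewrite alphaE; apply/(fpull_ker sp).
by apply: hw; rewrite !inE LH.
Qed.

Lemma logN_fpull w : logN A w -> fpull G w = 0.
Proof.
move=> hw; have [Rh [u sp]] := H_split.
by apply/(fpull_ker sp); rewrite -alphaE; apply: hw.
Qed.

Lemma resrel0 w : logN A' w -> (resrel w 0 <-> logN A w).
Proof.
move=> hw; rewrite /resrel scaler0; split=> [e|/logN_fpull ->]; last by rewrite scaler0.
apply: fpull_ker_logN => //; apply: (form_scaleI (defpoly_neq0 traces_arr)).
by rewrite e scaler0.
Qed.

Lemma logN_alpha w : logN A' w -> logN A (alpha H *: w).
Proof.
move=> hw L LA; rewrite linearZ.
have [->|LH] := eqVneq L H; first by apply: fdvd_scale; exists 1; rewrite mulr1.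
by apply: fdvdZ; apply: hw; rewrite !inE LH.
Qed.
End Restrict.
End LogForms.

(** * Rational forms *)

Section RationalForms.
Variables (K : fieldType) (l : nat).
Local Notation S := {mpoly K[l]}.
Implicit Types (A : {fset {vspace 'rV[K]_l}}) (w : form S l).

Definition to_rat w : ratform K l := [ffun I : {set 'I_l} => tofrac (w I)].

Lemma to_ratP c w v : to_rat (c *: w + v) = c *: to_rat w + to_rat v.
Proof. by apply/ffunP => I; rewrite !ffunE tofracD tofracM. Qed.

Lemma to_ratZ c w : to_rat (c *: w) = c *: to_rat w.
Proof. by apply/ffunP => I; rewrite !ffunE tofracM. Qed.

Lemma to_rat_inj : injective to_rat.
Proof.
move=> w v e; apply/ffunP => I; have := congr1 (fun u : ratform K l => u I) e.
by rewrite !ffunE => /eqP; rewrite tofrac_eq => /eqP.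
Qed.

Lemma ratform_scaleI (c : S) (w v : ratform K l) : c != 0 -> c *: w = c *: v -> w = v.
Proof.
move=> c0 e; apply/ffunP => I; have := congr1 (fun u : ratform K l => u I) e.
by rewrite !ffunE => /mulfI; apply; rewrite tofrac_eq0.
Qed.

Lemma regular_formE p (w : ratform K l) :
  regular_form p w <-> exists2 v, pform p v & w = to_rat v.
Proof.
split=> [rw|[v vp ->] I].
  have [v vE] := choice (fun I => (rw I).2).
  have e : w = to_rat [ffun I => v I] by apply/ffunP => I; rewrite !ffunE vE.
  exists [ffun I => v I] => // I Ip; rewrite ffunE; apply/eqP.
  by rewrite -tofrac_eq0 -vE (rw I).1.
split=> [Ip|]; rewrite ffunE; last by exists (v I).
by rewrite vp // tofrac0.
Qed.

Lemma mderiv_alpha i (L : {vspace 'rV[K]_l}) : mderiv i (alpha L) = (co L i)%:MP.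
Proof.
rewrite /alpha raddf_sum (bigD1 i) //= mderivZ mderivX mnm1E eqxx scale1r.
have -> : (U_(i) - U_(i))%MM = 0%MM :> 'X_{1..l} by apply/mnmP => k; rewrite mnmBE subnn mnm0E.
rewrite mpolyX0.
rewrite -mul_mpolyC mulr1 big1 ?addr0 // => j ji.
by rewrite mderivZ mderivX mnm1E (negbTE ji) scale0r scaler0.
Qed.

Lemma wedge_dpoly (L : {vspace 'rV[K]_l}) w :
  wedge (dpoly (alpha L)) (to_rat w) = to_rat (dlin (co L) w).
Proof.
apply/ffunP => J; rewrite !ffunE /dlin /extv sum_ffunE rmorph_sum.
under eq_bigr => I _ do rewrite ffunE mulr_suml mulr_sumr.
rewrite (exchange_big_dep xpredT) //=; apply: eq_bigr => i _.
rewrite !ffunE; case: (boolP (i \in J)) => iJ; last first.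
  rewrite mulr0 tofrac0 big_pred0 // => I.
  by apply/negP => /andP[IJ /eqP e]; move: IJ; rewrite e sub1set (negbTE iJ).
rewrite (big_pred1 [set i]%SET) => [|I /=]; last first.
  by case: eqVneq => [->|]; rewrite ?andbF // sub1set iJ.
rewrite ffunE mderiv_alpha rmorphM rmorphM rmorphXn rmorphN1 mulrCA; congr (_ * (_ ^+ _ * _)).
(* For I = [set i] the inversions of the shuffle are the pairs (i, u) with u in J and u < i. *)
rewrite /below; transitivity #|[set (i, u) | u in [set u in J | (u < i)%N]]|; last first.
  by apply: card_imset => u v [].
apply: eq_card => -[a b]; rewrite !inE /=; apply/idP/imsetP => [/and3P[/eqP -> /andP[_ bJ] bi]|[u]].
  by exists b; rewrite // inE bJ.
rewrite inE => /andP[uJ ui] [-> ->]; rewrite eqxx ui uJ andbT /=.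
by rewrite andbT; apply/eqP => e; move: ui; rewrite e ltnn.
Qed.

Definition logP A p w : Prop := pform p w /\ logN A w.

Lemma logP_closed0 A p : logP A p 0.
Proof. by split; [move=> I _; rewrite ffunE|apply: logN0]. Qed.

Lemma logP_closedP A p c w v : logP A p w -> logP A p v -> logP A p (c *: w + v).
Proof.
move=> [pw nw] [pv nv]; split; last exact: logNP.
by move=> I Ip; rewrite !ffunE pw // pv // mulr0 addr0.
Qed.

Lemma log_formE A p (w : ratform K l) :
  log_form A p w <-> exists2 v, logP A p v & defpoly A *: w = to_rat v.
Proof.
split=> [[/regular_formE[v vp vE] hw]|[v [vp nv] vE]].
  exists v => //; split=> // L LA; have [r /regular_formE[x _ ->] e] := hw L LA.
  have [y yE] : fdvd (alpha L) (dlin (co L) v).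
    exists x; apply: to_rat_inj; rewrite to_ratZ -wedge_dpoly -vE -e.
    have := wedgeP (dpoly (alpha L)) (defpoly A) w 0.
    by rewrite wedge0 !addr0 => ->.
  by exists y.
split; first by apply/regular_formE; exists v.
move=> L LA; have [y yE] := nv L LA.
(* [logN] says nothing about the degree of the quotient y, so its homogeneous part is taken. *)
exists (to_rat (hpart p.+1 y)).
  by apply/regular_formE; exists (hpart p.+1 y) => //; apply: hpart_pform.
have := wedgeP (dpoly (alpha L)) (defpoly A) w 0.
rewrite wedge0 !addr0 => <-; rewrite vE wedge_dpoly -to_ratZ; congr to_rat.
by rewrite -(hpart_id vp) /dlin -hpart_extv -/(dlin _ _) yE linearZ.
Qed.

Definition Np A p : lmodType S := sub_mod (mksub (@logP_closed0 A p) (@logP_closedP A p)).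

Lemma NpP A p (x : Np A p) : logP A p (sub_incl x).
Proof. by have /asboolP := valP x. Qed.

Lemma Np_ex A p w : logP A p w -> exists x : Np A p, sub_incl x = w.
Proof. by move=> /asboolP h; exists (exist _ w h). Qed.

Lemma Omega_iso A p : arrangement A ->
  exists k : {linear Np A p -> Omega A p}, [/\ injective k, surj k &
    forall x, defpoly A *: (val (k x) : ratform K l) = to_rat (sub_incl x)].
Proof.
move=> hA; have Q0 : defpoly A != 0.
  rewrite /defpoly prodf_seq_neq0; apply/allP => X XB /=.
  exact/alpha_neq0/hA.
pose q : {fraction S} := (tofrac (defpoly A))^-1.
have qK : tofrac (defpoly A) * q = 1 by rewrite mulfV // tofrac_eq0.
pose h (x : Np A p) : ratform K l := [ffun I : {set 'I_l} => q * tofrac ((sub_incl x) I)].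
have hE x : defpoly A *: h x = to_rat (sub_incl x).
  by apply/ffunP => I; rewrite !ffunE mulrA qK mul1r.
have hL : linear h.
  move=> c x y; apply: (ratform_scaleI Q0); rewrite hE [sub_incl _]linearP to_ratP.
  by rewrite -!hE scalerDr !scalerA mulrC.
have vL : linear (fun x : Omega A p => val x : ratform K l) by move=> c x y; rewrite linearP.
have [|x|k kE] := @lin_factor _ (Omega A p) (ratform K l) (Np A p) (mklin vL) (mklin hL).
- exact: val_inj.
- have hx : h x \in log_pred A p.
    by apply/asboolP/log_formE; exists (sub_incl x); [apply: NpP|apply: hE].
  by exists (exist _ (h x) hx).
exists k; split=> [x y e|y|x]; last by rewrite -hE -[h x]kE.
  apply/sub_incl_inj/to_rat_inj; rewrite -!hE; congr (_ *: _).
  by rewrite -[h x]kE e [LHS]kE.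
have /asboolP/log_formE[v lv vE] := valP y; have [x xE] := Np_ex lv.
exists x; apply/val_inj/(ratform_scaleI Q0); rewrite vE -xE -hE; congr (_ *: _).
exact: kE.
Qed.

Lemma pdl_Np A p q : arrangement A -> pdl q (Omega A p : lmodType S) <-> pdl q (Np A p).
Proof.
move=> hA; have [k [kI kS _]] := Omega_iso p hA.
split; last exact: (pdl_iso (f := k)).
have [k' [kk' k'k]] := lin_inv kI kS.
apply: (pdl_iso (f := k')); first exact: can_inj k'k.
by move=> x; exists (k x).
Qed.

Lemma free_generators A : arrangement A -> free_arr A ->
  exists e : 'I_l -> form S l, (forall i, logP A 1 (e i)) /\
    forall w, logP A 1 w -> exists s : 'I_l -> S, w = \sum_i s i *: e i.
Proof.
move=> hA [b bE]; have [k [kI kS _]] := Omega_iso 1 hA.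
have /choice[c cE] := fun i => kS (b i).
exists (fun i => sub_incl (c i)); split=> [i|w /Np_ex[x <-]]; first exact: NpP.
have [s [sE _]] := bE (k x); exists s.
rewrite -[in RHS](eq_bigr _ (fun i _ => linearZ _ _)) -linear_sum; congr sub_incl.
by apply: kI; rewrite sE linear_sum; apply: eq_bigr => i _; rewrite linearZ /= cE.
Qed.
End RationalForms.

(** * Free arrangements *)

Section FreeArrangement.
Variables (K : fieldType) (l : nat) (A : {fset {vspace 'rV[K]_l}}).
Local Notation S := {mpoly K[l]}.
Hypotheses (hA : arrangement A) (fA : free_arr A).
Local Notation Q := (defpoly A).

Let Q0 : Q != 0. Proof. exact: defpoly_neq0. Qed.

Lemma alpha_dvd_defpoly L : L \in A -> exists c, Q = alpha L * c.
Proof.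
by move=> LA; rewrite /defpoly (bigD1_seq L) ?fset_uniq //=; eexists.
Qed.

Lemma defpoly_fdvd w : (forall L, L \in A -> fdvd (alpha L) w) -> fdvd Q w.
Proof.
move=> h; apply: fdvd_prod => [|L M LA MA|//]; first exact: fset_uniq.
by apply: alpha_cop; apply: hA.
Qed.

Lemma logN_defpoly w : logN A (Q *: w).
Proof. by move=> L LA; rewrite linearZ; apply/fdvd_scale/alpha_dvd_defpoly. Qed.

Lemma pform_ext1_form1 j : pform 1 (ext1 j (form1 S l)).
Proof.
rewrite -dlin_delta; apply: pform_extv => I; rewrite cards_eq0 => /negbTE I0.
by rewrite ffunE I0.
Qed.

Lemma dlin_form1_set1 (a : 'I_l -> K) j : dlin a (form1 S l) [set j]%SET = (a j)%:MP.
Proof. by rewrite /dlin extv_set1 ffunE eqxx mulr1. Qed.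

(* The rows of h are the coefficients of a basis of log 1-forms, multiplied by
   Q. *)
Lemma free_matrices : exists h c : 'I_l -> 'I_l -> S,
  [/\ forall i k, \sum_j c i j * h j k = (k == i)%:R * Q,
      forall i k, \sum_j h i j * c j k = (k == i)%:R * Q,
      forall i L, L \in A -> exists r (v : 'I_l -> S),
        forall k, h i k = r * (co L k)%:MP + alpha L * v k
    & forall i L, L \in A -> exists s, \sum_j (co L j)%:MP * c j i = alpha L * s].
Proof.
have [e [eP eG]] := free_generators hA fA.
pose h i j : S := e i [set j]%SET.
have gen w : logP A 1 w -> exists s : 'I_l -> S, forall k, w [set k]%SET = \sum_i s i * h i k.
  move=> /eG[s ->]; exists s => k; rewrite sum_ffunE; apply: eq_bigr => i _.
  by rewrite ffunE.
have /choice[c cE] : forall j, exists s : 'I_l -> S, forall k,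
    (Q *: ext1 j (form1 S l)) [set k]%SET = \sum_i s i * h i k.
  move=> j; apply: gen; split; last exact: logN_defpoly.
  by move=> I Ip; rewrite ffunE pform_ext1_form1 // mulr0.
have ch i k : \sum_j c i j * h j k = (k == i)%:R * Q.
  rewrite -cE ffunE -dlin_delta dlin_form1_set1 mulrC eq_sym.
  by case: (k == i); rewrite ?mpolyC1 ?mpolyC0.
have hc i k : \sum_j h i j * c j k = (k == i)%:R * Q.
  (* The relation C Hm = Q with det C <> 0 forces Hm C = Q, through the adjugate of C. *)
  pose C := \matrix_(i, j) c i j; pose Hm := \matrix_(i, j) h i j.
  have CH : C *m Hm = Q%:M.
    apply/matrixP => i' k'; rewrite !mxE -[in RHS](mulr_natl Q) [_ == k']eq_sym -ch.
    by apply: eq_bigr => j _; rewrite !mxE.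
  have dC : \det C != 0.
    have := congr1 determinant CH; rewrite det_mulmx det_scalar => d.
    have : \det C * \det Hm != 0 by rewrite d expf_neq0.
    by rewrite mulf_eq0 negb_or => /andP[].
  have e0 : \det C *: (Hm *m C - Q%:M) = 0.
    rewrite -mul_scalar_mx -mul_adj_mx -mulmxA mulmxBr mulmxA CH.
    by rewrite mul_scalar_mx mul_mx_scalar subrr mulmx0.
  move/eqP: e0; rewrite scalemx_eq0 (negbTE dC) /= subr_eq0 => /eqP e0.
  have := congr1 (fun M : 'M_l => M i k) e0; rewrite !mxE => e1.
  rewrite [k == i]eq_sym mulr_natl -e1; apply: eq_bigr => j _.
  by rewrite !mxE.
exists h, c; split=> // i L LA.
  have hL := hA LA; have [x x1] := hyperplane_transversal hL.
  have [y yE] := (eP i).2 L LA.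
  pose u j : S := (x 0 j)%:MP.
  (* Contraction with x, where alpha_L takes the value 1, splits the i-th row into a multiple of d
     alpha_L and a multiple of alpha_L. *)
  exists (conv u (e i) finset.set0), (fun k => conv u y [set k]%SET) => k.
  have := conv_extv u (fun j => (co L j)%:MP) (e i).
  rewrite -/(dlin _ _) -/(dlin _ _) yE.
  have -> : \sum_j (co L j)%:MP * u j = 1 :> S.
    rewrite -mpolyC1 -x1 /dual rmorph_sum; apply: eq_bigr => j _.
    by rewrite /u [RHS]mpolyCM.
  rewrite scale1r => /esym /(canRL (subrK _)) eE.
  rewrite /h [in LHS]eE ffunE /dlin extv_set1 addrC mulrC; congr (_ + _).
  by rewrite linearZ ffunE.
have [q qE] := alpha_dvd_defpoly LA.
have q0 : q != 0 by apply: contraNneq Q0 => q0; rewrite qE q0 mulr0.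
(* The form (Q / alpha_L) d alpha_L lies in N(A). Multiplying its expression in the rows of h by c
   shows that the columns of c are logarithmic vector fields. *)
have [|s sE] := gen (q *: dlin (co L) (form1 S l)).
  split.
    move=> I Ip; rewrite ffunE; suff -> : dlin (co L) (form1 S l) I = 0 by rewrite mulr0.
    apply: (pform_extv (p := 0)) Ip => J; rewrite cards_eq0 => /negbTE J0.
    by rewrite ffunE J0.
  move=> M MA; rewrite linearZ; have [->|ML] := eqVneq M L.
    by rewrite /= [dlin _ (dlin _ _)]extv_same scaler0; apply: fdvd0.
  apply: (alpha_cop (hA MA) (hA LA) ML); rewrite scalerA -qE.
  exact/fdvd_scale/alpha_dvd_defpoly.
exists (s i); apply: (mulfI q0).
transitivity (\sum_k \sum_j s j * (h j k * c k i)).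
  rewrite mulr_sumr; apply: eq_bigr => k _.
  have := sE k; rewrite ffunE dlin_form1_set1 mulrA => ->.
  by rewrite mulr_suml; apply: eq_bigr => j _; rewrite mulrA.
rewrite exchange_big /= mulrA [q * _]mulrC -qE mulrC.
under eq_bigr => j _ do rewrite -mulr_sumr hc [i == j]eq_sym mulrA.
by rewrite -mulr_suml sum_delta.
Qed.

Section Frame.
Variables h c : 'I_l -> 'I_l -> S.
Hypothesis ch : forall i k, \sum_j c i j * h j k = (k == i)%:R * Q.
Hypothesis hc : forall i k, \sum_j h i j * c j k = (k == i)%:R * Q.
Hypothesis hlog : forall i L, L \in A -> exists r (v : 'I_l -> S),
  forall k, h i k = r * (co L k)%:MP + alpha L * v k.
Hypothesis clog : forall i L, L \in A -> exists s, \sum_j (co L j)%:MP * c j i = alpha L * s.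

(** Coordinates of a form with respect to the rational 1-forms omega_j, the rows of h divided by Q:
    by [ch], dx_i is the sum of the c i j omega_j. *)
Definition frame : form S l -> form S l := pull (idfun : {rmorphism S -> S}) c.

(** Each coefficient is reached by contracting w with columns of c, logarithmic vector fields that
    preserve N(A). This reduces to degree 0, where every alpha_L divides the coefficient. *)
Lemma frame_coef w : logN A w -> exists g, frame w = Q *: g.
Proof.
move=> hw; suff : forall I, exists r, frame w I = Q * r.
  move=> /choice[g gE]; exists [ffun I => g I].
  by apply/ffunP => I; rewrite !ffunE gE.
move=> I; move: {2}#|I| (erefl #|I|) => k; elim: k I w hw => [|k IH] I w hw Ik.
  have -> : I = finset.set0 by apply/eqP; rewrite -cards_eq0 Ik.
  rewrite /frame pull_set0 /=.
  have [v vE] : fdvd Q (w finset.set0 *: form1 S l).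
    apply: defpoly_fdvd => L LA; have [x x1] := hyperplane_transversal (hA LA).
    have [y yE] := hw L LA.
    exists ((\sum_j (x 0 j)%:MP * y [set j]%SET) *: form1 S l).
    rewrite scalerA; congr (_ *: _); rewrite mulr_sumr.
    rewrite -[LHS]mul1r -mpolyC1 -x1 /dual rmorph_sum mulr_suml.
    apply: eq_bigr => j _.
    have := congr1 (fun z : form S l => z [set j]%SET) yE.
    rewrite !ffunE /dlin extv_set1 /= => e.
    by rewrite mulrCA -e mpolyCM mulrCA mulrA.
  exists (v finset.set0).
  by have := congr1 (fun z : form S l => z finset.set0) vE; rewrite !ffunE eqxx mulr1.
have [i iI] : exists i, i \in I by apply/card_gt0P; rewrite Ik.
have Ik' : #|I :\ i| = k by move: Ik; rewrite (cardsD1 i) iI => -[].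
have hcw : logN A (conv (fun j => c j i) w) by apply: logN_conv => // L LA; apply: clog.
have [r rE] := IH (I :\ i) _ hcw Ik'.
have e : con1 i (frame w) = frame (conv (fun j => c j i) w).
  rewrite /frame -(conv_pull (v := fun k => (k == i)%:R)).
    by rewrite /conv (bigD1 i) //= eqxx scale1r big1 ?addr0 // => j /negbTE ->; rewrite scale0r.
  by move=> j; rewrite sum_delta.
exists ((-1) ^+ below i (I :\ i) * r).
have := congr1 (fun z : form S l => z (I :\ i)) e; rewrite rE ffunE !inE eqxx /= setD1K //.
move=> /(congr1 (fun z => (-1) ^+ below i (I :\ i) * z)).
rewrite mulrA -exprD addnn -mul2n exprM sqrrN !expr1n mul1r => ->.
by rewrite mulrCA.
Qed.

(** Modulo alpha_L the i-th row of h is a multiple of d alpha_L, so alpha_L divides its product with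
    w; hence omega_i /\ w is polynomial, and it stays in N(A). *)
Lemma frame_ext w i : logN A w -> exists2 v, logN A v & extv (h i) w = Q *: v.
Proof.
move=> hw.
have dec L : L \in A -> exists r (v : 'I_l -> S), forall x : form S l,
    extv (h i) x = r *: dlin (co L) x + alpha L *: extv v x.
  move=> LA; have [r [v vE]] := hlog i LA; exists r, v => x.
  by rewrite (eq_extv _ vE) extvD !extvZ.
have [v vE] : fdvd Q (extv (h i) w).
  apply: defpoly_fdvd => L LA; have [r [v ->]] := dec L LA.
  apply: fdvdP; first exact: hw.
  by apply: fdvd_scale; exists 1; rewrite mulr1.
exists v => // L LA; have [q qE] := alpha_dvd_defpoly LA.
have a0 := alpha_neq0 (hA LA).
have [r [x xE]] := dec L LA; have [y yE] := hw L LA.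
have := congr1 (dlin (co L)) vE; rewrite xE linearD !linearZ /=.
rewrite [dlin _ (dlin _ w)]extv_same scaler0 add0r [dlin _ (extv x w)]extv_anti.
rewrite -/(dlin _ _) yE linearZ /= qE -scalerA => /(form_scaleI a0) e.
have cq : cop (alpha L) q.
  have -> : q = \prod_(M <- A | M != L) alpha M.
    by apply: (mulfI a0); rewrite -qE /defpoly (bigD1_seq L) ?fset_uniq.
  rewrite -big_filter; apply: cop_prodr => M; rewrite mem_filter => /andP[ML MA].
  by apply: alpha_cop; [apply: hA|apply: hA|rewrite eq_sym].
apply: cq; rewrite -e; apply: fdvdN; apply: fdvd_scale.
by exists 1; rewrite mulr1.
Qed.

(** In frame coordinates the operator of [frame_ext] is [ext1 i], so these operators generate all
    coordinate vectors from that of Q. *)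
Lemma frame_surj g : exists2 w, logN A w & frame w = Q *: g.
Proof.
move: g; apply: form_ind => [d x y [x' nx ex] [y' ny ey]||i g [w nw ew]].
- exists (d *: x' + y'); first exact: logNP.
  by rewrite /frame pullP -!/(frame _) ex ey scalerDr !scalerA mulrC.
- exists (Q *: form1 S l); first exact: logN_defpoly.
  by rewrite /frame pullZ pull_form1.
have [v nv ve] := frame_ext i nw; exists v => //; apply: (form_scaleI Q0).
transitivity (frame (extv (h i) w)); first by rewrite ve /frame pullZ.
rewrite /frame pull_extv -/(frame w) ew -extv_delta.
rewrite linearZ /=; congr (_ *: _); rewrite -extvZ; apply: eq_extv => k.
by rewrite hc mulrC.
Qed.

(** Pulling back once more along h multiplies the coefficient at I by Q to the power #|I|. *)
Lemma frame_inj w : frame w = 0 -> w = 0.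
Proof.
move=> /(congr1 (pull (idfun : {rmorphism S -> S}) h)); rewrite pull0 /frame pull_comp => e.
set P := pull _ _ in e.
have PE v I : P v I = Q ^+ #|I| * v I.
  move: v I; apply: form_ind => [d x y hx hy I|I|i x hx I].
  - by rewrite /P pullP /= !ffunE -!/P hx hy mulrDr mulrCA.
  - rewrite /P pull_form1 ffunE; case: eqP => [->|_]; last by rewrite mulr0.
    by rewrite cards0 mul1r.
  rewrite /P pull_ext1 -/P.
  have -> : extv (fun k => \sum_j idfun (c i j) * h j k) (P x) = Q *: ext1 i (P x).
    rewrite -extv_delta -extvZ; apply: eq_extv => k.
    by rewrite [RHS]mulrC -(ch i k).
  rewrite !ffunE; case: ifP => iI; rewrite ?mulr0 // -/P hx.
  by rewrite [#|I|](cardsD1 i) iI exprS; ring.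
apply/ffunP => I; have := congr1 (fun v : form S l => v I) e.
rewrite PE ffunE => /eqP.
by rewrite mulf_eq0 expf_eq0 (negbTE Q0) andbF /= => /eqP.
Qed.
End Frame.
End FreeArrangement.

(** * Surjectivity of the residue for a free arrangement *)

Section FreeRestriction.
Variables (K : fieldType) (l : nat) (A : {fset {vspace 'rV[K]_l}}) (H : {vspace 'rV[K]_l}).
Variable phi : 'Hom('rV[K]_(\dim H), 'rV[K]_l).
Hypotheses (hA : arrangement A) (HA : H \in A).
Hypotheses (k0 : lker phi = 0%VS) (im : limg phi = H).
Local Notation n := (\dim H).
Local Notation G := (mat_of phi).
Local Notation f := (subst G).
Local Notation S := {mpoly K[l]}.
Local Notation T := {mpoly K[n]}.
Local Notation A' := (A `\ H)%fset.
Local Notation B := (traces A phi).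

(** In terms of residues: Q(B) z always lifts, B being the set of traces. *)
Lemma lift_zero z : exists2 w, logN A' w & fpull G w = f (defpoly A') *: z.
Proof.
have [Rh [u sp]] := H_split hA HA k0 im.
exists (defpoly A' *: fpull Rh z); last by rewrite fpullZ (fpull_section sp).
by apply: logN_defpoly => L /delA[].
Qed.

(** In terms of residues: (Q(B) / alpha_X) z lifts. Contraction with a vector transversal to X
    writes z = alpha_X z1 + d alpha_X /\ z2; both terms are extended using one L with trace X, and R
    takes care of the other hyperplanes. *)
Lemma lift_codim1 X z : X \in B -> logN B z -> exists2 w, logN A' w &
  alpha X *: fpull G w = f (defpoly A') *: z.
Proof.
move=> XB zB; have [Rh [u sp]] := H_split hA HA k0 im.
have hB := traces_arr hA HA k0 im.
have /tracesP[L LA XL] := XB.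
have [c c0 cE] := co_trace hA HA k0 im LA.
have [x x1] := hyperplane_transversal (hB _ XB).
pose v : 'I_n -> T := fun k => (x 0 k)%:MP.
have [mu muE] := zB X XB.
have [z1 [z2 zE]] : exists z1 z2 : form T n, z = alpha X *: z1 + dlin (co X) z2.
  exists (conv v mu), (conv v z).
  have := conv_extv v (fun k => (co X k)%:MP) z.
  rewrite -/(dlin _ _) -/(dlin _ _) muE linearZ /=.
  have -> : \sum_k (co X k)%:MP * v k = 1 :> T.
    by rewrite -mpolyC1 -x1 /dual rmorph_sum; apply: eq_bigr => k _; rewrite [RHS]mpolyCM.
  by rewrite scale1r => /esym/(canRL (subrK _)).
rewrite -XL in cE.
have fL : f (alpha L) = c%:MP * alpha X.
  by rewrite !alphaE subst_lin -linZ; apply: eq_lin.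
pose R := \prod_(M <- A' | M != L) alpha M.
have QR : defpoly A' = alpha L * R by rewrite /defpoly (bigD1_seq L) ?fset_uniq.
exists (R *: (alpha L *: fpull Rh z1 + dlin (co L) (fpull Rh z2))).
  move=> M MA; have [->|ML] := eqVneq M L.
    rewrite linearZ; apply: fdvdZ; rewrite linearD linearZ /=.
    rewrite [dlin _ (dlin _ _)]extv_same addr0.
    by apply: fdvd_scale; exists 1; rewrite mulr1.
  rewrite linearZ; apply: fdvd_scale; rewrite /R -big_filter (bigD1_seq M) //=.
  - by eexists.
  - by rewrite mem_filter ML.
  - by rewrite filter_uniq ?fset_uniq.
rewrite fpullZ fpullD fpullZ fpull_dlin.
rewrite !(fpull_section sp).
rewrite (eq_dlin _ cE) dlinZ fL -scalerA -scalerDr -zE !scalerA.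
by rewrite QR rmorphM /= fL; congr (_ *: _); ring.
Qed.

Hypothesis fA : free_arr A.

(** The crude lift w0 has residue Q(B) z, and alpha_H w0 has frame coordinates Q g0. Comparison with
    the lift at each X shows that alpha_X divides g0 on H, so g0 = Qt g + alpha_H k with [Qt]
    extending Q(B) to V. By [frame_surj] and [frame_inj] this becomes an equation in N(A);
    cancelling alpha_H, which is coprime to [Qt], gives w0 = Qt w + wk with wk restricting to 0. *)
Lemma free_res_surj z : logN B z -> exists2 w, logN A' w & resrel A phi w z.
Proof.
move=> zB; have [Rh [u sp]] := H_split hA HA k0 im.
have hB := traces_arr hA HA k0 im.
have [h [c [ch hc hlog clog]]] := free_matrices hA fA.
have Q0 : defpoly A != 0 by apply: defpoly_neq0.
have a0 : alpha H != 0 by apply/alpha_neq0/hA.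
have [w0 n0 e0] := lift_zero z.
have [g0 g0E] := frame_coef hA clog (logN_alpha n0).
have coef_ker (g : form S l) : (forall I, f (g I) = 0) -> exists k, g = alpha H *: k.
  move=> e; have /choice[k kE] : forall I, exists r, g I = alpha H * r.
    by move=> I; rewrite alphaE; apply/(subst_ker sp)/e.
  by exists [ffun I => k I]; apply/ffunP => I; rewrite !ffunE kE.
have /choice[gb gbE] : forall I, exists r, f (g0 I) = defpoly B * r.
  move=> I; have [|v vE] := @defpoly_fdvd _ _ B hB (f (g0 I) *: form1 T n); last first.
    exists (v finset.set0).
    by have := congr1 (fun x : form T n => x finset.set0) vE; rewrite !ffunE eqxx mulr1.
  move=> X XB.
  have [wX nX eX] := lift_codim1 XB zB.
  have [gX gXE] := frame_coef hA clog (logN_alpha nX).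
  pose bt := subst Rh (alpha X).
  have btE : f bt = alpha X by rewrite (subst_section sp).
  (* The two forms agree on H, so their difference lies in N(A); hence g0 and bt gX agree modulo
     alpha_H. *)
  have nk : logN A (w0 - bt *: wX).
    apply: (fpull_ker_logN hA HA k0 im).
      exact: logNB n0 (logNZ bt nX).
    by rewrite fpullB fpullZ btE eX e0 subrr.
  have [k kE] := frame_coef hA clog nk.
  have ge : g0 - bt *: gX = alpha H *: k.
    apply: (form_scaleI Q0).
    rewrite scalerBr -g0E [defpoly A *: (bt *: gX)]scalerA mulrC -scalerA -gXE.
    rewrite [RHS]scalerA mulrC -scalerA -kE /frame.
    rewrite -[bt *: _](pullZ (idfun : {rmorphism S -> S}) c bt) -pullB.
    rewrite -[RHS](pullZ (idfun : {rmorphism S -> S})); congr (pull _ _ _).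
    by rewrite scalerBr !scalerA mulrC.
  apply: fdvd_scale; exists (f (gX I)).
  have -> : g0 = bt *: gX + alpha H *: k by rewrite -ge addrC subrK.
  rewrite !ffunE rmorphD !rmorphM /= btE [in alpha H]alphaE.
  by have -> : f (lin (co H)) = 0 by [apply: subst_a sp]; rewrite mul0r addr0.
pose g : form S l := [ffun I : {set 'I_l} => subst Rh (gb I)].
pose Qt := subst Rh (defpoly B).
have QtE : f Qt = defpoly B by rewrite (subst_section sp).
have [k kE] : exists k, g0 - Qt *: g = alpha H *: k.
  apply: coef_ker => I.
  by rewrite !ffunE rmorphB rmorphM /= QtE (subst_section sp) gbE subrr.
have [ws nws ews] := frame_surj hA hc hlog g.
have [wk nwk ewk] := frame_surj hA hc hlog k.
have frE : alpha H *: w0 = Qt *: ws + alpha H *: wk.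
  apply/eqP; rewrite -subr_eq0; apply/eqP/(frame_inj hA ch).
  rewrite /frame in ews ewk g0E *.
  rewrite pullB pullD (pullZ _ _ Qt) (pullZ _ _ (alpha H) wk) g0E ews ewk /=.
  rewrite !scalerA ![_ * defpoly A]mulrC -!scalerA -scalerDr -scalerBr.
  by rewrite opprD addrA kE subrr scaler0.
have [w wE] : fdvd (alpha H) ws.
  have : cop (alpha H) Qt.
    by rewrite alphaE; apply: (lin_cop sp); rewrite QtE; apply: defpoly_neq0.
  apply; exists (w0 - wk); rewrite scalerBr frE addrK //.
have w0E : w0 = Qt *: w + wk.
  apply: (form_scaleI a0); rewrite frE wE scalerDr !scalerA mulrC //.
exists w.
  move=> L LA; have [hL LH] := delA hA LA.
  apply: (alpha_cop hL (hA HA) LH).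
  have := nws L; rewrite wE linearZ; apply.
  by move: LA; rewrite !inE => /andP[].
rewrite /resrel -e0 w0E fpullD fpullZ QtE.
by rewrite (logN_fpull hA HA k0 im nwk) addr0.
Qed.
End FreeRestriction.

(** * Locally free arrangements *)

Section LocallyFree.
Variables (K : fieldType) (l : nat) (A : {fset {vspace 'rV[K]_l}}) (H : {vspace 'rV[K]_l}).
Variable phi : 'Hom('rV[K]_(\dim H), 'rV[K]_l).
Hypotheses (hA : arrangement A) (HA : H \in A).
Hypotheses (k0 : lker phi = 0%VS) (im : limg phi = H).
Local Notation n := (\dim H).
Local Notation G := (mat_of phi).
Local Notation f := (subst G).
Local Notation S := {mpoly K[l]}.
Local Notation T := {mpoly K[n]}.
Local Notation A' := (A `\ H)%fset.
Local Notation B := (traces A phi).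

Definition liftable (z : form T n) : Prop := exists2 w, logN A' w & resrel A phi w z.

Lemma liftableP t z z' : liftable z -> liftable z' -> liftable (t *: z + z').
Proof.
move=> [w nw ew] [w' nw' ew']; have [Rh [u sp]] := H_split hA HA k0 im.
exists (subst Rh t *: w + w'); first exact: logNP.
by rewrite -{2}(subst_section sp t); apply: resrelP.
Qed.

Lemma liftable0 : liftable 0.
Proof.
exists 0; first exact: logN0.
by rewrite /resrel fpull0 !scaler0.
Qed.

Hypothesis fA : locally_free_along A (mem H).

(** The localization at x = phi y is free and its traces are those containing y, so z lifts for it.
    Multiplying the lift by the alpha_L with x outside L restores the conditions at these L, at the
    cost of the factor formed by the traces missing y. *)
Lemma liftable_local (y : 'rV[K]_n) z : y != 0 -> logN B z ->
  liftable ((\prod_(X <- B | y \notin X) alpha X) *: z).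
Proof.
move=> y0 zB; set x := phi y.
have xH : x \in H by apply: mem_limg.
have x0 : x != 0.
  apply: contraNneq y0 => e; rewrite -memv0 -k0 memv_ker; exact/eqP.
pose C := localization A x.
have CP L : (L \in C) = (L \in A) && (x \in L) by rewrite !inE.
have hC : arrangement C by move=> L; rewrite CP => /andP[/hA].
have HC : H \in C by rewrite CP HA.
have BC X : (X \in traces C phi) = (X \in B) && (y \in X).
  apply/tracesP/andP => [[L]|[/tracesP[L LA ->]]].
    rewrite !inE => /and3P[LH LA xL] ->; rewrite (mem_trace im) xL; split=> //.
    by apply/tracesP; exists L; rewrite // !inE LH.
  rewrite (mem_trace im) => xL; exists L => //; move: LA.
  by rewrite !inE => /andP[-> ->] /=.
have zC : logN (traces C phi) z by apply: logN_sub zB => X; rewrite BC => /andP[].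
have [w nw ew] := free_res_surj hC HC k0 im (fA xH x0) zC.
pose R := \prod_(L <- A' | x \notin L) alpha L.
have split_prod m (E F : {fset {vspace 'rV[K]_m}}) (p : 'rV[K]_m) :
    (forall X, (X \in F) = (X \in E) && (p \in X)) ->
    defpoly E = defpoly F * \prod_(X <- E | p \notin X) alpha X.
  move=> EF; rewrite /defpoly (bigID (fun X : {vspace 'rV[K]_m} => p \in X)) /=.
  congr (_ * _); rewrite -big_filter; apply: perm_big.
  apply: uniq_perm; rewrite ?filter_uniq ?fset_uniq // => X.
  by rewrite mem_filter EF andbC.
exists (R *: w).
  move=> L LA; rewrite linearZ; case: (boolP (x \in L)) => xL.
    apply: fdvdZ; apply: nw; move: LA; rewrite !inE => /andP[-> ->] /=.
    by rewrite xL.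
  apply: fdvd_scale; rewrite /R -big_filter (bigD1_seq L) //=.
  - by eexists.
  - by rewrite mem_filter xL.
  - by rewrite filter_uniq ?fset_uniq.
rewrite /resrel (split_prod _ B (traces C phi) y BC).
rewrite (split_prod _ A' (C `\ H)%fset x) => [|L]; last first.
  by rewrite !inE andbA.
rewrite fpullZ -/R rmorphM /=.
have := ew; rewrite /resrel => e.
set g := \prod_(X <- _ | _) _.
transitivity ((g * f R) *: (defpoly (traces C phi) *: fpull G w)).
  by rewrite !scalerA; congr (_ *: _); ring.
by rewrite e !scalerA; congr (_ *: _); ring.
Qed.

(** Traces with no common point but 0 have forms spanning the dual space: M has trivial left kernel,
    and a right inverse provides the coefficients. *)
Lemma span_var (U : seq {vspace 'rV[K]_n}) (i : 'I_n) :
  (forall X, X \in U -> X \in B) ->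
  (forall y : 'rV[K]_n, (forall X, X \in U -> y \in X) -> y = 0) ->
  exists b : 'I_(size U) -> K, 'X_i = \sum_j (b j)%:MP * alpha (tnth (in_tuple U) j) :> T.
Proof.
move=> UB U0; have hB := traces_arr hA HA k0 im.
pose M := \matrix_(i < n, j < size U) co (tnth (in_tuple U) j) i.
have : row_free M.
  rewrite -kermx_eq0; apply/eqP/row_matrixP => k; rewrite row0; apply: U0 => X XU.
  have [j jE] : exists j, X = tnth (in_tuple U) j.
    by have /tnthP[j ->] : X \in in_tuple U by []; exists j.
  rewrite memE; last by apply/hB/UB.
  have := congr1 (fun N : 'M_(_, _) => N k j) (mulmx_ker M).
  rewrite !mxE => e; apply/eqP; rewrite -[RHS]e; apply: eq_bigr => i' _.
  by rewrite !mxE -jE mulrC.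
case/row_freeP => N MN; exists (fun j => N j i).
rewrite -[LHS]lin_delta.
have -> : \sum_j (N j i)%:MP * alpha (tnth (in_tuple U) j) =
    lin (fun k => \sum_j M k j * N j i).
  under eq_bigr => j _ do rewrite alphaE /lin mulr_sumr.
  rewrite exchange_big; apply: eq_bigr => k _; rewrite rmorph_sum mulr_suml.
  by apply: eq_bigr => j _; rewrite /= !mxE mpolyCM; ring.
apply: eq_lin => k; have := congr1 (fun N : 'M_n => N k i) MN.
by rewrite !mxE eq_sym => <-.
Qed.

(* Nullstellensatz for ideals containing enough products of linear forms: the
   traces contained in J + (alpha X, X in U) are enlarged one at a time. *)
Lemma liftable_var_power (i : 'I_n) z : logN B z -> exists N, liftable ('X_i ^+ N *: z).
Proof.
move=> zB; pose J (s : T) := liftable (s *: z).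
have J0 : J 0 by rewrite /J scale0r; apply: liftable0.
have JD s s' : J s -> J s' -> J (s + s').
  by move=> h h'; have := liftableP 1 h h'; rewrite scale1r -scalerDl.
have JM s t : J s -> J (t * s).
  by move=> h; have := liftableP t h liftable0; rewrite addr0 scalerA.
(* The ideal J + (alpha X, X in U), unfolded one generator at a time. *)
pose JU := fix JU (U : seq {vspace 'rV[K]_n}) (s : T) : Prop :=
  if U is X :: U' then exists t, JU U' (s - t * alpha X) else J s.
have JUJ U s : J s -> JU U s.
  elim: U s => [//|X U IHU] s hs /=.
  by exists 0; rewrite mul0r subr0; apply: IHU.
have JUD U s s' : JU U s -> JU U s' -> JU U (s + s').
  elim: U s s' => [|X U IHU] s s' /=; first exact: JD.
  move=> [t h] [t' h']; exists (t + t').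
  by rewrite mulrDl opprD addrACA; apply: IHU.
have JUM U s t : JU U s -> JU U (t * s).
  elim: U s => [|X U IHU] s /=; first exact: JM.
  by move=> [t' h]; exists (t * t'); rewrite -mulrA -mulrBr; apply: IHU.
have JUin U (X : {vspace 'rV[K]_n}) : X \in U -> JU U (alpha X).
  elim: U => [//|Y U IHU]; rewrite inE => /predU1P[->|/IHU h] /=.
    by exists 1; rewrite mul1r subrr; apply: JUJ.
  by exists 0; rewrite mul0r subr0.
suff main m (U : seq {vspace 'rV[K]_n}) : size [seq X <- B | X \notin U] = m -> (forall X, X \in U -> X \in B) ->
    exists N, JU U ('X_i ^+ N).
  by have [//|N hN] := main _ [::] erefl; exists N.
elim/ltn_ind: m U => m IH U Um UB.
(* If the traces in U meet only at 0, their forms generate 'X_i. Otherwise they have a common point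
   y <> 0, to which [liftable_local] applies; every trace missing y is then outside U. *)
case: (pselect (forall y : 'rV[K]_n, (forall X, X \in U -> y \in X) -> y = 0)) => [U0|].
  have [b bE] := span_var i UB U0; exists 1%N; rewrite expr1 bE.
  apply: (big_ind (JU U)) => [||k _]; [exact: JUJ|exact: JUD|].
  by apply/JUM/JUin; apply: mem_tnth.
move=> /existsNP[y /not_implyP[yU /eqP y0]].
have prodJ := liftable_local y0 zB.
have step (s : seq {vspace 'rV[K]_n}) :
    (forall X, X \in s -> X \in B /\ y \notin X) ->
    exists N j t, JU U j /\ 'X_i ^+ N = j + t * \prod_(X <- s) alpha X.
  elim: s => [|X s IHs] sB.
    by exists 0%N, 0, 1; split; [apply: JUJ|rewrite big_nil add0r mulr1].
  have [|N [j [t [hj e]]]] := IHs; first by move=> Y Ys; apply: sB; rewrite inE Ys orbT.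
  have [XB yX] := sB X (mem_head _ _).
  have XU : X \notin U by apply: contra yX => /yU.
  have [||N' [t' hj']] := IH _ _ (X :: U) erefl.
  - rewrite -Um; apply: (@uniq_leq_size _ (X :: _)) => /= [|Y].
      by rewrite mem_filter mem_head /= filter_uniq ?fset_uniq.
    rewrite inE => /predU1P[->|]; first by rewrite mem_filter XU.
    by rewrite !mem_filter inE negb_or => /andP[/andP[_ ->] ->].
  - move=> Y; rewrite inE => /predU1P[->//|]; exact: UB.
  set j' := 'X_i ^+ N' - _ in hj'.
  (* Multiply 'X_i ^+ N = j + t P, with P the product over s, by 'X_i ^+ N' = j' + t' alpha X: all
     terms but t t' alpha X P lie in the ideal. *)
  exists (N + N')%N, (t' * alpha X * j + 'X_i ^+ N * j'), (t * t').
  split; first by apply: JUD; apply: JUM.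
  have e' : 'X_i ^+ N' = j' + t' * alpha X by rewrite subrK.
  by rewrite exprD e' e big_cons; ring.
have [|N [j [t [hj e]]]] := step [seq X <- enum_fset B | y \notin (X : {vspace _})].
  by move=> X; rewrite mem_filter => /andP[].
exists N; rewrite e; apply: JUD => //; apply/JUM/JUJ.
by rewrite big_filter.
Qed.
End LocallyFree.

(** * The residue map onto the restriction, and descent to the hyperplane *)

Section Assembly.
Variables (K : fieldType) (l : nat) (A : {fset {vspace 'rV[K]_l}}) (H : {vspace 'rV[K]_l}).
Variable phi : 'Hom('rV[K]_(\dim H), 'rV[K]_l).
Hypotheses (hA : arrangement A) (HA : H \in A).
Hypotheses (k0 : lker phi = 0%VS) (im : limg phi = H).
Local Notation n := (\dim H).
Local Notation G := (mat_of phi).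
Local Notation f := (subst G : {rmorphism {mpoly K[l]} -> {mpoly K[\dim H]}}).
Local Notation S := {mpoly K[l]}.
Local Notation T := {mpoly K[n]}.
Local Notation A' := (A `\ H)%fset.
Local Notation B := (traces A phi).

Lemma form_projective (R : comNzRingType) m : projective (form R m : lmodType R).
Proof.
move=> X Y g h gS; have /choice[x xE] := fun I => gS (h (dform R I)).
have kL : linear (fun w : form R m => \sum_I w I *: x I).
  move=> c w v; rewrite scaler_sumr -big_split; apply: eq_bigr => I _ /=.
  by rewrite !ffunE scalerDl scalerA.
exists (mklin kL) => w /=; rewrite linear_sum [in RHS](dform_expand w) linear_sum.
by apply: eq_bigr => I _; rewrite !linearZ /= xE.
Qed.

(** The module is a first syzygy of the quotient of the free module of all forms by it, which gains
    one over Hilbert's bound n. *)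
Lemma pdl_Np_submax p m : n = m.+1 -> pdl m (Np B p).
Proof.
move=> nm; have [Q [q [qS qE]]] := quotient_exists (mksub (@logP_closed0 K n B p) (@logP_closedP K n B p)).
apply: (@pdl_left _ m (Np B p) (form T n) Q (@sub_incl _ _ _) q).
- split=> [|//|w]; first exact: sub_incl_inj.
  rewrite qE; split=> [wU|[x <-]]; last exact: (valP x).
  by exists (to_sub wU).
- by apply: (@pdl_leq _ 0) => //; apply: form_projective.
by rewrite -nm; apply: syzygy.
Qed.

Lemma resrel_pform p w z : pform p w -> resrel A phi w z -> pform p z.
Proof.
move=> pw e I Ip; apply: (mulfI (subst_defpoly_neq0 hA HA k0 im)).
have := congr1 (fun v : form T n => v I) e; rewrite !ffunE mulr0 => <-.
by rewrite -(hpart_id pw) /fpull pull_hpart !ffunE (negbTE Ip) mulr0.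
Qed.

Lemma resrel_hpart p w z : resrel A phi w z -> resrel A phi (hpart p w) (hpart p z).
Proof.
rewrite /resrel => e.
have := congr1 (hpart p) e; rewrite !linearZ /= => <-.
by congr (_ *: _); apply: pull_hpart.
Qed.

Variable p : nat.
Hypotheses (pA : pdl p (Np A p)) (pA' : pdl p (Np A' p)).
Hypotheses (pn : (p.+2 <= n)%N) (fA : locally_free_along A (mem H)).

Lemma residue_map : exists r : {linear Np A' p -> restr f (Np B p)},
  forall w, resrel A phi (sub_incl w) (sub_incl (r w : Np B p)).
Proof.
have /choice[r rE] : forall w : Np A' p, exists z : Np B p, resrel A phi (sub_incl w) (sub_incl z).
  move=> w; have [pw nw] := NpP w.
  have [z ez nz] := res_exists hA HA k0 im nw.
  have [|x xE] := @Np_ex K n B p z; first by split=> //; apply: resrel_pform ez.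
  by exists x; rewrite xE.
have rL : linear (r : Np A' p -> restr f (Np B p)).
  move=> c x y; apply: sub_incl_inj.
  apply: (resrel_uniq hA HA k0 im (rE _)).
  have eR : sub_incl (f c *: r x + r y) = f c *: sub_incl (r x) + sub_incl (r y).
    exact: linearP.
  rewrite [sub_incl (c *: x + y)]linearP.
  by have := resrelP c (rE x) (rE y); rewrite -eR.
by exists (mklin rL).
Qed.

Lemma residue_surj (r : {linear Np A' p -> restr f (Np B p)}) :
  (forall w, resrel A phi (sub_incl w) (sub_incl (r w : Np B p))) ->
  surj r /\ pdl p.+1 (restr f (Np B p) : lmodType S).
Proof.
move=> rE.
have lE : l = n.+1 by have /eqP := hA HA.
have [Rh [u sp]] := H_split hA HA k0 im.
(* Q is the image I of r, presented as a quotient of the source, and r' is its inclusion into the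
   target. *)
have [Q [q [qS qE]]] := quotient_exists (Submodule (ker_closed r)).
have [|r' r'E] := lin_descend qS (h := r).
  by move=> x /qE; rewrite /in_mem /= => /eqP.
have r'I : injective r'.
  move=> x y e; apply/eqP; rewrite -subr_eq0; have [z zE] := qS (x - y).
  rewrite -zE; apply/eqP/qE; rewrite /in_mem /=; apply/eqP.
  by rewrite -r'E zE linearB e subrr.
have [|x|j jE] := @lin_factor _ (Np A' p) (form S l) (Np A p) (@sub_incl _ _ _) (@sub_incl _ _ _).
- exact: sub_incl_inj.
- have [px nx] := NpP x; apply: Np_ex; split=> //.
  by apply: logN_sub nx => L; rewrite !inE => /andP[].
have jses : ses j q.
  split=> [x y e|//|w]; first by apply: sub_incl_inj; rewrite -!jE e.
  have [pw nw] := NpP w.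
  have -> : q w = 0 <-> logN A (sub_incl w).
    rewrite -(resrel0 hA HA k0 im nw) qE /in_mem /=; split=> [/eqP rw|e].
      by have := rE w; rewrite rw.
    apply/eqP/sub_incl_inj; exact: (resrel_uniq hA HA k0 im (rE w) e).
  split=> [nw'|[x <-]]; last by rewrite jE; have [] := NpP x.
  have [x xE] := Np_ex (conj pw nw'); exists x.
  by apply: sub_incl_inj; rewrite jE.
have pQ : pdl p.+1 Q by apply: (pdl_right jses) => //; apply: pdl_mono.
(* The condition of [acyc_pdl] reads 1 + (p + 1) < l, that is p + 2 <= n. *)
have aQ : acyc [seq 'X_j : S | j <- enum 'I_l] Q 1.
  apply: (@acyc_pdl _ _ l p.+1) => // [P k pP kl|]; last by rewrite lE; lia.
  exact: projective_acyc.
pose P (z : Np B p) := exists y, r' y = z.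
have PP t z z' : P z -> P z' -> P (t *: z + z').
  move=> [y yE] [y' y'E]; exists (subst Rh t *: y + y').
  by rewrite linearP yE y'E restrE /= (subst_section sp).
have P0 : P 0 by exists 0; rewrite linear0.
have Plift t (z : Np B p) : liftable A phi (t *: sub_incl z) -> P (t *: z).
  move=> [w nw ew]; have [|x xE] := @Np_ex K l A' p (hpart p w).
    by split; [apply: hpart_pform|apply: logN_hpart].
  exists (q x); rewrite r'E; apply: sub_incl_inj.
  apply: (resrel_uniq hA HA k0 im (rE x)); rewrite xE.
  have [ptz _] := NpP (t *: z).
  have eZ : sub_incl (t *: z) = t *: sub_incl z by exact: linearZ.
  by have := resrel_hpart p ew; rewrite -eZ (hpart_id ptz).
(* Vanishing of the first Koszul cohomology provides y with every 'X_k killing r' y - z. Now 'X_k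
   acts through its restriction lin (G k), which is nonzero for some k, and forms over T have no
   torsion. *)
have Psat z : (forall i : 'I_n, P ('X_i *: z)) -> P z.
  move=> Pz; have [|y yE] := acyc_saturated (x := z : restr f (Np B p)) aQ r'I.
    move=> a /mapP[k _ ->]; have : P (lin (G k) *: z).
      rewrite /lin scaler_suml; apply: (big_ind P) => // [x y Px Py|i _].
        by rewrite -[x]scale1r; apply: PP.
      by rewrite -scalerA -[_ *: _]addr0; apply: PP.
    case=> y yE; exists y; rewrite yE restrE.
    exact: (congr1 (fun t => t *: z) (esym (substX G k))).
  have [i0 _] : exists i0 : 'I_n, True.
    have n0 : (0 < n)%N by lia.
    by exists (Ordinal n0).
  have [k Gk] : exists k, lin (G k) != 0.
    apply: contrapT => h.
    have G0 k : G k i0 = 0.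
      apply: lin_eq0; apply/eqP; apply: contrapT => /negP Gk; apply: h; by exists k.
    have := split_RG sp i0 i0; rewrite eqxx big1 => [/eqP|k _]; last by rewrite G0 mulr0.
    by rewrite eq_sym oner_eq0.
  exists y; apply/eqP; rewrite -subr_eq0; apply/eqP.
  have := yE 'X_k (map_f _ (mem_enum _ k)); rewrite restrE /= substX => e.
  apply: sub_incl_inj; apply: (form_scaleI Gk).
  by rewrite -[LHS]linearZ /= [X in sub_incl X]e !linear0.
have Pall z : P z.
  have /choice[e eE] : forall i : 'I_n, exists N, P ('X_i ^+ N *: z).
    move=> i; have [pz nz] := NpP z.
    by have [N hN] := liftable_var_power hA HA k0 im fA i nz; exists N; apply: Plift.
  (* Induction on the sum of the exponents: if none is 0, [Psat] reduces z to the multiples 'X_i z,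
     for each of which one exponent has dropped. *)
  move: {2}(\sum_i e i)%N (leqnn (\sum_i e i)) => m.
  elim: m e z eE => [|m IH] e z eE em.
    have n0 : (0 < n)%N by lia.
    have := eE (Ordinal n0); suff -> : e (Ordinal n0) = 0%N by rewrite expr0 scale1r.
    by move: em; rewrite leqn0 sum_nat_eq0 => /forallP /(_ (Ordinal n0)) /eqP.
  have [/existsP[i /eqP ei]|/existsPn en0] := boolP [exists i, e i == 0%N].
    by have := eE i; rewrite ei expr0 scale1r.
  apply: Psat => i; apply: (IH (fun k => if k == i then (e i).-1 else e k)).
    move=> k; case: eqVneq => [->|_].
      by rewrite scalerA -exprSr prednK ?lt0n ?en0 //; apply: eE.
    by rewrite scalerA mulrC -scalerA -[_ *: _]addr0; apply: PP.
  rewrite (bigD1 i) //= eqxx; move: em; rewrite (bigD1 i) //=.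
  rewrite [X in _ -> (_ + X <= m)%N](eq_bigr e); last by move=> k /negbTE ->.
  by have := en0 i; lia.
have r'S : surj r' by move=> z; have [y <-] := Pall z; exists y.
split; last exact: (pdl_iso r'I r'S).
by move=> z; have [y <-] := r'S z; have [x <-] := qS y; exists x.
Qed.

Lemma pdl_Np_restr : pdl p (Np B p).
Proof.
have [r rE] := residue_map; have [_ pM] := residue_surj rE.
have [Rh [u sp]] := H_split hA HA k0 im.
(* The derivative along the transversal vector u, restricted to H; it sends the form of H to its
   value at u, which is 1. *)
pose D (s : S) : T := f (\sum_i (u i)%:MP * mderiv i s).
apply: (@pdl_change_rings S T f (subst Rh) (lin (co H)) D _ _ _ _ _ _ _ p (Np B p) pM).
- exact: (subst_section sp).
- exact: (subst_a sp).
- exact: (subst_retract sp).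
- move=> s t; rewrite /D -rmorphD -big_split; congr (f _); apply: eq_bigr => i _.
  by rewrite linearD mulrDr.
- move=> s t; rewrite /D -!rmorphM -rmorphD; congr (f _).
  rewrite mulr_sumr mulr_suml -big_split; apply: eq_bigr => i _ /=.
  by rewrite mderivM; ring.
- rewrite /D (_ : \sum_i _ = 1) ?rmorph1 // -mpolyC1 -(split_au sp) rmorph_sum.
  by apply: eq_bigr => i _; rewrite -alphaE mderiv_alpha [RHS]mpolyCM mulrC.
by move=> P pP; apply: (projective_regular _ (split_au sp) pP).
Qed.
End Assembly.

Theorem theorem1p8 (K : fieldType) (l : nat)
    (A : {fset {vspace 'rV[K]_l}}) (H : {vspace 'rV[K]_l}) :
  arrangement A ->
  H \in A ->
  tame A ->
  tame (A `\ H)%fset ->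
  locally_free_along A (mem H) ->
  tame_in H (restriction A H).
Proof.
move=> hA HA tA tA' fA phi k0 im p pn; apply: pdl_pd_le.
have hB := traces_arr hA HA k0 im.
have hA' : arrangement (A `\ H)%fset by move=> L /(delA hA)[].
have lE : l = (\dim H).+1 by have /eqP := hA _ HA.
apply/(pdl_Np p p hB).
(* The two top degrees come from Hilbert's theorem and from its sharpening for submodules of a free
   module; below them p + 2 <= \dim H. *)
have [e|ne] := eqVneq p (\dim H); first by rewrite {1}e; apply: syzygy.
have [e|ne'] := eqVneq p.+1 (\dim H); first exact: pdl_Np_submax.
have p2 : (p.+2 <= \dim H)%N by lia.
have pl : (p <= l)%N by lia.
by apply: pdl_Np_restr => //; apply/pdl_Np/pd_le_pdl => //; [apply: tA|apply: tA'].
Qed.
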